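(* Given a string $S[1..n]$ over $[1..\sigma]$, a set $\Gamma\subseteq[1..n]$, and an integer $k\geq 1$, one can check whether $\Gamma$ is a minimal $k$-attractor of $S$ in $\mathcal O(n\log n)$ time and $\mathcal O(n\log|\Gamma|)$ words of space.
   Context: A set $\Gamma\subseteq[1..n]$ is a $k$-attractor of $S$ if every substring $S[i..j]$ with $i\leq j<i+k$ has an occurrence $S[i'..j']=S[i..j]$ with $j''\in[i'..j']$ for some $j''\in\Gamma$. It is a minimal $k$-attractor if it is a $k$-attractor and $\Gamma\setminus\{j\}$ is not a $k$-attractor for any $j\in\Gamma$. Model: word RAM with words of $\Theta(\log n)$ bits. *)

(* Defs.v *)
From mathcomp Require Import all_boot finmap.

Set Implicit Arguments.
Unset Strict Implicit.
Unset Printing Implicit Defensive.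

Local Open Scope fset_scope.

(* Positions are 1-based; substr x i j is x[i..j] when 1 <= i <= j <= size x. *)
Definition substr (x : seq nat) (i j : nat) : seq nat :=
  take (j.+1 - i) (drop i.-1 x).

Definition k_attractor (k : nat) (x : seq nat) (Gamma : {fset nat}) : Prop :=
  (forall p, p \in Gamma -> 1 <= p <= size x) /\
  forall i j, 1 <= i -> i <= j -> j <= size x -> j < i + k ->
    exists i' j' p,
      [/\ 1 <= i', i' <= j' & j' <= size x] /\
      [/\ substr x i' j' = substr x i j, p \in Gamma & i' <= p <= j'].

Definition minimal_k_attractor (k : nat) (x : seq nat) (Gamma : {fset nat}) :
    Prop :=
  k_attractor k x Gamma /\
  forall j, j \in Gamma -> ~ k_attractor k x (Gamma `\ j).

(* Floor of the binary logarithm, rounded up to 1 so that bounds such as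
   O(n log m) do not degenerate for m <= 1. *)
Definition lg (m : nat) : nat := maxn 1 (trunc_log 2 m).

(* A word RAM with w-bit words: a fixed program, a register file (of which a
   program can only name finitely many registers) and a memory addressed by
   words. Words are the naturals below 2 ^ w; arithmetic is modulo 2 ^ w. *)

Inductive binop :=
  OpAdd | OpSub | OpMul | OpDiv | OpAnd | OpOr | OpXor | OpShl | OpShr.

Inductive instr :=
  | Const of nat & nat           (* Const d c   : r_d <- c                *)
  | Bin of binop & nat & nat & nat (* Bin o d a b : r_d <- r_a o r_b      *)
  | Read of nat & nat            (* Read d a    : r_d <- mem[r_a]         *)
  | Write of nat & nat           (* Write a b   : mem[r_a] <- r_b         *)
  | Jmp of nat                   (* Jmp l       : goto l                  *)
  | Jeq of nat & nat & nat       (* Jeq a b l   : if r_a = r_b goto l     *)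
  | Jlt of nat & nat & nat       (* Jlt a b l   : if r_a < r_b goto l     *)
  | Halt of bool.                (* Halt v      : stop with answer v      *)

Definition program := seq instr.

Record config := Config { pc : nat; regs : nat -> nat; memory : nat -> nat }.

Definition upd (f : nat -> nat) (a v : nat) : nat -> nat :=
  fun b => if b == a then v else f b.

Definition eval_binop (w : nat) (o : binop) (x y : nat) : nat :=
  match o with
  | OpAdd => x + y
  | OpSub => x + 2 ^ w - y
  | OpMul => x * y
  | OpDiv => x %/ y
  | OpAnd => Nat.land x y
  | OpOr => Nat.lor x y
  | OpXor => Nat.lxor x y
  | OpShl => x * 2 ^ y
  | OpShr => x %/ 2 ^ y
  end %% 2 ^ w.

Definition step (w : nat) (I : instr) (c : config) : config :=
  let: Config q r m := c in
  match I with
  | Const d v => Config q.+1 (upd r d (v %% 2 ^ w)) m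
  | Bin o d a b => Config q.+1 (upd r d (eval_binop w o (r a) (r b))) m
  | Read d a => Config q.+1 (upd r d (m (r a))) m
  | Write a b => Config q.+1 r (upd m (r a) (r b))
  | Jmp l => Config l r m
  | Jeq a b l => Config (if r a == r b then l else q.+1) r m
  | Jlt a b l => Config (if r a < r b then l else q.+1) r m
  | Halt _ => c
  end.

(* The number of initial memory cells needed to contain the cell accessed. *)
Definition extent (I : instr) (c : config) : nat :=
  match I with
  | Read _ a | Write a _ => (regs c a).+1
  | _ => 0
  end.

(* run w P c t m v: from c, P halts after t unit-cost instructions with answer
   v, accessing only memory cells 0, ..., m - 1. Jumping outside P never
   halts. *)
Inductive run (w : nat) (P : program) :
    config -> nat -> nat -> bool -> Prop :=
  | run_halt c v : onth P (pc c) = Some (Halt v) -> run w P c 1 0 v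
  | run_step c I t m v :
      onth P (pc c) = Some I -> (forall b, I <> Halt b) ->
      run w P (step w I c) t m v ->
      run w P c t.+1 (maxn (extent I c) m) v.

Definition init (w : nat) (input : seq nat) : config :=
  Config 0 (fun=> 0) (fun a => nth 0 input a %% 2 ^ w).

(* The memory occupied by the input counts towards the space. *)
Definition computes (w : nat) (P : program) (input : seq nat)
    (v : bool) (time space : nat) : Prop :=
  exists m, run w P (init w input) time m v /\ space = maxn (size input) m.

(* One word per item; the set of positions is given as a list g, in an
   arbitrary order. *)
Definition encode (sigma k : nat) (x g : seq nat) : seq nat :=
  [:: size x; sigma; k; size g] ++ x ++ g.

(* Main.v *)
From HB Require Import structures.
Require Import Defs.
From mathcomp Require Import all_boot finmap zify.

(** Fix a string and, for each length [l], group the positions by the next [l]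
    letters.  Write Cr(u) for the elements of the set that lie in some
    occurrence of u.  Along an edge of the suffix tree the occurrences of u do
    not change and Cr(u) grows with u, so it is enough to look at the shortest
    word u of each edge: the set is a k-attractor iff Cr(u) is never empty for
    those of length at most k, and it is minimal iff in addition every element
    p has some such u with Cr(u) = {p}.

    These words are visited by decreasing length.  The boundaries between
    consecutive suffixes of the suffix array are removed in decreasing order of
    longest common prefix; when a boundary of value a is about to disappear, the
    two blocks it separates are tested for the length a + 1.  A block may be a
    union of several classes, which is harmless: if Cr of the union is empty, or
    contained in {p}, then so is Cr of each class.
    A segment tree over the suffix array, with values in the flat lattice
    "none, exactly p, at least two", gives Cr of a block in logarithmic time; its
    leaves change only when the length drops below the distance to the next or
    the second next element of the set.

    The suffix array comes from radix sort and prefix doubling, the common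
    prefixes from Kasai's algorithm, and the order of the removals from another
    radix sort on the bits of the keys, which costs O(n w) = O(n log n). *)

Set Implicit Arguments.
Unset Strict Implicit.
Unset Printing Implicit Defensive.

(** * A structured language with arrays *)

(** The bound concerns a concrete list of instructions, which shapes the algorithm: no recursion and
    no explicit suffix tree, only loops over a fixed number of arrays of equal length. Programs are
    verified in a small language whose clock is part of the postcondition, and are compiled once,
    with a constant slowdown.

    Sweeping by decreasing length keeps the updates few: blocks only merge and windows only shrink,
    so a leaf can pass only from the top to an atom to the bottom. Together with the n boundaries
    this makes 3 n events, each of logarithmic cost, and arrays of 4 n + 8 words have room for them.
    Space is thus linear, which lies within the claimed bound because [lg] is at least 1.

    No instruction returns w, so the program has to measure it before it can sort by bits. *)

Inductive hop := HAdd | HSub | HDiv | HAddW | HBit.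
Inductive expr := V of nat | N of nat | Op of hop & expr & expr | Get of nat & expr.
Inductive bexpr := Eq of expr & expr | Lt of expr & expr.
Inductive cmd :=
  | Skip
  | Asg of nat & expr
  | Put of nat & expr & expr
  | Seq of cmd & cmd
  | If of bexpr & cmd & cmd
  | While of bexpr & cmd.

Definition For (v : nat) (lo : expr) (u : nat) (body : cmd) : cmd :=
  Seq (Asg v lo)
      (While (Lt (V v) (V u)) (Seq body (Asg v (Op HAdd (V v) (N 1))))).

(** [Nat.eqb] rather than [==], here and in [memb], lets [cbn] decide accesses at concrete register
    and array numbers. *)
Definition set {T : Type} (f : nat -> T) (v : nat) (x : T) : nat -> T :=
  fun u => if Nat.eqb u v then x else f u.

Lemma eqbE (u v : nat) : Nat.eqb u v = (u == v).
Proof. by elim: u v => [|u IH] [|v] //=; rewrite IH. Qed.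

Lemma setE T (f : nat -> T) v x u : set f v x u = if u == v then x else f u.
Proof. by rewrite /set eqbE. Qed.

Fixpoint memb (v : nat) (s : seq nat) : bool :=
  if s is u :: s' then Nat.eqb v u || memb v s' else false.

Lemma memb_cat v s1 s2 : memb v (s1 ++ s2) = memb v s1 || memb v s2.
Proof. by elim: s1 => //= u s1 ->; rewrite orbA. Qed.

Fixpoint modv (c : cmd) : seq nat :=
  match c with
  | Asg v _ => [:: v]
  | Seq c1 c2 | If _ c1 c2 => modv c1 ++ modv c2
  | While _ c => modv c
  | _ => [::]
  end.
Fixpoint moda (c : cmd) : seq nat :=
  match c with
  | Put j _ _ => [:: j]
  | Seq c1 c2 | If _ c1 c2 => moda c1 ++ moda c2
  | While _ c => moda c
  | _ => [::]
  end.

Definition regfile := nat -> nat.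
Definition arrays := nat -> nat -> nat.

(* Register 59 holds the common length B of the arrays, registers from 60 on
   are temporaries; array j lives in cells j * B, ..., j * B + B - 1. *)
Definition nvar := 59.
Definition narr := 16.

Section Semantics.
Variables (w B : nat).
Local Notation W := (2 ^ w).

Definition opeval (o : hop) (x y : nat) : nat :=
  match o with
  | HAdd => x + y
  | HSub => x - y
  | HDiv => x %/ y
  | HAddW => (x + y) %% W
  | HBit => odd (x %/ 2 ^ y)
  end.
(** Under these conditions arithmetic on naturals agrees with that of the machine. [HAddW] wraps
    around on purpose: [word_bits] measures w with it. *)
Definition opsafe (o : hop) (x y : nat) : Prop :=
  match o with
  | HAdd => x + y < W
  | HSub => y <= x
  | _ => True
  end.
Fixpoint eval (e : expr) (r : regfile) (a : arrays) : nat :=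
  match e with
  | V v => r v
  | N c => c
  | Op o e1 e2 => opeval o (eval e1 r a) (eval e2 r a)
  | Get j e1 => a j (eval e1 r a)
  end.
Fixpoint safe (e : expr) (r : regfile) (a : arrays) : Prop :=
  match e with
  | V v => True
  | N c => c < W
  | Op o e1 e2 =>
      [/\ safe e1 r a, safe e2 r a & opsafe o (eval e1 r a) (eval e2 r a)]
  | Get j e1 => safe e1 r a /\ eval e1 r a < B
  end.
Definition beval (b : bexpr) (r : regfile) (a : arrays) : bool :=
  match b with
  | Eq e1 e2 => eval e1 r a == eval e2 r a
  | Lt e1 e2 => eval e1 r a < eval e2 r a
  end.
Definition bsafe (b : bexpr) (r : regfile) (a : arrays) : Prop :=
  match b with Eq e1 e2 | Lt e1 e2 => safe e1 r a /\ safe e2 r a end.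

(** Assignments, stores and tests cost one unit whatever the size of their expressions; that size is
    absorbed by the constant [F] at compilation. *)
Inductive exec :
    cmd -> regfile -> arrays -> regfile -> arrays -> nat -> Prop :=
  | exec_skip r a : exec Skip r a r a 0
  | exec_asg v e r a : safe e r a ->
      exec (Asg v e) r a (set r v (eval e r a)) a 1
  | exec_put j e1 e2 r a : safe e1 r a -> safe e2 r a -> eval e1 r a < B ->
      exec (Put j e1 e2) r a r
           (set a j (upd (a j) (eval e1 r a) (eval e2 r a))) 1
  | exec_seq c1 c2 r a r1 a1 t1 r2 a2 t2 :
      exec c1 r a r1 a1 t1 -> exec c2 r1 a1 r2 a2 t2 ->
      exec (Seq c1 c2) r a r2 a2 (t1 + t2)
  | exec_if b c1 c2 r a r1 a1 t : bsafe b r a ->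
      exec (if beval b r a then c1 else c2) r a r1 a1 t ->
      exec (If b c1 c2) r a r1 a1 t.+1
  | exec_while_false b c r a : bsafe b r a -> beval b r a = false ->
      exec (While b c) r a r a 1
  | exec_while_true b c r a r1 a1 t1 r2 a2 t2 :
      bsafe b r a -> beval b r a ->
      exec c r a r1 a1 t1 -> exec (While b c) r1 a1 r2 a2 t2 ->
      exec (While b c) r a r2 a2 (t1 + t2).+1.

(** The frame condition, read off the syntax. The loop rules hand it on, so that an invariant has to
    mention only what the loop changes. *)
Definition agree (c : cmd) (r : regfile) (a : arrays) (r' : regfile)
    (a' : arrays) : Prop :=
  (forall v, memb v (modv c) = false -> r' v = r v) /\
  (forall j, memb j (moda c) = false -> a' j = a j).

Lemma exec_agree c r a r' a' t : exec c r a r' a' t -> agree c r a r' a'.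
Proof.
elim=> {c r a r' a' t} /=.
- by [].
- by move=> v e r a _; split=> // u; rewrite /= orbF /set => ->.
- by move=> j e1 e2 r a _ _ _; split=> // u; rewrite /= orbF /set => ->.
- move=> c1 c2 r a r1 a1 t1 r2 a2 t2 _ [H1 H2] _ [H3 H4].
  by split=> u /=; rewrite memb_cat => /norP[/negbTE h1 /negbTE h2];
    [rewrite H3 // H1 | rewrite H4 // H2].
- move=> b c1 c2 r a r1 a1 t _ _ [H1 H2].
  by split=> u /=; rewrite memb_cat => /norP[/negbTE h1 /negbTE h2];
    [apply: H1 | apply: H2]; case: ifP.
- by [].
- move=> b c r a r1 a1 t1 r2 a2 t2 _ _ _ [H1 H2] _ [H3 H4].
  by split=> u h; [rewrite H3 // H1 | rewrite H4 // H2].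
Qed.

(** Total correctness: the existence of an execution includes termination. The clock t runs through
    the postcondition, so time bounds are proved together with the functional specification. *)
Definition wp (c : cmd) (Q : regfile -> arrays -> nat -> Prop)
    (r : regfile) (a : arrays) (t : nat) : Prop :=
  exists r' a' t', exec c r a r' a' t' /\ Q r' a' (t + t').

Lemma wp_conseq c (Q' Q : regfile -> arrays -> nat -> Prop) r a t :
  wp c Q' r a t ->
  (forall r' a' t', agree c r a r' a' -> Q' r' a' t' -> Q r' a' t') ->
  wp c Q r a t.
Proof.
move=> [r' [a' [t' [h q]]]] hq; exists r', a', t'; split=> //.
by apply: hq q; apply: exec_agree h.
Qed.

Lemma wp_skip (Q : regfile -> arrays -> nat -> Prop) r a t :
  Q r a t -> wp Skip Q r a t.
Proof. by move=> q; exists r, a, 0; rewrite addn0; split=> //; constructor. Qed.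

Lemma wp_asg v e (Q : regfile -> arrays -> nat -> Prop) r a t :
  safe e r a -> Q (set r v (eval e r a)) a t.+1 -> wp (Asg v e) Q r a t.
Proof.
by move=> s q; exists (set r v (eval e r a)), a, 1; rewrite addn1; split=> //; constructor.
Qed.

Lemma wp_put j e1 e2 (Q : regfile -> arrays -> nat -> Prop) r a t :
  safe e1 r a -> safe e2 r a -> eval e1 r a < B ->
  Q r (set a j (upd (a j) (eval e1 r a) (eval e2 r a))) t.+1 ->
  wp (Put j e1 e2) Q r a t.
Proof.
move=> s1 s2 lt q.
by exists r, (set a j (upd (a j) (eval e1 r a) (eval e2 r a))), 1;
  rewrite addn1; split=> //; constructor.
Qed.

Lemma wp_seq c1 c2 Q r a t :
  wp c1 (wp c2 Q) r a t -> wp (Seq c1 c2) Q r a t.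
Proof.
move=> [r1 [a1 [t1 [h1 [r2 [a2 [t2 [h2 q]]]]]]]].
by exists r2, a2, (t1 + t2); rewrite addnA; split=> //; econstructor; eassumption.
Qed.

Lemma wp_if b c1 c2 Q r a t :
  bsafe b r a -> (beval b r a -> wp c1 Q r a t.+1) ->
  (~~ beval b r a -> wp c2 Q r a t.+1) ->
  wp (If b c1 c2) Q r a t.
Proof.
move=> s h1 h2.
have [r1 [a1 [t1 [h q]]]] : wp (if beval b r a then c1 else c2) Q r a t.+1.
  by case E: (beval b r a) h1 h2 => h1 h2; [apply: h1 | apply: h2].
by exists r1, a1, t1.+1; rewrite addnS -addSn; split=> //; constructor.
Qed.

(** Strong induction on the variant m, which also indexes the invariant; an invariant may therefore
    relate the clock to the number of rounds left. *)
Lemma wp_while (I : nat -> regfile -> arrays -> nat -> Prop) m b c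
    (Q : regfile -> arrays -> nat -> Prop) r a t :
  I m r a t ->
  (forall m r' a' t', agree c r a r' a' -> I m r' a' t' ->
    bsafe b r' a' /\
    if beval b r' a' then
      wp c (fun r'' a'' t'' => exists2 m', m' < m & I m' r'' a'' t'') r' a' t'.+1
    else Q r' a' t'.+1) ->
  wp (While b c) Q r a t.
Proof.
move=> i0 step.
suff H r1 a1 t1 : I m r1 a1 t1 -> agree c r a r1 a1 ->
    wp (While b c) Q r1 a1 t1 by apply: H.
elim/ltn_ind: m {i0 t} r1 a1 t1 => m IH r1 a1 t i ag.
have [s] := step m r1 a1 t ag i.
case E: (beval b r1 a1).
  move=> [r2 [a2 [t2 [h [m' lt i']]]]].
  have [A1 A2] := exec_agree h.
  have ag' : agree c r a r2 a2.
    by case: ag => B1 B2; split=> u hu; [rewrite A1 // B1 | rewrite A2 // B2].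
  have [r3 [a3 [t3 [h3 q]]]] := IH m' lt _ _ _ i' ag'.
  exists r3, a3, (t2 + t3).+1; split.
    by apply: exec_while_true h h3.
  by move: q; rewrite !addSn addnS addnA.
move=> q; exists r1, a1, 1; rewrite addn1; split=> //.
exact: exec_while_false.
Qed.

(** Here the clock is an argument of the invariant, as an amortised bound such as that of [kasaiP]
    requires. *)
Lemma wp_for (I : nat -> regfile -> arrays -> nat -> Prop) v lo u body
    (Q : regfile -> arrays -> nat -> Prop) r a t :
  memb u (v :: modv body) = false -> memb v (modv body) = false ->
  safe lo r a -> 1 < W -> r u < W -> eval lo r a <= r u ->
  I (eval lo r a) (set r v (eval lo r a)) a t.+1 ->
  (forall i r' a' t', eval lo r a <= i < r u ->
     agree (Seq (Asg v lo) body) r a r' a' -> r' v = i -> I i r' a' t' ->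
     wp body (fun r'' a'' t'' => I i.+1 (set r'' v i.+1) a'' t''.+1)
        r' a' t'.+1) ->
  (forall r' a' t', agree (Seq (Asg v lo) body) r a r' a' ->
     r' v = r u -> I (r u) r' a' t' -> Q r' a' t'.+1) ->
  wp (For v lo u body) Q r a t.
Proof.
move=> /= Hu Hv s W1 ru le i0 step fin.
apply/wp_seq/wp_asg => //.
set L := eval lo r a in le i0 step *.
have uv : Nat.eqb u v = false by case/norP: (negbT Hu) => /negbTE.
have {}Hu : memb u (modv body) = false by case/norP: (negbT Hu) => _ /negbTE.
apply: (@wp_while (fun m r' a' t' => exists i, [/\ m = r u - i, L <= i <= r u,
  r' v = i, agree (Seq (Asg v lo) body) r a r' a' & I i r' a' t']) (r u - L)).
  exists L; split=> //; [by lia | by rewrite setE eqxx |].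
  by split=> // x /=; rewrite /set => /norP[/negbTE-> _].
move=> m r' a' t' ag [i [-> lei rv ag0 Ii]].
have r'u : r' u = r u by case: ag0 => -> //=; rewrite uv.
split=> //=; rewrite rv r'u.
case: ltnP => lt; last first.
  have e : i = r u by lia.
  by rewrite e in Ii rv; apply: fin.
apply: wp_seq.
have : L <= i < r u by lia.
move=> /step/(_ ag0 rv Ii) h.
apply: (wp_conseq h) => r2 a2 t2 [A1 A2] I2.
have r2v : r2 v = i by rewrite A1.
apply: wp_asg => /=; first by rewrite r2v; split=> //; lia.
rewrite r2v addn1; exists (r u - i.+1); first by lia.
exists i.+1; split=> //; first by lia.
  by rewrite setE eqxx.
split=> x /=.
  move=> hx; case/norP: (negbT hx) => /negbTE h1 /negbTE h2.
  by rewrite /set h1 A1 //; case: ag0 => ->.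
by move=> hx; rewrite A2 //; case: ag0 => _ ->.
Qed.

(** For bodies of uniform cost [T]: the test and the increment add 2 per round, the initialisation
    and the last test add 2 once. *)
Lemma wp_forc (T : nat) (I : nat -> regfile -> arrays -> Prop) v lo u body
    (Q : regfile -> arrays -> nat -> Prop) r a t :
  memb u (v :: modv body) = false -> memb v (modv body) = false ->
  safe lo r a -> 1 < W -> r u < W -> eval lo r a <= r u ->
  I (eval lo r a) (set r v (eval lo r a)) a ->
  (forall i r' a' t', eval lo r a <= i < r u ->
     agree (Seq (Asg v lo) body) r a r' a' -> r' v = i -> I i r' a' ->
     wp body (fun r'' a'' t'' => I i.+1 (set r'' v i.+1) a'' /\ t'' <= t' + T)
        r' a' t') ->
  (forall r' a' t', agree (Seq (Asg v lo) body) r a r' a' ->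
     r' v = r u -> I (r u) r' a' -> t' <= t + (r u - eval lo r a) * (T + 2) + 2 ->
     Q r' a' t') ->
  wp (For v lo u body) Q r a t.
Proof.
move=> Hu Hv s W1 ru le i0 step fin.
apply: (@wp_for (fun i r' a' t' => I i r' a' /\
  t' <= t + (i - eval lo r a) * (T + 2) + 1)) => //.
- by split=> //; lia.
- move=> i r' a' t' li ag rv [Ii lt].
  apply: (wp_conseq (step i r' a' t'.+1 li ag rv Ii)) => r2 a2 t2 _ [I2 lt2]; split=> //.
  have -> : i.+1 - eval lo r a = (i - eval lo r a).+1 by lia.
  by rewrite mulSn; lia.
- by move=> r' a' t' ag rv [Iu lt]; apply: fin => //; lia.
Qed.

End Semantics.

(** * Compilation to the word RAM *)

Definition addr_code (j d d1 : nat) : seq instr :=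
  [:: Const d1 j; Bin OpMul d1 d1 nvar; Bin OpAdd d d d1].

Definition op_code (o : hop) (d : nat) : seq instr :=
  match o with
  | HAdd | HAddW => [:: Bin OpAdd d d d.+1]
  | HSub => [:: Bin OpSub d d d.+1]
  | HDiv => [:: Bin OpDiv d d d.+1]
  | HBit => [:: Bin OpShr d d d.+1; Const d.+1 1; Bin OpAnd d d d.+1]
  end.

Fixpoint expr_code (e : expr) (d : nat) : seq instr :=
  match e with
  | V v => [:: Const d 0; Bin OpAdd d v d]
  | N c => [:: Const d c]
  | Op o e1 e2 => expr_code e1 d ++ expr_code e2 d.+1 ++ op_code o d
  | Get j e1 => expr_code e1 d ++ addr_code j d d.+1 ++ [:: Read d d]
  end.

Definition bexpr_code (b : bexpr) (l : nat) : seq instr :=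
  match b with
  | Eq e1 e2 => expr_code e1 60 ++ expr_code e2 61 ++ [:: Jeq 60 61 l]
  | Lt e1 e2 => expr_code e1 60 ++ expr_code e2 61 ++ [:: Jlt 60 61 l]
  end.

(** Separate from [cmd_code], which needs these sizes for its absolute jump targets.
    [bexpr_code b 0] only serves for its length, which does not depend on the target. *)
Fixpoint cmd_size (c : cmd) : nat :=
  match c with
  | Skip => 0
  | Asg v e => size (expr_code e 60) + 2
  | Put j e1 e2 => size (expr_code e1 60) + size (expr_code e2 61) + 4
  | Seq c1 c2 => cmd_size c1 + cmd_size c2
  | If b c1 c2 => size (bexpr_code b 0) + cmd_size c2 + 1 + cmd_size c1
  | While b c => size (bexpr_code b 0) + 1 + cmd_size c + 1
  end.

Fixpoint cmd_code (c : cmd) (q : nat) : seq instr :=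
  match c with
  | Skip => [::]
  | Asg v e => expr_code e 60 ++ [:: Const 61 0; Bin OpAdd v 60 61]
  | Put j e1 e2 =>
      expr_code e1 60 ++ expr_code e2 61 ++ addr_code j 60 62 ++ [:: Write 60 61]
  | Seq c1 c2 => cmd_code c1 q ++ cmd_code c2 (q + cmd_size c1)
  | If b c1 c2 =>
      let q2 := q + size (bexpr_code b 0) in
      let q1 := q2 + cmd_size c2 + 1 in
      bexpr_code b q1 ++ cmd_code c2 q2 ++ [:: Jmp (q1 + cmd_size c1)]
        ++ cmd_code c1 q1
  | While b c =>
      let q1 := q + size (bexpr_code b 0) + 1 in
      bexpr_code b q1 ++ [:: Jmp (q1 + cmd_size c + 1)] ++ cmd_code c q1
        ++ [:: Jmp q]
  end.

Lemma size_bexpr_code b l : size (bexpr_code b l) = size (bexpr_code b 0).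
Proof. by case: b => e1 e2; rewrite /= !size_cat. Qed.

Lemma size_cmd_code c q : size (cmd_code c q) = cmd_size c.
Proof.
elim: c q => //= [v e|j e1 e2|c1 IH1 c2 IH2|b c1 IH1 c2 IH2|b c IH] q;
  rewrite !size_cat /= ?size_cat /= ?IH1 ?IH2 ?IH ?size_bexpr_code; lia.
Qed.

Fixpoint expr_wf (e : expr) : bool :=
  match e with
  | V v => v < nvar
  | N _ => true
  | Op _ e1 e2 => expr_wf e1 && expr_wf e2
  | Get j e1 => (j < narr) && expr_wf e1
  end.
Definition bexpr_wf (b : bexpr) : bool :=
  match b with Eq e1 e2 | Lt e1 e2 => expr_wf e1 && expr_wf e2 end.

(* [cmd_wf F c]: [c] stays within the available registers and arrays, and each
   elementary step of [c] takes at most [F] instructions. *)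
Fixpoint cmd_wf (F : nat) (c : cmd) : bool :=
  match c with
  | Skip => true
  | Asg v e => [&& v < nvar, expr_wf e & size (expr_code e 60) + 2 <= F]
  | Put j e1 e2 => [&& j < narr, expr_wf e1, expr_wf e2 &
      size (expr_code e1 60) + size (expr_code e2 61) + 4 <= F]
  | Seq c1 c2 => cmd_wf F c1 && cmd_wf F c2
  | If b c1 c2 => [&& bexpr_wf b, size (bexpr_code b 0) + 2 <= F,
      cmd_wf F c1 & cmd_wf F c2]
  | While b c => [&& bexpr_wf b, size (bexpr_code b 0) + 2 <= F & cmd_wf F c]
  end.

Definition code_at (P : program) (q : nat) (l : seq instr) : Prop :=
  forall i I, onth l i = Some I -> onth P (q + i) = Some I.

Lemma code_at_cat P q l1 l2 :
  code_at P q (l1 ++ l2) -> code_at P q l1 /\ code_at P (q + size l1) l2.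
Proof.
move=> H; split=> i I h.
  apply: H; rewrite onth_cat; case: ltnP => // le.
  by rewrite onth_default in h.
by rewrite -addnA; apply: H; rewrite onth_cat ltnNge leq_addr /= addKn.
Qed.

Lemma code_at_cons P q I l :
  code_at P q (I :: l) -> onth P q = Some I /\ code_at P q.+1 l.
Proof.
move=> H; split; first by have := H 0 I erefl; rewrite addn0.
by move=> i J h; have := H i.+1 J h; rewrite addnS addSn.
Qed.

Section Simulation.
Variables (w B F : nat) (P : program).
Local Notation W := (2 ^ w).
Hypothesis (w_gt0 : 0 < w) (BW : narr * B < W).

(** Phrased through continuations because [run] describes only complete, halting runs: any run from
    [c2] extends backwards to [c1] at the cost of s instructions, and the accesses in between stay
    inside the arrays. *)
Definition reach (c1 c2 : config) (s : nat) : Prop :=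
  forall t m v, run w P c2 t m v ->
    exists2 m', m' <= maxn (narr * B) m & run w P c1 (s + t) m' v.

Lemma reach_refl c : reach c c 0.
Proof. by move=> t m v h; exists m => //; apply: leq_maxr. Qed.

Lemma reach_trans c1 c2 c3 s1 s2 :
  reach c1 c2 s1 -> reach c2 c3 s2 -> reach c1 c3 (s1 + s2).
Proof.
move=> h1 h2 t m v /h2[m2 l2 /h1[m1 l1 r]].
exists m1; last by rewrite -addnA.
by apply: leq_trans l1 _; rewrite geq_max leq_maxl.
Qed.

Lemma reach_step q r m I c' :
  onth P q = Some I -> (forall b, I <> Halt b) ->
  extent I (Config q r m) <= narr * B ->
  step w I (Config q r m) = c' ->
  reach (Config q r m) c' 1.
Proof.
move=> h1 h2 h3 <- t k v h; exists (maxn (extent I (Config q r m)) k).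
  by rewrite geq_max leq_max h3 leq_maxr.
exact: (@run_step w P (Config q r m) I t k v h1 h2).
Qed.

(** That registers and cells hold words is kept on the machine side; this is why [safe] asks nothing
    of a variable. *)
Record related (r : regfile) (a : arrays) (rl ml : nat -> nat) : Prop := {
  rel_var : forall v, v < nvar -> rl v = r v;
  rel_size : rl nvar = B;
  rel_arr : forall j i, j < narr -> i < B -> ml (j * B + i) = a j i;
  rel_reg_lt : forall v, rl v < W;
  rel_mem_lt : forall i, ml i < W
}.

Lemma W_gt0 : 0 < W. Proof. by rewrite expn_gt0. Qed.

Lemma related_temp r a rl ml d x :
  related r a rl ml -> nvar < d -> x < W -> related r a (upd rl d x) ml.
Proof.
move=> [H1 H2 H3 H4 H5] dlt xW; split=> //.
- by move=> v hv; rewrite /upd ltn_eqF ?H1 //; apply: ltn_trans dlt.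
- by rewrite /upd ltn_eqF.
- by move=> v; rewrite /upd; case: eqP.
Qed.

Lemma addr_inj j i j' i' :
  i < B -> i' < B -> j * B + i = j' * B + i' -> j = j' /\ i = i'.
Proof.
move=> h1 h2 e; have B0 : 0 < B by apply: leq_ltn_trans h1.
have ej : j = j'.
  by have /(congr1 (fun x => x %/ B)) := e; rewrite !divnMDl // !divn_small // !addn0.
by move: e; rewrite ej => /addnI.
Qed.

Lemma addr_lt j i : j < narr -> i < B -> j * B + i < narr * B.
Proof.
move=> hj hi; apply: (@leq_trans (j.+1 * B)); first by rewrite mulSn addnC ltn_add2r.
by rewrite leq_mul2r hj orbT.
Qed.

Lemma land1 x : Nat.land x 1 = odd x.
Proof.
have -> : Nat.land x 1 = PeanoNat.Nat.modulo x 2 by apply: (PeanoNat.Nat.land_ones x 1).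
have := PeanoNat.Nat.mod_upper_bound x 2; have := PeanoNat.Nat.div_mod_eq x 2.
by move: (PeanoNat.Nat.div _ _) (PeanoNat.Nat.modulo _ _) => d m; lia.
Qed.

Lemma op_codeP o d r a rl ml q x y :
  related r a rl ml -> nvar < d -> rl d = x -> rl d.+1 = y ->
  opsafe w o x y -> code_at P q (op_code o d) ->
  exists rl', [/\ related r a rl' ml, rl' d = opeval w o x y,
    forall v, v < d -> rl' v = rl v &
    reach (Config q rl ml) (Config (q + size (op_code o d)) rl' ml)
      (size (op_code o d))].
Proof.
move=> R dlt ex ey; have xW : x < W by rewrite -ex; apply: rel_reg_lt R _.
have one op z : eval_binop w op x y = z ->
    code_at P q [:: Bin op d d d.+1] ->
    exists rl', [/\ related r a rl' ml, rl' d = z,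
    forall v, v < d -> rl' v = rl v &
    reach (Config q rl ml) (Config (q + 1) rl' ml) 1].
  move=> ez /code_at_cons[h _].
  exists (upd rl d z); split.
  - by apply: related_temp => //; rewrite -ez /eval_binop ltn_mod W_gt0.
  - by rewrite /upd eqxx.
  - by move=> v hv; rewrite /upd ltn_eqF.
  - by apply: (reach_step h) => //=; rewrite ex ey ez addn1.
case: o => /= s.
- by apply: one; rewrite /eval_binop modn_small.
- apply: one; rewrite /eval_binop /=; have -> : x + W - y = (x - y) + W by lia.
  by rewrite modnDr modn_small //; lia.
- by apply: one; rewrite /eval_binop modn_small //; apply: leq_ltn_trans xW; apply: leq_div.
- by apply: one.
- move=> /code_at_cons[h1 /code_at_cons[h2 /code_at_cons[h3 _]]].
  have xyW : x %/ 2 ^ y < W by apply: leq_ltn_trans xW; apply: leq_div.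
  have W1 : 1 < W by rewrite -{1}(expn0 2) ltn_exp2l.
  exists (upd (upd (upd rl d (x %/ 2 ^ y)) d.+1 1) d (odd (x %/ 2 ^ y))); split.
  + do ?apply: related_temp => //; [exact: ltnW | by case: odd; rewrite ?W_gt0].
  + by rewrite /upd eqxx.
  + by move=> v hv; rewrite /upd !ltn_eqF // ltnS ltnW.
  + apply: (@reach_trans _ _ _ 1 2).
      by apply: (reach_step h1) => //=; rewrite ex ey modn_small.
    apply: (@reach_trans _ _ _ 1 1).
      by apply: (reach_step h2) => //=; rewrite modn_small.
    apply: (reach_step h3) => //=; rewrite /upd !eqxx ltn_eqF // /eval_binop ex ey.
    rewrite (modn_small xyW) (modn_small W1) land1 modn_small ?addn3 //.
    by case: odd; rewrite ?W_gt0.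
Qed.

Lemma addr_codeP j d d1 r a rl ml q x :
  related r a rl ml -> nvar < d -> nvar < d1 -> d != d1 -> rl d = x ->
  j < narr -> x < B -> code_at P q (addr_code j d d1) ->
  exists rl', [/\ related r a rl' ml, rl' d = j * B + x,
    forall v, v != d -> v != d1 -> rl' v = rl v &
    reach (Config q rl ml) (Config (q + 3) rl' ml) 3].
Proof.
move=> R dlt d1lt dd ex hj hx /code_at_cons[h1 /code_at_cons[h2 /code_at_cons[h3 _]]].
have aW := ltn_trans (addr_lt hj hx) BW.
have jBW : j * B < W by apply: leq_ltn_trans aW; apply: leq_addr.
have jW : j < W by apply: leq_ltn_trans jBW; rewrite leq_pmulr //; apply: leq_ltn_trans hx.
exists (upd (upd (upd rl d1 j) d1 (j * B)) d (j * B + x)); split.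
- by do ?apply: related_temp => //.
- by rewrite /upd eqxx.
- by move=> v /negbTE h h'; rewrite /upd h (negbTE h').
- apply: (@reach_trans _ _ _ 1 2).
    exact: (reach_step h1).
  apply: (@reach_trans _ _ _ 1 1); first exact: (reach_step h2).
  apply: (reach_step h3) => //=; rewrite /upd !eqxx (negbTE dd) ex.
  rewrite (ltn_eqF d1lt) (rel_size R) /eval_binop (modn_small jW).
  by rewrite (modn_small jBW) [x + _]addnC modn_small // addn3.
Qed.

(** Registers from [d] on form an evaluation stack. The clause on [v < d] makes a left operand
    survive the evaluation of the right one. *)
Lemma expr_codeP e d r a rl ml q :
  related r a rl ml -> nvar < d -> expr_wf e -> safe w B e r a ->
  code_at P q (expr_code e d) ->
  exists rl', [/\ related r a rl' ml, rl' d = eval w e r a,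
    forall v, v < d -> rl' v = rl v &
    reach (Config q rl ml) (Config (q + size (expr_code e d)) rl' ml)
      (size (expr_code e d))].
Proof.
elim: e d rl q => [v|c|o e1 IH1 e2 IH2|j e IH] d rl q R dlt /=.
- move=> hv _ /code_at_cons[h1 /code_at_cons[h2 _]].
  exists (upd (upd rl d 0) d (r v)).
  have rvW : r v < W by rewrite -(rel_var R) //; apply: rel_reg_lt R _.
  split.
  + by do ?apply: related_temp => //; apply: W_gt0.
  + by rewrite /upd eqxx.
  + by move=> u hu; rewrite /upd ltn_eqF.
  + apply: (@reach_trans _ _ _ 1 1).
      by apply: (reach_step h1) => //=; rewrite mod0n.
    apply: (reach_step h2) => //=.
    rewrite /upd eqxx (ltn_eqF (ltn_trans hv dlt)) (rel_var R) // /eval_binop.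
    by rewrite mod0n addn0 modn_small // addn2.
- move=> _ cW /code_at_cons[h1 _]; exists (upd rl d c); split.
  + exact: related_temp.
  + by rewrite /upd eqxx.
  + by move=> u hu; rewrite /upd ltn_eqF.
  + by apply: (reach_step h1) => //=; rewrite modn_small ?addn1.
- move=> /andP[f1 f2] [s1 s2 so] /code_at_cat[c1 /code_at_cat[c2 c3]].
  have [rl1 [R1 E1 U1 G1]] := IH1 d rl q R dlt f1 s1 c1.
  have [rl2 [R2 E2 U2 G2]] := IH2 d.+1 rl1 _ R1 (ltnW dlt) f2 s2 c2.
  have E1' : rl2 d = eval w e1 r a by rewrite U2.
  have [rl3 [R3 E3 U3 G3]] := op_codeP R2 dlt E1' E2 so c3.
  exists rl3; split=> //.
    by move=> v hv; rewrite U3 // U2 ?U1 // ltnS ltnW.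
  rewrite !size_cat !addnA in G3 *.
  by rewrite -[X in reach _ _ X]addnA; apply: (reach_trans G1); apply: reach_trans G2 G3.
- move=> /andP[hj f] [s lt] /code_at_cat[c1 c23].
  have /code_at_cat[c2 /code_at_cons[c3 _]] :
    code_at P (q + size (expr_code e d)) (addr_code j d d.+1 ++ [:: Read d d]) := c23.
  have [rl1 [R1 E1 U1 G1]] := IH d rl q R dlt f s c1.
  have dd : d != d.+1 by rewrite neq_ltn ltnSn.
  have [rl2 [R2 E2 U2 G2]] := addr_codeP R1 dlt (leqW dlt) dd E1 hj lt c2.
  have ea : ml (rl2 d) = a j (eval w e r a) by rewrite E2 (rel_arr R).
  exists (upd rl2 d (a j (eval w e r a))); split.
  + by apply: related_temp => //; rewrite -ea; apply: rel_mem_lt R _.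
  + by rewrite /upd eqxx.
  + move=> v hv; rewrite /upd ltn_eqF // U2 ?U1 // neq_ltn ?hv //.
    by rewrite (ltn_trans hv).
  + rewrite size_cat /=; apply: (reach_trans G1); apply: (@reach_trans _ _ _ 3 1) G2 _.
    apply: (reach_step c3) => //=; first by rewrite E2 addr_lt.
    by rewrite ea; congr Config; lia.
Qed.

Lemma bexpr_codeP b l r a rl ml q :
  related r a rl ml -> bexpr_wf b -> bsafe w B b r a ->
  code_at P q (bexpr_code b l) ->
  exists2 rl', related r a rl' ml &
    reach (Config q rl ml)
      (Config (if beval w b r a then l else q + size (bexpr_code b 0)) rl' ml)
      (size (bexpr_code b 0)).
Proof.
move=> R; rewrite -(size_bexpr_code b l).
have main e1 e2 J (cond : nat -> nat -> bool) :
  (forall b, J <> Halt b) -> (forall c, extent J c = 0) ->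
  (forall q r m, step w J (Config q r m) =
     Config (if cond (r 60) (r 61) then l else q.+1) r m) ->
  expr_wf e1 && expr_wf e2 -> safe w B e1 r a /\ safe w B e2 r a ->
  code_at P q (expr_code e1 60 ++ expr_code e2 61 ++ [:: J]) ->
  let s := size (expr_code e1 60 ++ expr_code e2 61 ++ [:: J]) in
  exists2 rl', related r a rl' ml & reach (Config q rl ml)
    (Config (if cond (eval w e1 r a) (eval w e2 r a) then l else q + s) rl' ml) s.
  move=> nh ext st /andP[f1 f2] [s1 s2] /code_at_cat[c1 /code_at_cat[c2 /code_at_cons[c3 _]]] s.
  have [rl1 [R1 E1 U1 G1]] := expr_codeP R (d := 60) isT f1 s1 c1.
  have [rl2 [R2 E2 U2 G2]] := expr_codeP R1 (d := 61) isT f2 s2 c2.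
  exists rl2 => //; rewrite /s !size_cat /=.
  apply: (reach_trans G1); apply: (reach_trans G2).
  apply: (reach_step c3) => //; first by rewrite ext.
  by rewrite st U2 // E1 E2 !addnA addn1.
case: b => e1 e2 f s c.
  by apply: (main e1 e2 (Jeq 60 61 l) (fun x y => x == y)) c.
by apply: (main e1 e2 (Jlt 60 61 l) (fun x y => x < y)) c.
Qed.

Lemma cmd_codeP c r a r' a' t rl ml q :
  exec w B c r a r' a' t -> related r a rl ml -> cmd_wf F c ->
  code_at P q (cmd_code c q) ->
  exists rl' ml' s, [/\ related r' a' rl' ml', s <= F * t &
    reach (Config q rl ml) (Config (q + cmd_size c) rl' ml') s].
Proof.
move=> ex; elim: ex rl ml q => {c r a r' a' t} /=.
- move=> r a rl ml q R _ _; exists rl, ml, 0; rewrite addn0; split=> //.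
  exact: reach_refl.
- move=> v e r a s rl ml q R /and3P[hv f leF].
  move=> /code_at_cat[c1 /code_at_cons[c2 /code_at_cons[c3 _]]].
  have [rl1 [R1 E1 U1 G1]] := expr_codeP R (d := 60) isT f s c1.
  have eW : eval w e r a < W by rewrite -E1; apply: rel_reg_lt R1 _.
  have R2 : related r a (upd rl1 61 0) ml by apply: related_temp => //; apply: W_gt0.
  exists (upd (upd rl1 61 0) v (eval w e r a)), ml, (size (expr_code e 60) + 2).
  split; last 2 [by rewrite muln1].
    case: R2 => H1 H2 H3 H4 H5; split=> //.
    + by move=> u hu; rewrite setE {1}/upd; case: eqP => // _; apply: H1.
    + by rewrite {1}/upd gtn_eqF.
    + by move=> u; rewrite {1}/upd; case: eqP.
  apply: (reach_trans G1); apply: (@reach_trans _ _ _ 1 1).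
    by apply: (reach_step c2) => //=; rewrite mod0n.
  apply: (reach_step c3) => //=.
  by rewrite /upd /= E1 /eval_binop mod0n addn0 modn_small // addnA addn2.
- move=> j e1 e2 r a s1 s2 lt rl ml q R /and4P[hj f1 f2 leF].
  move=> /code_at_cat[c1 /code_at_cat[c2 c34]].
  have /code_at_cat[c3 /code_at_cons[c4 _]] :
    code_at P (q + size (expr_code e1 60) + size (expr_code e2 61))
      (addr_code j 60 62 ++ [:: Write 60 61]) := c34.
  have [rl1 [R1 E1 U1 G1]] := expr_codeP R (d := 60) isT f1 s1 c1.
  have [rl2 [R2 E2 U2 G2]] := expr_codeP R1 (d := 61) isT f2 s2 c2.
  have E1' : rl2 60 = eval w e1 r a by rewrite U2.
  have [rl3 [R3 E3 U3 G3]] := addr_codeP R2 (d := 60) (d1 := 62) isT isT isT E1' hj lt c3.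
  exists rl3, (upd ml (rl3 60) (rl3 61)),
    (size (expr_code e1 60) + size (expr_code e2 61) + 4).
  split; last 2 [by rewrite muln1].
    case: R3 => H1 H2 H3 H4 H5; split=> //.
    + move=> j' i' hj' hi'; rewrite setE {1}/upd E3; case: eqP => [|ne].
        move=> /(addr_inj hi' lt)[-> ->]; rewrite eqxx /upd eqxx.
        by rewrite U3 // E2.
      case: eqP => [ej|_]; last by apply: H3.
      rewrite /upd; case: eqP => [ei|_]; first by case: ne; rewrite ej ei.
      by rewrite -ej; apply: H3.
    + by move=> i; rewrite /upd; case: eqP.
  rewrite -addnA; apply: (reach_trans G1); apply: (reach_trans G2).
  apply: (@reach_trans _ _ _ 3 1) G3 _.
  apply: (reach_step c4) => //=; first by rewrite E3 addr_lt.
  by congr Config; lia.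
- move=> c1 c2 r a r1 a1 t1 r2 a2 t2 _ IH1 _ IH2 rl ml q R /andP[f1 f2].
  move=> /code_at_cat[h1]; rewrite size_cmd_code => h2.
  have [rl1 [ml1 [s1 [R1 l1 G1]]]] := IH1 _ _ _ R f1 h1.
  have [rl2 [ml2 [s2 [R2 l2 G2]]]] := IH2 _ _ _ R1 f2 h2.
  exists rl2, ml2, (s1 + s2); split=> //; first by rewrite mulnDr leq_add.
  by rewrite addnA; apply: reach_trans G1 G2.
- move=> b c1 c2 r a r1 a1 t s _ IH rl ml q R /and4P[fb leF f1 f2].
  move=> /code_at_cat[hb]; rewrite size_bexpr_code.
  move=> /code_at_cat[h2]; rewrite size_cmd_code.
  move=> /code_at_cons[hj h1].
  have [rl0 R0 G0] := bexpr_codeP R fb s hb.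
  case: (beval w b r a) IH G0 => IH G0.
    rewrite -addn1 in h1.
    have [rl1 [ml1 [s1 [R1 l1 G1]]]] := IH _ _ _ R0 f1 h1.
    exists rl1, ml1, (size (bexpr_code b 0) + s1); split=> //.
      by rewrite mulnS; apply: leq_add => //; apply: leq_trans leF; apply: leq_addr.
    by rewrite !addnA in G1 *; apply: reach_trans G0 G1.
  have [rl1 [ml1 [s1 [R1 l1 G1]]]] := IH _ _ _ R0 f2 h2.
  exists rl1, ml1, (size (bexpr_code b 0) + s1 + 1); split=> //.
    rewrite mulnS addnAC; apply: leq_add => //.
    by apply: leq_trans leF; rewrite leq_add2l.
  rewrite -[X in reach _ _ X]addnA; apply: (reach_trans G0); apply: (reach_trans G1).
  by apply: (reach_step hj) => //=; rewrite !addnA.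
- move=> b c r a s bF rl ml q R /and3P[fb leF f].
  move=> /code_at_cat[hb]; rewrite size_bexpr_code.
  move=> /code_at_cons[hj _].
  have [rl0 R0] := bexpr_codeP R fb s hb; rewrite bF => G0.
  exists rl0, ml, (size (bexpr_code b 0) + 1); split=> //.
    by rewrite muln1; apply: leq_trans leF; rewrite leq_add2l.
  by apply: (reach_trans G0); apply: (reach_step hj) => //=; rewrite !addnA.
- move=> b c r a r1 a1 t1 r2 a2 t2 s bT _ IH1 _ IH2 rl ml q R fw h0.
  have := fw => /and3P[fb leF f].
  have /code_at_cat[hb] := h0; rewrite size_bexpr_code.
  move=> /code_at_cons[_]; rewrite -addn1 => /code_at_cat[hc].
  rewrite size_cmd_code => /code_at_cons[hj _].
  have [rl0 R0] := bexpr_codeP R fb s hb; rewrite bT => G0.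
  have [rl1 [ml1 [s1 [R1 l1 G1]]]] := IH1 _ _ _ R0 f hc.
  have [rl2 [ml2 [s2 [R2 l2 G2]]]] := IH2 _ _ _ R1 fw h0.
  exists rl2, ml2, (size (bexpr_code b 0) + (s1 + (1 + s2))); split=> //.
    rewrite mulnS mulnDr !addnA -addnA.
    have : size (bexpr_code b 0) + 1 <= F by apply: leq_trans leF; rewrite leq_add2l.
    by move: l1 l2; lia.
  apply: (reach_trans G0); apply: (reach_trans G1); apply: reach_trans G2.
  by apply: (reach_step hj).
Qed.

End Simulation.

(** Only comparisons free of conditionals are split, so nested joins are resolved from the inside
    out. *)
Ltac split_eqs :=
  repeat match goal with |- context [?a == ?b] =>
    lazymatch constr:((a, b)) with
    | context [if _ then _ else _] => fail
    | _ => case: (eqVneq a b) => ? /=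
    end end.

(* The flat lattice: 0 is bottom, 1 is top, the other numbers are atoms. *)
Definition join (u v : nat) : nat :=
  if u == 0 then v else if v == 0 then u else if u == v then u else 1.

Lemma joinA : associative join.
Proof.
move=> u v x; rewrite /join.
by split_eqs; lia.
Qed.
Lemma joinC : commutative join.
Proof.
move=> u v; rewrite /join.
by split_eqs; lia.
Qed.
Lemma join0x : left_id 0 join. Proof. by []. Qed.

HB.instance Definition _ := Monoid.isComLaw.Build nat 0 join joinA joinC join0x.

(** * Prefix keys *)

Lemma ltn_digits M x y p q : p < M -> q < M ->
  (x * M + p < y * M + q) = (x < y) || ((x == y) && (p < q)).
Proof.
move=> hp hq; case: (ltngtP x y) => [lt|gt|->] /=; last by rewrite ltn_add2l.
  have : x.+1 * M <= y * M by rewrite leq_mul2r lt orbT.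
  by rewrite mulSn; lia.
have : y.+1 * M <= x * M by rewrite leq_mul2r gt orbT.
by rewrite mulSn; lia.
Qed.

Lemma eqn_digits M x y p q : p < M -> q < M ->
  (x * M + p == y * M + q) = (x == y) && (p == q).
Proof.
move=> hp hq; have := ltn_digits x y hp hq; have := ltn_digits y x hq hp.
by case: (ltngtP x y) => //; case: (ltngtP p q) => /=; lia.
Qed.

Section PrefixKeys.
Variables (W n : nat) (X : nat -> nat).
Hypothesis X_lt : forall i, X i < W.
Hypothesis X_in : forall i, i < n -> 0 < X i.
Hypothesis X_out : forall i, n <= i -> X i = 0.

(* The first [l] letters from position [i], padded with zeros beyond the end of
   the string, read as a number in base [W]: numerical order is lexicographic
   order, and the padding acts as an end marker. *)
Fixpoint key (l i : nat) : nat :=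
  if l is l'.+1 then key l' i * W + X (i + l') else 0.

Lemma key_lt l i : key l i < W ^ l.
Proof.
elim: l => //= l IH; rewrite expnSr.
have : (key l i).+1 * W <= W ^ l * W by rewrite leq_mul2r IH orbT.
by rewrite mulSn; have := X_lt (i + l); lia.
Qed.

Lemma keyD a b i : key (a + b) i = key a i * W ^ b + key b (i + a).
Proof.
elim: b => [|b IH]; first by rewrite !addn0 muln1.
by rewrite addnS /= IH mulnDl -mulnA -expnSr [i + (a + b)]addnA -addnA.
Qed.

Lemma ltn_keyD a b i j : (key (a + b) i < key (a + b) j) =
  (key a i < key a j) || ((key a i == key a j) && (key b (i + a) < key b (j + a))).
Proof. by rewrite !keyD ltn_digits ?key_lt. Qed.

Lemma eqn_keyD a b i j : (key (a + b) i == key (a + b) j) =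
  (key a i == key a j) && (key b (i + a) == key b (j + a)).
Proof. by rewrite !keyD eqn_digits ?key_lt. Qed.

Lemma key1 i : key 1 i = X i. Proof. by rewrite /= addn0. Qed.

Lemma key_prefix_lt a l i j : a <= l -> key a i < key a j -> key l i < key l j.
Proof. by move=> /subnKC <- h; rewrite ltn_keyD h. Qed.

Lemma key_prefix_le a l i j : a <= l -> key l i <= key l j -> key a i <= key a j.
Proof. by move=> le; rewrite leqNgt [key a i <= _]leqNgt; apply/contra/key_prefix_lt. Qed.

Lemma key_prefix_eq a l i j : a <= l -> key l i = key l j -> key a i = key a j.
Proof. by move=> /subnKC <- /eqP; rewrite eqn_keyD => /andP[/eqP]. Qed.

Lemma keyS_eq l i j :
  (key l.+1 i == key l.+1 j) = (key l i == key l j) && (X (i + l) == X (j + l)).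
Proof. by rewrite -addn1 eqn_keyD !key1. Qed.

Lemma key_eq_letter l i j t : key l i = key l j -> t < l -> X (i + t) = X (j + t).
Proof.
by move=> e lt; have := key_prefix_eq lt e => /eqP; rewrite keyS_eq => /andP[_ /eqP].
Qed.

Lemma key_eqP l i j : (forall t, t < l -> X (i + t) = X (j + t)) -> key l i = key l j.
Proof.
elim: l => // l IH h; apply/eqP; rewrite keyS_eq h // eqxx andbT; apply/eqP/IH.
by move=> t lt; apply/h/ltnW.
Qed.

Lemma key_out l i : n <= i -> key l i = 0.
Proof. by move=> le; elim: l => //= l ->; rewrite X_out //; lia. Qed.

Lemma key_in l i : 0 < l -> i < n -> 0 < key l i.
Proof.
case: l => // l _ lt.
have : key l.+1 i <> key l.+1 n.
  by move=> /key_eq_letter/(_ (ltn0Sn l)); rewrite !addn0 (X_out (leqnn n)); have := X_in lt; lia.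
by rewrite (key_out _ (leqnn n)); lia.
Qed.

Lemma key_eq_ltn l i j : key l i = key l j -> i < j -> j < n -> j + l <= n.
Proof.
move=> e lt jn; case: (leqP (j + l) n) => // gt.
have := @key_eq_letter l i j (n - j) e.
have -> : j + (n - j) = n by lia.
rewrite (X_out (leqnn n)).
have : 0 < X (i + (n - j)) by apply: X_in; lia.
by lia.
Qed.

(** The last letter at j would be padding, whereas the last letter at i belongs to the string and is
    positive. *)
Lemma key_eq_fits l i j : 0 < l -> key l i = key l j -> i + l <= n -> j + l <= n.
Proof.
move=> l0 e le; rewrite leqNgt; apply/negP => gt.
have := @key_eq_letter l i j l.-1 e; rewrite (X_out (i := j + l.-1)); last by lia.
have : 0 < X (i + l.-1) by apply: X_in; lia.
by lia.
Qed.

(** Ties share a value, which is the start of their bucket in any order sorted by [f]; [double_step]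
    uses it in this way. *)
Definition below (f : nat -> nat) (i : nat) : nat :=
  count (fun j => f j < f i) (iota 0 n).

(* One-based, so that 0 is left for the empty suffixes. *)
Definition krank (l i : nat) : nat := if i < n then (below (key l) i).+1 else 0.

Lemma below_lt f i : i < n -> below f i < n.
Proof.
move=> lt; rewrite -[X in _ < X](size_iota 0 n) ltn_neqAle count_size andbT -all_count.
by apply/negP => /allP/(_ i); rewrite mem_iota ltnn /= lt => /(_ isT).
Qed.

Lemma below_mono f i j : j < n -> f i < f j ->
  below f i + count (fun u => f u == f i) (iota 0 n) <= below f j.
Proof.
move=> jn lt; rewrite /below -count_predUI addnC.
rewrite (@eq_count _ (predI _ _) pred0) ?count_pred0 ?add0n; last by move=> u /=; lia.
by apply: sub_count => u /=; lia.
Qed.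

Lemma below_eq f i j : i < n -> j < n -> below f i = below f j -> f i = f j.
Proof.
move=> hi hj e; case: (ltngtP (f i) (f j)) => // lt; exfalso.
  have := below_mono hj lt; rewrite e.
  suff : 0 < count (fun u => f u == f i) (iota 0 n) by lia.
  by rewrite -has_count; apply/hasP; exists i; rewrite ?mem_iota.
have := below_mono hi lt; rewrite e.
suff : 0 < count (fun u => f u == f j) (iota 0 n) by lia.
by rewrite -has_count; apply/hasP; exists j; rewrite ?mem_iota.
Qed.

Lemma below_congr f i j : f i = f j -> below f i = below f j.
Proof. by rewrite /below => ->. Qed.

Lemma krank_eq l i j : 0 < l -> (krank l i == krank l j) = (key l i == key l j).
Proof.
move=> l0; rewrite /krank; case: ltnP => hi; case: ltnP => hj.
- by rewrite eqSS; apply/eqP/eqP; [apply: below_eq | apply: below_congr].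
- by rewrite (key_out l hj); have := key_in l0 hi; lia.
- by rewrite (key_out l hi); have := key_in l0 hj; lia.
- by rewrite !key_out.
Qed.

(** * Suffix arrays and common prefixes *)

Variables (L : nat) (sa pos lc : nat -> nat).
Hypothesis leL : n <= L.
Hypothesis sa_lt : forall p, p < n -> sa p < n.
Hypothesis sa_mono : forall p q, p < q -> q < n -> key L (sa p) < key L (sa q).
Hypothesis pos_lt : forall i, i < n -> pos i < n.
Hypothesis posK : forall i, i < n -> sa (pos i) = i.

Lemma sa_inj p q : p < n -> q < n -> sa p = sa q -> p = q.
Proof.
move=> hp hq e; case: (ltngtP p q) => // lt; exfalso.
  by have := sa_mono lt hq; rewrite e ltnn.
by have := sa_mono lt hp; rewrite e ltnn.
Qed.

Lemma saK p : p < n -> pos (sa p) = p.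
Proof. by move=> lt; apply: sa_inj; rewrite ?posK ?pos_lt ?sa_lt. Qed.

Lemma sa_le p q : p <= q -> q < n -> key L (sa p) <= key L (sa q).
Proof.
by rewrite leq_eqVlt => /orP[/eqP->//|lt] hq; apply/ltnW/sa_mono.
Qed.

(* The monotonicity behind Kasai's linear-time computation of the longest
   common prefixes: removing the first letter loses at most one. *)
Lemma pred_shift h i : i.+1 < n -> 0 < pos i -> 1 < h ->
  key h (sa (pos i).-1) = key h i ->
  0 < pos i.+1 /\ key h.-1 (sa (pos i.+1).-1) = key h.-1 i.+1.
Proof.
move=> ilt p0 h1 e; set j := sa (pos i).-1 in e.
have i_lt : i < n by apply: ltnW.
have jlt : j < n by apply: sa_lt; have := pos_lt i_lt; lia.
have neq : key L j < key L i.
  by rewrite -[X in _ < key L X](posK i_lt); apply: sa_mono; have := pos_lt i_lt; lia.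
have ij : i <> j by move=> E; move: neq; rewrite -E ltnn.
have hn : h <= n.
  case: (ltngtP i j) ij => // lt _; [have := key_eq_ltn (esym e) lt jlt | have := key_eq_ltn e lt i_lt]; lia.
have e1 : key h.-1 j.+1 = key h.-1 i.+1.
  have : 1 + h.-1 = h by lia.
  by move=> E; move/eqP: e; rewrite -E eqn_keyD !addn1 => /andP[_ /eqP].
have j1 : j.+1 < n.
  rewrite ltnNge; apply/negP => ge; move: e1; rewrite (key_out _ ge).
  have : 0 < key h.-1 i.+1 by apply: key_in => //; lia.
  by lia.
have lt1 : key L j.+1 < key L i.+1.
  apply: (@key_prefix_lt L.-1); first by lia.
  have E : 1 + L.-1 = L by lia.
  have ex : key 1 j = key 1 i by apply: key_prefix_eq e; lia.
  by move: neq; rewrite -E ltn_keyD ex ltnn eqxx /= !addn1.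
have plt : pos j.+1 < pos i.+1.
  rewrite ltnNge; apply/negP => ge.
  have := sa_le ge (pos_lt j1); rewrite !posK //.
  by lia.
split; first by lia.
(* In the sorted order [q] lies between [j.+1] and [i.+1]; these agree on h - 1 letters, so [q] is
   squeezed and agrees with them as well. *)
set q := sa (pos i.+1).-1.
have le1 : key L j.+1 <= key L q.
  by rewrite -[X in key L X <= _](posK j1); apply: sa_le; have := pos_lt ilt; lia.
have le2 : key L q <= key L i.+1.
  by rewrite -[X in _ <= key L X](posK ilt); apply: sa_le; have := pos_lt ilt; lia.
have h1L : h.-1 <= L by lia.
have := key_prefix_le h1L le1; have := key_prefix_le h1L le2.
by rewrite e1; lia.
Qed.

Hypothesis lc0 : lc 0 = 0.
Hypothesis lcP : forall p, 0 < p < n ->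
  key (lc p) (sa p.-1) = key (lc p) (sa p) /\
  X (sa p.-1 + lc p) <> X (sa p + lc p).

Lemma lc_geP l p : 0 < p < n -> (l <= lc p) = (key l (sa p.-1) == key l (sa p)).
Proof.
move=> hp; have [e ne] := lcP hp; case: leqP => le.
  by rewrite (key_prefix_eq le e) eqxx.
by apply/esym/negbTE/eqP => /key_eq_letter/(_ le).
Qed.

Lemma lc_lt p : p < n -> lc p < n.
Proof.
case: (posnP p) => [->|p0] hp; first by rewrite lc0.
have [|e _] := lcP (p := p); first by rewrite p0.
have h1 : sa p < n by apply: sa_lt.
have h2 : sa p.-1 < n by apply: sa_lt; lia.
have ne : sa p.-1 <> sa p by move/(sa_inj (ltn_trans (ltac:(lia) : p.-1 < p) hp) hp); lia.
case: (ltngtP (sa p.-1) (sa p)) ne => // lt _.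
  by have := key_eq_ltn e lt h1; lia.
by have := key_eq_ltn (esym e) lt h2; lia.
Qed.

(** Prefix keys are monotone along the suffix array, so equality at the two ends forces equality at
    every boundary between them. *)
Lemma block_eq l p q : l <= n -> p <= q -> q < n ->
  key l (sa p) = key l (sa q) <-> forall b, p < b <= q -> l <= lc b.
Proof.
move=> ln pq qn; have lL := leq_trans ln leL; split.
  move=> e b hb; rewrite lc_geP; last by lia.
  have h1 : key l (sa p) <= key l (sa b.-1).
    by apply/(key_prefix_le lL)/sa_le; lia.
  have h2 : key l (sa b.-1) <= key l (sa b).
    by apply/(key_prefix_le lL)/sa_le; lia.
  have h3 : key l (sa b) <= key l (sa q).
    by apply/(key_prefix_le lL)/sa_le; lia.
  by lia.
elim: q pq qn => [|q IH] pq qn h; first by have -> : p = 0 by lia.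
case: (ltngtP p q.+1) pq => // [lt|->] _ //.
rewrite IH //; [|by lia|by move=> b hb; apply: h; lia].
have hq : 0 < q.+1 < n by lia.
by apply/eqP; rewrite -(lc_geP l hq); apply: h; lia.
Qed.

(** * Crossing positions *)

(** The attractor condition with zero-based starts and one-based elements of [G]. The occurrence i'
    carries no bound: agreeing with a nonempty word that fits already forces it to fit, by
    [key_eq_fits]. *)
Definition covers (G : pred nat) (k : nat) : Prop :=
  forall i l, 0 < l -> l <= k -> i + l <= n ->
    exists i' p, [/\ key l i' = key l i, G p & i' < p <= i' + l].

End PrefixKeys.

(** * Testing blocks in the flat lattice *)

Lemma join_le (f : nat -> nat) l r :
  \big[join/0]_(l <= p < r) f p <> 1 ->
  forall p, l <= p < r -> f p = 0 \/ f p = \big[join/0]_(l <= p < r) f p.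
Proof.
elim: r => [|r IH] h p hp; first by lia.
have lr : l <= r by lia.
move: h IH; rewrite big_nat_recr //=; move: (\big[join/0]_(l <= i < r) f i) => J h IH.
case: (ltngtP p r) => [lt|gt|->]; last 1 first.
- move: h; rewrite /join.
  by split_eqs; lia.
- have := IH _ p; move: h; rewrite /join.
  by split_eqs; lia.
- by lia.
Qed.

Lemma join_const (f : nat -> nat) v l r :
  (forall p, l <= p < r -> f p = 0 \/ f p = v) ->
  \big[join/0]_(l <= p < r) f p = 0 \/ \big[join/0]_(l <= p < r) f p = v.
Proof.
move=> h; rewrite big_nat_cond; elim/big_ind: _ => //; first by left.
- move=> a b; rewrite /join.
  by split_eqs; lia.
- by move=> p /andP[/h].
Qed.

Section Queries.
Variables (W n : nat) (X : nat -> nat).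
Hypothesis X_lt : forall i, X i < W.
Hypothesis X_in : forall i, i < n -> 0 < X i.
Hypothesis X_out : forall i, n <= i -> X i = 0.
Variables (L : nat) (sa pos lc : nat -> nat).
Local Notation key := (key W X).
Local Notation covers := (covers W n X).
Hypothesis leL : n <= L.
Hypothesis sa_lt : forall p, p < n -> sa p < n.
Hypothesis sa_mono : forall p q, p < q -> q < n -> key L (sa p) < key L (sa q).
Hypothesis pos_lt : forall i, i < n -> pos i < n.
Hypothesis posK : forall i, i < n -> sa (pos i) = i.
Hypothesis lc0 : lc 0 = 0.
Hypothesis lcP : forall p, 0 < p < n ->
  key (lc p) (sa p.-1) = key (lc p) (sa p) /\
  X (sa p.-1 + lc p) <> X (sa p + lc p).

Variables (G : pred nat) (nx1 nx2 : nat -> nat) (k : nat).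
Hypothesis n_gt0 : 0 < n.
Hypothesis nx1_in : forall i, i < n -> G (nx1 i) \/ nx1 i = n.*2.+1.
Hypothesis nx1_gt : forall i, i < n -> i < nx1 i.
Hypothesis nx1_min : forall i p, i < n -> G p -> i < p -> nx1 i <= p.
Hypothesis nx2_in : forall i, i < n -> G (nx2 i) \/ nx2 i = n.*2.+1.
Hypothesis nx2_gt : forall i, i < n -> nx1 i < nx2 i \/ nx2 i = n.*2.+1.
Hypothesis nx2_min : forall i p, i < n -> G p -> nx1 i < p -> nx2 i <= p.

(* The elements of [G] in the window of length [a + 1] starting at [i]
   (zero-based; elements of [G] are one-based), as an element of the flat
   lattice: 0 for none, [p + 1] for only [p], 1 for at least two. *)
Definition window (a i : nat) : nat :=
  if nx2 i <= i + a + 1 then 1 else if nx1 i <= i + a + 1 then (nx1 i).+1 else 0.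

Lemma window_in a i p : i < n -> G p -> i < p <= i + a + 1 ->
  window a i <> 0 /\ (window a i <> 1 -> window a i = p.+1).
Proof.
move=> hi Gp hp; have h1 := nx1_min hi Gp; have h2 := nx1_gt hi.
have h3 := nx2_min hi Gp; rewrite /window.
by case: leqP => h4; [split; lia | case: leqP => h5; split; lia].
Qed.

(** The sentinel [n.*2.+1] lies beyond every window with i, a < n, so a nonzero value always stems
    from genuine elements of [G]; the top supplies two of them, one of which differs from p. *)
Lemma window_ex a i p : i < n -> a < n -> window a i <> 0 -> window a i <> p.+1 ->
  exists2 p', G p' /\ p' <> p & i < p' <= i + a + 1.
Proof.
move=> hi ha; have h5 := nx1_gt hi; have h4 := nx1_in hi; have h3 := nx2_in hi.
have h := nx2_gt hi; rewrite /window.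
case: leqP => h2.
  move=> _ _.
  have {}h : nx1 i < nx2 i by lia.
  have {}h3 : G (nx2 i) by case: h3 => //; lia.
  have {}h4 : G (nx1 i) by case: h4 => //; lia.
  by case: (eqVneq (nx1 i) p) => e; [exists (nx2 i) | exists (nx1 i)];
    try (split; first by []); lia.
case: leqP => // h1 _ ne; exists (nx1 i); last by lia.
by split; [case: h4 => //; lia | lia].
Qed.

Definition answer (l r a : nat) : nat := \big[join/0]_(l <= p < r) window a (sa p).

(** The last clause discards a single suffix shorter than a + 1, whose padded prefix is no
    substring. Larger blocks always contain a suffix that fits, by [block_fits]. *)
Definition qualified (l r a : nat) : bool :=
  [&& l < r, a < k & ~~ ((r == l.+1) && (n < sa l + a + 1))].

(* The interval is a union of classes of length-[a + 1] prefixes. *)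
Definition closed_block (l r a : nat) : Prop :=
  [/\ r <= n, forall b, l < b < r -> a <= lc b,
      l = 0 \/ lc l <= a & r = n \/ lc r <= a].

(** Two neighbouring suffixes of a block share a letters. This prefix fits at the one starting
    later, hence one more letter fits at the one starting earlier. *)
Lemma block_fits l r a : qualified l r a -> closed_block l r a ->
  exists2 q, l <= q < r & sa q + a + 1 <= n.
Proof.
move=> /and3P[lr ak short] [rn inner _ _].
case: (eqVneq r l.+1) short => /= [e|ne _].
  by rewrite -leqNgt; exists l; lia.
have l1r : l.+1 < r by lia.
have e : key a (sa l) = key a (sa l.+1).
  have hh : 0 < l.+1 < n by lia.
  by apply/eqP; rewrite -(lc_geP X_lt lcP a hh); apply: inner; lia.
have h1 : sa l < n by apply: sa_lt; lia.
have h2 : sa l.+1 < n by apply: sa_lt; lia.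
case: (ltngtP (sa l) (sa l.+1)) => [lt|gt|E].
- by have := key_eq_ltn X_lt X_in X_out e lt h2; exists l; lia.
- by have := key_eq_ltn X_lt X_in X_out (esym e) gt h1; exists l.+1; lia.
- by have := sa_mono (ltnSn l); rewrite E ltnn => /(_ (leq_trans l1r rn)).
Qed.

(** An occurrence outside would agree on a + 1 letters with one inside, across an end of the block
    where the common prefix has at most a letters. *)
Lemma block_occurrence l r a q i' : qualified l r a -> closed_block l r a ->
  l <= q < r -> sa q + a + 1 <= n -> key a.+1 i' = key a.+1 (sa q) ->
  i' < n /\ l <= pos i' < r.
Proof.
move=> /and3P[lr ak short] [rn inner hl hr] hq fit e.
have fit' : i' + a.+1 <= n by apply: (key_eq_fits X_lt X_in X_out _ (esym e)) => //; lia.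
have i'n : i' < n by lia.
split=> //; have pn := pos_lt i'n.
rewrite -(posK i'n) in e.
have be := @block_eq _ _ _ X_lt _ sa lc leL sa_mono lc0 lcP a.+1.
apply/andP; split.
- rewrite leqNgt; apply/negP => lt.
  have := (be (pos i') q (ltac:(lia)) (ltac:(lia)) (ltac:(lia))).1 e l.
  by case: hl; lia.
- rewrite ltnNge; apply/negP => ge.
  have := (be q (pos i') (ltac:(lia)) (ltac:(lia)) (ltac:(lia))).1 (esym e) r.
  by case: hr; lia.
Qed.

(** Some word of length a + 1 fits in the block, all its occurrences lie in the block, and none of
    their windows meets [G]. *)
Lemma answer0_sound l r a : qualified l r a -> closed_block l r a ->
  answer l r a = 0 -> ~ covers G k.
Proof.
move=> Hq Hb J0 cov.
have [q hq fit] := block_fits Hq Hb.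
have ak : a.+1 <= k by case/and3P: Hq.
have [|i' [p [e Gp hp]]] := cov (sa q) a.+1 isT ak; first by lia.
have [i'n hpos] := block_occurrence Hq Hb hq fit e.
have J1 : answer l r a <> 1 by rewrite J0.
have := join_le J1 hpos; rewrite -/(answer l r a) J0 posK //.
have [|nz _] := @window_in a i' p i'n Gp; first by lia.
by case.
Qed.

Lemma answer1_sound l r a p : qualified l r a -> closed_block l r a -> 0 < p ->
  answer l r a = p.+1 -> ~ covers (fun x => G x && (x != p)) k.
Proof.
move=> Hq Hb p0 Jp cov.
have [q hq fit] := block_fits Hq Hb.
have ak : a.+1 <= k by case/and3P: Hq.
have [|i' [p' [e /andP[Gp pp] hp]]] := cov (sa q) a.+1 isT ak; first by lia.
have [i'n hpos] := block_occurrence Hq Hb hq fit e.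
(* Positivity of p keeps the atom p + 1 apart from the top 1. *)
have J1 : answer l r a <> 1 by lia.
have := join_le J1 hpos; rewrite -/(answer l r a) Jp posK //.
have [|nz eq1] := @window_in a i' p' i'n Gp; first by lia.
by case=> // E; move: eq1; rewrite E => /(_ ltac:(lia)); lia.
Qed.

(** Read as: b' is removed before b. Ties go to the larger index, in accordance with [klt] and a
    traversal from the end. *)
Definition prec (b b' : nat) : bool :=
  (lc b < lc b') || ((lc b == lc b') && (b < b')).

Variable mark : pred nat.
(** The top is recorded too: its predecessor is cell 0, which belongs to no element of the set. *)
Definition recorded (l r a : nat) : Prop :=
  answer l r a <> 0 /\ mark (answer l r a).-1.

Hypothesis recorded_left : forall l b, l < b < n ->
  (forall b', l < b' < b -> prec b b') -> prec l b ->
  qualified l b (lc b) -> recorded l b (lc b).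
Hypothesis recorded_right : forall b r, b < r <= n ->
  (forall b', b < b' < r -> prec b b') -> r = n \/ prec r b ->
  qualified b r (lc b) -> recorded b r (lc b).

Lemma left_end l q : q < n -> 0 < l ->
  exists lo, [/\ lo <= q, lc lo < l & forall b, lo < b <= q -> l <= lc b].
Proof.
move=> qn l0; elim: q qn => [|q IH] qn.
  by exists 0; rewrite lc0; split=> // b; lia.
case: (ltnP (lc q.+1) l) => h; first by exists q.+1; split=> // b; lia.
have [lo [h1 h2 h3]] := IH (ltnW qn); exists lo; split=> //; first by lia.
by move=> b hb; case: (ltngtP b q.+1) => hh; [apply: h3|..|rewrite hh]; lia.
Qed.

Lemma right_end l q : q < n ->
  exists hi, [/\ q < hi <= n, hi = n \/ lc hi < l & forall b, q < b < hi -> l <= lc b].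
Proof.
move=> qn; have [m em] : exists m, q + m.+1 = n by exists (n - q).-1; lia.
elim: m q qn em => [|m IH] q qn em.
  by exists n; split; [lia | left | move=> b; lia].
case: (ltnP (lc q.+1) l) => h.
  by exists q.+1; split; [lia | right | move=> b; lia].
have [||hi [h1 h2 h3]] := IH q.+1; try lia.
exists hi; split=> //; first by lia.
by move=> b hb; case: (ltngtP b q.+1) => hh; [|apply: h3|rewrite hh]; lia.
Qed.

(** The class of a word of length l is an interval with inner boundaries of value at least l and
    ends of value below l. The inner ones disappear first; then whichever end is removed first tests
    exactly this interval, at a length a + 1 not exceeding l. *)
Lemma class_recorded i l : 0 < l -> l <= k -> i + l <= n ->
  exists lo hi a, [/\ hi <= n, a < l, recorded lo hi a &
    forall p, lo <= p < hi -> key l (sa p) = key l i].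
Proof.
move=> l0 lk il; have hi_ : i < n by lia.
have qn := pos_lt hi_; set q := pos i in qn.
have [lo [lo1 lo2 lo3]] := left_end qn l0.
have [hi [hi1 hi2 hi3]] := @right_end l q qn.
have inner b : lo < b < hi -> l <= lc b.
  by move=> hb; case: (leqP b q) => h; [apply: lo3 | apply: hi3]; lia.
have same p : lo <= p < hi -> key l (sa p) = key l i.
  move=> hp; rewrite -[i]posK // -/q.
  have be := @block_eq _ _ _ X_lt _ sa lc leL sa_mono lc0 lcP l.
  case: (leqP p q) => h.
    by apply/(be p q (ltac:(lia)) (ltac:(lia)) (ltac:(lia))) => b hb; apply: inner; lia.
  by apply/esym/(be q p (ltac:(lia)) (ltac:(lia)) (ltac:(lia))) => b hb; apply: inner; lia.
have qual a : a < l -> qualified lo hi a.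
  move=> al; apply/and3P; split; [lia|lia|].
  apply/negP => /andP[/eqP e]; have eq : lo = q by lia.
  by rewrite eq /q posK //; lia.
case: (boolP ((hi < n) && prec lo hi)) => [/andP[hn pr]|npr].
  exists lo, hi, (lc hi); have lt : lc hi < l by lia.
  split=> //; first by lia.
  apply: recorded_left => //; [lia| |exact: qual].
  by move=> b /inner; rewrite /prec; lia.
exists lo, hi, (lc lo); split=> //; first by lia.
apply: recorded_right => //; [lia| | |exact: qual].
  by move=> b /inner; rewrite /prec; lia.
by move: npr; rewrite /prec; lia.
Qed.

(** A nonempty join exhibits a suffix of the class with an element in its window of length a + 1,
    and this window is contained in the one of length l. *)
Lemma recorded_covers : covers G k.
Proof.
move=> i l l0 lk il.
have [lo [hi [a [hn al [J0 _] same]]]] := class_recorded l0 lk il.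
case E: (has (fun p => window a (sa p) != 0) (iota lo (hi - lo))).
  have /hasP[p] := E; rewrite mem_iota => hp /eqP nz.
  have pn : sa p < n by apply: sa_lt; lia.
  have [p' [Gp _] hp'] := @window_ex a (sa p) (window a (sa p)) pn ltac:(lia) nz ltac:(lia).
  by exists (sa p), p'; split=> //; [apply: same|]; lia.
case: J0; have [|//|//] := @join_const (fun p => window a (sa p)) 0 lo hi.
move=> p hp; left; apply/eqP; apply: contraFT E => nz; apply/hasP; exists p => //.
by rewrite mem_iota; lia.
Qed.

(** If every window of the class offered at most p, the join would be 0 or p + 1: the former
    contradicts the record, the latter would have marked p. *)
Lemma recorded_minimal p : ~~ mark p -> covers (fun x => G x && (x != p)) k.
Proof.
move=> np i l l0 lk il.
have [lo [hi [a [hn al [J0 mk] same]]]] := class_recorded l0 lk il.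
case E: (has (fun q => (window a (sa q) != 0) && (window a (sa q) != p.+1))
          (iota lo (hi - lo))).
  have /hasP[q] := E; rewrite mem_iota => hq /andP[/eqP nz /eqP nz'].
  have qn : sa q < n by apply: sa_lt; lia.
  have [p' [Gp np'] hp'] := @window_ex a (sa q) p qn ltac:(lia) nz nz'.
  exists (sa q), p'; split=> //; [by apply: same; lia| |lia].
  by rewrite Gp; apply/eqP.
have [|//|J1] := @join_const (fun p => window a (sa p)) p.+1 lo hi.
  move=> q hq; case: (eqVneq (window a (sa q)) 0) => [|h1]; first by left.
  right; apply/eqP; apply: contraFT E => h2; apply/hasP; exists q.
    by rewrite mem_iota; lia.
  by rewrite h1.
by move: mk; rewrite /answer J1 /= (negbTE np).
Qed.

End Queries.

(** * The checking program *)

Arguments set {T} f v x u /.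
Arguments mkseq : simpl never.
Arguments iota : simpl never.

Notation vn := 0 (only parsing).
Notation vk := 1 (only parsing).
Notation vgs := 2 (only parsing).
Notation vw := 3 (only parsing).
Notation vmask := 4 (only parsing).
Notation vN := 5 (only parsing).
Notation vb := 6 (only parsing).
Notation vi := 7 (only parsing).
Notation ve := 8 (only parsing).
Notation vq := 9 (only parsing).
Notation vp := 10 (only parsing).
Notation vj := 11 (only parsing).
Notation vc := 12 (only parsing).
Notation vl := 13 (only parsing).
Notation vh := 14 (only parsing).
Notation vc1 := 15 (only parsing).
Notation vc2 := 16 (only parsing).
Notation vt := 17 (only parsing).
Notation va := 18 (only parsing).
Notation vL := 19 (only parsing).
Notation vR := 20 (only parsing).
Notation vql := 21 (only parsing).
Notation vqr := 22 (only parsing).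
Notation vres := 23 (only parsing).
Notation vu := 24 (only parsing).
Notation vv := 25 (only parsing).
Notation vbad := 26 (only parsing).
Notation vlo := 27 (only parsing).

(* The input; sort keys and sorted order; scratch space; ranks and new ranks;
   bucket pointers; suffix array; the string padded with zeros; next element of
   the set; membership flags; segment tree; left and right neighbours in the list
   of boundaries; elements found to be indispensable. *)
Notation IN := 0 (only parsing).
Notation KEY := 1 (only parsing).
Notation ORD := 2 (only parsing).
Notation TMP := 3 (only parsing).
Notation RK := 4 (only parsing).
Notation NRK := 5 (only parsing).
Notation CNT := 6 (only parsing).
Notation SA := 7 (only parsing).
Notation XP := 8 (only parsing).
Notation NX := 9 (only parsing).
Notation GF := 10 (only parsing).
Notation TR := 11 (only parsing).
Notation LF := 12 (only parsing).
Notation RT := 13 (only parsing).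
Notation MK := 14 (only parsing).

Declare Scope prog_scope.
Delimit Scope prog_scope with prog.
Notation "c1 ;; c2" := (Seq c1 c2) (at level 80, right associativity) : prog_scope.
Notation "e1 +! e2" := (Op HAdd e1 e2) (at level 50, left associativity) : prog_scope.
Notation "e1 -! e2" := (Op HSub e1 e2) (at level 50, left associativity) : prog_scope.
Notation "v <-- e" := (Asg v e) (at level 70) : prog_scope.
Local Open Scope prog_scope.

(** * Stable radix sort on bits *)

Definition key_bit := Op HBit (Get KEY (V ve)) (V vb).
Definition append (e : expr) := Put TMP (V vq) e ;; vq <-- V vq +! N 1.

Definition radix_sort :=
  For vi (N 0) vN (Put ORD (V vi) (V vi)) ;;
  For vb (N 0) vw (
    vq <-- N 0 ;;
    For vi (N 0) vN (ve <-- Get ORD (V vi) ;;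
      If (Eq key_bit (N 0)) (append (V ve)) Skip) ;;
    For vi (N 0) vN (ve <-- Get ORD (V vi) ;;
      If (Eq key_bit (N 1)) (append (V ve)) Skip) ;;
    For vi (N 0) vN (Put ORD (V vi) (Get TMP (V vi)))).

Ltac simp := cbn [eval safe beval bsafe opeval opsafe set Nat.eqb memb modv moda cat orb key_bit append].
Ltac simp_in H := cbn [eval safe beval bsafe opeval opsafe set Nat.eqb memb modv moda cat orb key_bit append] in H.
Ltac wp_side := simp; repeat split; try lia.
Ltac wp_step :=
  lazymatch goal with
  | |- wp _ _ (append _) _ _ _ _ => rewrite /append
  | |- wp _ _ (Seq _ _) _ _ _ _ => apply: wp_seq
  | |- wp _ _ (Asg _ _) _ _ _ _ => apply: wp_asg; [wp_side | simp]
  | |- wp _ _ (Put _ _ _) _ _ _ _ =>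
      apply: wp_put; [wp_side | wp_side | wp_side | simp]
  | |- wp _ _ Skip _ _ _ _ => apply: wp_skip; simp
  | |- wp _ _ (If _ _ _) _ _ _ _ => apply: wp_if; [wp_side | simp | simp]
  | |- wp _ _ ?c _ _ _ _ => unfold c
  end.

Lemma mkseqS T (f : nat -> T) m : mkseq f m.+1 = rcons (mkseq f m) (f m).
Proof. by rewrite /mkseq -addn1 iotaD map_cat cats1. Qed.

Lemma mkseq_upd f m x : mkseq (upd f m x) m.+1 = rcons (mkseq f m) x.
Proof.
rewrite mkseqS {2}/upd eqxx; congr rcons; apply/eq_in_map => i.
by rewrite mem_iota /upd => h; rewrite ltn_eqF //; lia.
Qed.

(** Breaking ties by position turns the sorted order into a strict one; the sweep relies on it to
    order events of equal key. *)
Definition klt (f : nat -> nat) (i j : nat) : bool :=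
  (f i < f j) || ((f i == f j) && (i < j)).

Lemma modn_exp2S x b : x %% 2 ^ b.+1 = odd (x %/ 2 ^ b) * 2 ^ b + x %% 2 ^ b.
Proof.
have e : x = x %/ 2 ^ b.+1 * 2 ^ b.+1 + x %% 2 ^ b.+1 by apply: divn_eq.
have e1 : x = x %/ 2 ^ b * 2 ^ b + x %% 2 ^ b by apply: divn_eq.
rewrite {1}e1 -{1}(odd_double_half (x %/ 2 ^ b)) mulnDl -addnA -muln2 -mulnA -expnS.
rewrite addnCA modnMDl modn_small //.
have : x %% 2 ^ b < 2 ^ b by rewrite ltn_mod expn_gt0.
by rewrite expnS; case: odd; lia.
Qed.

(** Among items with the same new bit the old order is already right; between the two halves the new
    bit decides. *)
Lemma radix_step (f : nat -> nat) b s :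
  let bit e := odd (f e %/ 2 ^ b) in
  pairwise (klt (fun i => f i %% 2 ^ b)) s ->
  pairwise (klt (fun i => f i %% 2 ^ b.+1))
    ([seq e <- s | ~~ bit e] ++ [seq e <- s | bit e]).
Proof.
move=> bit ps; have m0 i : f i %% 2 ^ b < 2 ^ b by rewrite ltn_mod expn_gt0.
have sub (c : bool) : pairwise (klt (fun i => f i %% 2 ^ b.+1)) [seq e <- s | bit e == c].
  apply: (@sub_in_pairwise _ (fun e => bit e == c) (klt (fun i => f i %% 2 ^ b))).
  - move=> i j /eqP hi /eqP hj; rewrite /klt !modn_exp2S ltn_digits // eqn_digits //.
    by rewrite -/(bit i) -/(bit j) hi hj ltnn eqxx.
  - exact: filter_all.
  - exact: pairwise_filter.
rewrite pairwise_cat; apply/and3P; split.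
- apply/allrelP => i j; rewrite !mem_filter => /andP[/negbTE hi _] /andP[hj _].
  by rewrite /klt !modn_exp2S ltn_digits // -/(bit i) -/(bit j) hi hj.
- by have := sub false; under eq_filter do rewrite eqbF_neg.
- by have := sub true; under eq_filter do rewrite eqb_id.
Qed.

Section Phases.
Variables (w B : nat).
Local Notation W := (2 ^ w).
Hypothesis BW : 16 * B < W.
Hypothesis B8 : 8 <= B.

Lemma radix_sortP m r a t :
  r vN = m -> r vw = w -> w < W -> m <= B ->
  (forall i, i < m -> a KEY i < W) ->
  wp w B radix_sort (fun r' a' t' =>
    [/\ perm_eq (mkseq (a' ORD) m) (iota 0 m),
        pairwise (klt (a KEY)) (mkseq (a' ORD) m) &
        t' <= t + 20 * (w + 1) * (m + 1)]) r a t.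
Proof.
move=> rN rw wW mB kW; rewrite /radix_sort.
wp_step; apply: (@wp_forc _ _ 1 (fun i r' a' => mkseq (a' ORD) i = iota 0 i)) => //; simp; try lia.
  move=> i r' a' t' hi [Fv Fa] rv; simp => e; wp_step => //.
  split; last by lia.
  by rewrite rv mkseq_upd e -addn1 iotaD cats1.
move=> r1 a1 t1 [Fv1 Fa1] _; simp => e1 ht1.
have r1N : r1 vN = m by rewrite Fv1.
have r1w : r1 vw = w by rewrite Fv1.
have a1K : a1 KEY = a KEY by rewrite Fa1.
have pass_bound s i (P : pred nat) : size [seq e <- mkseq s i | P e] <= i.
  by rewrite size_filter (leq_trans (count_size _ _)) // size_mkseq.
apply: (@wp_forc _ _ (15 * m + 7) (fun b r' a' => let s := mkseq (a' ORD) m in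
  perm_eq s (iota 0 m) /\ pairwise (klt (fun i => a KEY i %% 2 ^ b)) s)) => //; simp; try lia.
- rewrite -rN e1; split=> //.
  have : pairwise ltn (iota 0 (r vN)) by rewrite -(sorted_pairwise ltn_trans) iota_ltn_sorted.
  by apply: sub_pairwise => i j; rewrite /klt /= !modn1.
- move=> b r2 a2 t2 hb [Fv2 Fa2] r2b [pm pw].
  rewrite /= in Fv2 Fa2; set s := mkseq (a2 ORD) m in pm pw.
  have szs : size s = m by rewrite size_mkseq.
  have s_in i : i < m -> a2 ORD i < m.
    move=> hi; have : a2 ORD i \in s by apply: map_f; rewrite mem_iota.
    by rewrite (perm_mem pm) mem_iota.
  have r2N : r2 vN = m by rewrite Fv2.
  have a2K : a2 KEY = a KEY by rewrite Fa2.
  wp_step; wp_step; wp_step.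
  pose bit e := odd (a KEY e %/ 2 ^ b).
  apply: (@wp_forc _ _ 4 (fun i r' a' =>
    mkseq (a' TMP) (r' vq) = [seq e <- mkseq (a2 ORD) i | ~~ bit e])) => //; simp; try lia.
    move=> i r3 a3 t3 hi [Fv3 Fa3] r3i; simp => e3; rewrite /= in Fv3 Fa3.
    have a3O : a3 ORD = a2 ORD by rewrite Fa3.
    have a3K : a3 KEY = a KEY by rewrite Fa3.
    have r3b : r3 vb = b by rewrite Fv3 /=.
    have qi : r3 vq <= i by rewrite -(size_mkseq (a3 TMP) (r3 vq)) e3.
    wp_step; wp_step; rewrite r3i a3O.
    wp_step.
    + have := s_in i; lia.
    + rewrite a3K r3b => h; do 4!wp_step; split; last by lia. 
      rewrite addn1 mkseq_upd mkseqS filter_rcons e3 /bit.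
      by move: h; case: odd.
    + rewrite a3K r3b => h; wp_step; split; last by lia.
      rewrite mkseqS filter_rcons e3 /bit.
      by move: h; case: odd.
  move=> r3 a3 t3 [Fv3 Fa3] _; simp => e3 ht3; rewrite /= in Fv3 Fa3.
  wp_step; rewrite r2N -/s in e3.
  have a3O : a3 ORD = a2 ORD by rewrite Fa3.
  have r3N : r3 vN = m by rewrite Fv3.
  have r3b : r3 vb = b by rewrite Fv3.
  have a3K : a3 KEY = a KEY by rewrite Fa3.
  apply: (@wp_forc _ _ 4 (fun i r' a' =>
    mkseq (a' TMP) (r' vq) = [seq e <- s | ~~ bit e] ++ [seq e <- mkseq (a2 ORD) i | bit e])) => //; simp; try lia.
  + by rewrite cats0.
  + move=> i r4 a4 t4 hi [Fv4 Fa4] r4i; simp => e4; rewrite /= in Fv4 Fa4.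
    have a4O : a4 ORD = a2 ORD by rewrite Fa4.
    have a4K : a4 KEY = a KEY by rewrite Fa4.
    have r4b : r4 vb = b by rewrite Fv4.
    have qi : r4 vq <= size [seq e <- s | ~~ bit e] + size [seq e <- mkseq (a2 ORD) i | bit e].
      by rewrite -(size_mkseq (a4 TMP) (r4 vq)) e4 size_cat.
    have lt_m : a4 KEY (a2 ORD i) < W by rewrite a4K; apply/kW/s_in; lia.
    (* There is room for one more: the item about to be appended occurs in [s] but not yet among
       those already copied. *)
    have qm : bit (a2 ORD i) -> r4 vq < m.
      move=> hb1; apply: leq_ltn_trans qi _; rewrite -szs -[size s](count_predC bit).
      rewrite !size_filter addnC ltn_add2r.
      have -> : s = mkseq (a2 ORD) i ++ [seq a2 ORD u | u <- iota i (m - i)].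
        by rewrite /s /mkseq -map_cat -iotaD subnKC //; lia.
      rewrite count_cat -[X in X < _]addn0 ltn_add2l -has_count; apply/hasP.
      by exists (a2 ORD i) => //; apply: map_f; rewrite mem_iota; lia.
    wp_step; wp_step; rewrite r4i a4O.
    wp_step.
    * have := s_in i; lia.
    * rewrite a4K r4b => h; have {}qm : r4 vq < m by apply: qm; move: h; rewrite /bit; case: odd.
      do 4!wp_step; split; last by lia.
      rewrite addn1 mkseq_upd mkseqS filter_rcons e4 /bit.
      by move: h; case: odd => //= _; rewrite rcons_cat.
    * rewrite a4K r4b => h; wp_step; split; last by lia.
      rewrite mkseqS filter_rcons e4 /bit.
      by move: h; case: odd.
  move=> r4 a4 t4 [Fv4 Fa4] _; simp => e4 ht4; rewrite /= in Fv4 Fa4.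
  rewrite r3N -/s in e4.
  have r4q : r4 vq = m.
    rewrite -(size_mkseq (a4 TMP) (r4 vq)) e4 size_cat !size_filter addnC.
    by rewrite -szs; apply: count_predC.
  have r4N : r4 vN = m by rewrite Fv4.
  apply: (@wp_forc _ _ 1 (fun i r' a' => a' TMP = a4 TMP /\
     mkseq (a' ORD) i = mkseq (a4 TMP) i)) => //; simp; try lia.
    move=> i r5 a5 t5 hi [Fv5 Fa5] r5i [e5 e6]; rewrite /= in Fv5 Fa5.
    by wp_step; rewrite ?r5i; try lia; split; [split=> //; rewrite mkseq_upd e6 mkseqS e5|lia].
  move=> r5 a5 t5 [Fv5 Fa5] _ [_ e5] ht5; rewrite r4N in e5 ht5.
  rewrite r4q in e4; rewrite e5 e4; split; last by lia.
  split; last exact: radix_step.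
  by rewrite perm_catC perm_filterC.
- move=> r2 a2 t2 [Fv2 Fa2] _ [pm pw] ht2; split=> //; last first.
    rewrite r1w in ht2; move: ht1 ht2; rewrite rN; clear; nia.
  apply: (@sub_in_pairwise _ (fun i => i < m)) pw; last first.
    by rewrite (perm_all _ pm); apply/allP => i; rewrite mem_iota.
  by move=> i j hi hj; rewrite /klt r1w !modn_small ?kW.
Qed.

End Phases.

(** * Suffix array by prefix doubling *)

Definition rank_pass :=
  For vp (N 0) vn (
    vi <-- Get ORD (V vp) ;;
    If (Eq (V vp) (N 0)) (vc <-- N 1) (
      vj <-- Get ORD (V vp -! N 1) ;;
      If (Eq (Get RK (V vi)) (Get RK (V vj)))
        (If (Eq (Get RK (V vi +! V vl)) (Get RK (V vj +! V vl)))
          Skip (vc <-- V vp +! N 1))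
        (vc <-- V vp +! N 1)) ;;
    Put NRK (V vi) (V vc)) ;;
  For vi (N 0) vn (Put RK (V vi) (Get NRK (V vi))).

(** The order by second halves needs no sorting: positions from n - l on have an empty second half
    and come first, the others are the current order shifted by l. A stable distribution by current
    rank completes the round. A rank is one more than the start of its bucket, whence the initial
    values of [CNT]. *)
Definition double_step :=
  vq <-- N 0 ;;
  For vi (V vn -! V vl) vn (append (V vi)) ;;
  For vp (N 0) vn (vi <-- Get ORD (V vp) ;;
    If (Lt (V vi) (V vl)) Skip (append (V vi -! V vl))) ;;
  For vp (N 0) vn (Put CNT (V vp +! N 1) (V vp)) ;;
  For vp (N 0) vn (
    vi <-- Get TMP (V vp) ;; vc <-- Get RK (V vi) ;; vj <-- Get CNT (V vc) ;;
    Put ORD (V vj) (V vi) ;; Put CNT (V vc) (V vj +! N 1)) ;;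
  rank_pass ;;
  vl <-- V vl +! V vl.

(** Letters can be arbitrary positive words, too large to index buckets; hence one radix sort at the
    beginning. From then on ranks are at most n. *)
Definition suffix_sort :=
  For vi (N 0) vn (
    vc <-- Get IN (V vi +! N 4) ;;
    Put KEY (V vi) (V vc) ;; Put RK (V vi) (V vc) ;; Put XP (V vi) (V vc)) ;;
  vN <-- V vn ;;
  radix_sort ;;
  vl <-- N 0 ;;
  rank_pass ;;
  vl <-- N 1 ;;
  While (Lt (V vl) (V vn)) double_step.

(** Doubling 1 modulo 2^w reaches 0 after exactly w steps. *)
Definition word_bits :=
  vmask <-- N 1 ;; vw <-- N 0 ;;
  While (Lt (N 0) (V vmask))
    (vmask <-- Op HAddW (V vmask) (V vmask) ;; vw <-- V vw +! N 1).

Section ListFacts.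
Variable n : nat.
Implicit Types (sa tmp f g : nat -> nat).

Lemma mkseq_perm_lt sa p : perm_eq (mkseq sa n) (iota 0 n) -> p < n -> sa p < n.
Proof.
move=> pm hp; have : sa p \in mkseq sa n by apply: map_f; rewrite mem_iota.
by rewrite (perm_mem pm) mem_iota.
Qed.

Lemma mkseq_perm_onto sa i : perm_eq (mkseq sa n) (iota 0 n) -> i < n ->
  exists2 p, p < n & sa p = i.
Proof.
move=> pm hi; have : i \in mkseq sa n by rewrite (perm_mem pm) mem_iota.
by case/mapP => p; rewrite mem_iota => hp ->; exists p.
Qed.

Lemma mkseq_perm_inj sa p q : perm_eq (mkseq sa n) (iota 0 n) ->
  p < n -> q < n -> sa p = sa q -> p = q.
Proof.
move=> pm hp hq e; have u : uniq (mkseq sa n) by rewrite (perm_uniq pm) iota_uniq.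
have := nth_uniq 0 (s := mkseq sa n) (i := p) (j := q).
by rewrite size_mkseq !nth_mkseq // e eqxx => /(_ hp hq u)/esym/eqP.
Qed.

Lemma pairwise_mkseq (R : rel nat) sa :
  reflect (forall p q, p < q -> q < n -> R (sa p) (sa q)) (pairwise R (mkseq sa n)).
Proof.
apply: (iffP (pairwiseP 0)) => [h p q pq qn|h p q].
  have pn := ltn_trans pq qn.
  by have := h p q; rewrite !inE size_mkseq !nth_mkseq //; apply.
by rewrite !inE size_mkseq => hp hq pq; rewrite !nth_mkseq //; apply: h.
Qed.

Lemma count_lt_iota p : p <= n -> count (fun q => q < p) (iota 0 n) = p.
Proof.
move=> pn; rewrite -(subnKC pn) iotaD count_cat.
rewrite (eq_in_count (a2 := predT)); last by move=> q; rewrite mem_iota /= => ->.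
rewrite count_predT size_iota.
rewrite (eq_in_count (a2 := pred0)) ?count_pred0 ?addn0 //.
by move=> q; rewrite mem_iota /=; lia.
Qed.

Lemma below_sorted sa f p : perm_eq (mkseq sa n) (iota 0 n) ->
  pairwise (fun i j => f i <= f j) (mkseq sa n) -> p < n ->
  p = 0 \/ f (sa p.-1) < f (sa p) -> below n f (sa p) = p.
Proof.
move=> pm /pairwise_mkseq srt pn hp; rewrite /below -(permP pm) count_map.
rewrite -[RHS](@count_lt_iota p (ltnW pn)); apply: eq_in_count => q.
rewrite mem_iota /= => qn; case: (ltnP q p) => qp; last first.
  case: (ltngtP q p) qp => // [lt|->] _; last by rewrite ltnn.
  by have := srt p q lt qn; rewrite leqNgt => /negbTE.
case: hp => [|hp]; first by lia.
apply: leq_ltn_trans hp; case: (ltngtP q p.-1) => [lt|gt|->//]; last by lia.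
by apply: srt => //; lia.
Qed.

Lemma count_prefix_lt (P : pred nat) tmp q : q < n -> P (tmp q) ->
  count P (mkseq tmp q) < count P (mkseq tmp n).
Proof.
move=> qn Pq; have -> : mkseq tmp n = mkseq tmp q ++ [seq tmp u | u <- iota q (n - q)].
  by rewrite /mkseq -map_cat -iotaD subnKC // ltnW.
rewrite count_cat -[X in X < _]addn0 ltn_add2l -has_count; apply/hasP.
by exists (tmp q) => //; apply: map_f; rewrite mem_iota; lia.
Qed.

Lemma inj_onto f p : (forall q, q < n -> f q < n) ->
  (forall q q', q < n -> q' < n -> f q = f q' -> q = q') -> p < n ->
  exists2 q, q < n & f q = p.
Proof.
move=> flt finj pn.
have u : uniq (mkseq f n).
  rewrite map_inj_in_uniq ?iota_uniq // => x y; rewrite !mem_iota; exact: finj.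
have sub : {subset mkseq f n <= iota 0 n}.
  by move=> x /mapP[q]; rewrite mem_iota => hq ->; rewrite mem_iota; apply: flt.
have [|_ eqi] := uniq_min_size u sub; first by rewrite size_mkseq size_iota.
have : p \in mkseq f n by rewrite eqi mem_iota.
by case/mapP => q; rewrite mem_iota => hq ->; exists q.
Qed.

(* The cell that a stable distribution by [g] gives to the [q]-th item. *)
Definition place g tmp (q : nat) : nat :=
  below n g (tmp q) + count (fun j => g j == g (tmp q)) (mkseq tmp q).

Section Placement.
Variables (g tmp : nat -> nat).
Hypothesis pm : perm_eq (mkseq tmp n) (iota 0 n).

Lemma place_mono q q' : q < n -> q' < n ->
  (g (tmp q) < g (tmp q')) || ((g (tmp q) == g (tmp q')) && (q < q')) ->
  place g tmp q < place g tmp q'.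
Proof.
move=> hq hq' /orP[lt|/andP[/eqP e lt]].
  apply: (@leq_trans (below n g (tmp q'))); last exact: leq_addr.
  apply: leq_trans (below_mono (mkseq_perm_lt pm hq') lt).
  by rewrite ltn_add2l -(permP pm); apply: (@count_prefix_lt _ tmp q hq); rewrite /= eqxx.
rewrite /place e (below_congr _ e) ltn_add2l.
have -> : mkseq tmp q' = mkseq tmp q ++ [seq tmp u | u <- iota q (q' - q)].
  by rewrite /mkseq -map_cat -iotaD subnKC // ltnW.
rewrite count_cat -[X in X < _]addn0 ltn_add2l -has_count; apply/hasP.
by exists (tmp q); rewrite ?e //; apply: map_f; rewrite mem_iota; lia.
Qed.

Lemma place_lt q : q < n -> place g tmp q < n.
Proof.
move=> hq.
apply: (@leq_trans (below n g (tmp q) + count (fun j => g j == g (tmp q)) (mkseq tmp n))).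
  by rewrite ltn_add2l; apply: count_prefix_lt.
rewrite (permP pm) /below -count_predUI.
rewrite (@eq_count _ (predI _ _) pred0) ?count_pred0 ?addn0; last by move=> u /=; lia.
by rewrite (leq_trans (count_size _ _)) ?size_iota.
Qed.

Lemma place_total q q' : q < n -> q' < n -> q <> q' ->
  let lex u v := (g (tmp u) < g (tmp v)) || ((g (tmp u) == g (tmp v)) && (u < v)) in
  lex q q' \/ lex q' q.
Proof. by move=> _ _ ne /=; case: (ltngtP (g (tmp q)) (g (tmp q'))); lia. Qed.

Lemma place_inj q q' : q < n -> q' < n -> place g tmp q = place g tmp q' -> q = q'.
Proof.
move=> hq hq' e; case: (eqVneq q q') => // /eqP ne.
by case: (place_total hq hq' ne) => h; have := place_mono _ _ h; rewrite e ltnn => /(_ _ _)h';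
  have := h' ltac:(assumption) ltac:(assumption).
Qed.

(** [place] is injective from n items to n cells, hence onto, and it is monotone in the pair of new
    key and old order. *)
Lemma placed_sorted sa (R : rel nat) : pairwise R (mkseq tmp n) ->
  (forall q, q < n -> sa (place g tmp q) = tmp q) ->
  perm_eq (mkseq sa n) (iota 0 n) /\
  pairwise (fun i j => (g i < g j) || ((g i == g j) && R i j)) (mkseq sa n).
Proof.
move=> /pairwise_mkseq srt h.
have onto p : p < n -> exists2 q, q < n & place g tmp q = p.
  by apply: inj_onto; [apply: place_lt | apply: place_inj].
split.
  have sub : {subset iota 0 n <= mkseq sa n}.
    move=> i; rewrite mem_iota => /(mkseq_perm_onto pm)[q hq <-].
    by rewrite -h //; apply: map_f; rewrite mem_iota; apply: place_lt.
  have [|_ eqi] := uniq_min_size (iota_uniq 0 n) sub; first by rewrite size_mkseq size_iota.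
  apply: uniq_perm; [|exact: iota_uniq|by move=> x; rewrite eqi].
  by apply: (leq_size_uniq (iota_uniq 0 n) sub); rewrite size_mkseq size_iota.
apply/pairwise_mkseq => p p' pp pn.
have [q hq eq] := onto p (ltn_trans pp pn); have [q' hq' eq'] := onto p' pn.
have ne : q <> q' by move=> E; move: pp; rewrite -eq -eq' E ltnn.
case: (place_total hq hq' ne) => lex; last first.
  by have := place_mono hq' hq lex; lia.
rewrite -eq -eq' !h //; case/orP: lex => [->//|/andP[-> lt]].
by rewrite srt ?orbT.
Qed.

End Placement.
End ListFacts.

Section SuffixSort.
Variables (w B n : nat) (X : nat -> nat).
Local Notation W := (2 ^ w).
Hypothesis X_lt : forall i, X i < W.
Hypothesis X_in : forall i, i < n -> 0 < X i.
Hypothesis X_out : forall i, n <= i -> X i = 0.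
Local Notation key := (key W X).

Lemma second_key_order l sa : l < n ->
  perm_eq (mkseq sa n) (iota 0 n) ->
  pairwise (fun i j => key l i <= key l j) (mkseq sa n) ->
  let s := iota (n - l) l ++ [seq i - l | i <- mkseq sa n & l <= i] in
  perm_eq s (iota 0 n) /\ pairwise (fun i j => key l (i + l) <= key l (j + l)) s.
Proof.
move=> ln pm srt s; split.
  have -> : iota 0 n = iota 0 (n - l) ++ iota (n - l) l.
    by rewrite -{1}(subnK (ltnW ln)) iotaD add0n.
  rewrite perm_catC perm_cat2r.
  rewrite (permPl (perm_map (fun i => i - l) (perm_filter (fun i => l <= i) pm))).
  have -> : iota 0 n = iota 0 l ++ iota l (n - l) by rewrite -{1}(subnKC (ltnW ln)) iotaD.
  rewrite filter_cat (@eq_in_filter _ _ pred0) ?filter_pred0 /=; last first.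
    by move=> i; rewrite mem_iota /=; lia.
  rewrite (@eq_in_filter _ _ predT) ?filter_predT /=; last first.
    by move=> i; rewrite mem_iota /=; lia.
  rewrite -[X in iota X]addn0 iotaDl -map_comp.
  rewrite (@eq_map _ _ _ id) ?map_id // => i /=; lia.
rewrite pairwise_cat; apply/and3P; split.
- apply/allrelP => i j; rewrite mem_iota => hi _.
  by rewrite (key_out _ X_out) //; lia.
- apply: (@sub_in_pairwise _ (fun i => n - l <= i) ltn).
  + by move=> i j hi _ _; rewrite (key_out _ X_out) //; lia.
  + by apply/allP => i; rewrite mem_iota; lia.
  + by rewrite -(sorted_pairwise ltn_trans) iota_ltn_sorted.
- rewrite pairwise_map.
  apply: (@sub_in_pairwise _ (fun i => l <= i) (fun i j => key l i <= key l j)).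
  + by move=> i j hi hj /=; rewrite !subnK.
  + exact: filter_all.
  + exact: pairwise_filter.
Qed.

Hypothesis BW : 16 * B < W.
Hypothesis wW : w < W.
Hypothesis nB : 4 * n + 8 <= B.

Lemma word_bitsP r a t :
  wp w B word_bits (fun r' a' t' => r' vw = w /\ t' <= t + 3 * w + 3) r a t.
Proof.
have W1 : 1 < W by lia.
do 5!wp_step.
apply: (@wp_while _ _ (fun m r' a' t' => [/\ r' vw + m = w,
   r' vmask = if m == 0 then 0 else 2 ^ (r' vw) & t' <= t + 2 + 3 * r' vw]) w); simp.
  by split; [| case: eqP => // w0; move: W1; rewrite w0 | lia].
move=> m r' a' t' _ [e1 e2 e3]; split; first by lia.
case: m e1 e2 => [|m] e1 e2.
  by rewrite e2 /=; split; lia.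
rewrite e2 /= expn_gt0 /=; do 3!wp_step.
exists m => //; split; [lia | | lia].
rewrite e2 /= addnn -mul2n -expnS addn1; case: eqP => m0.
  have -> : (r' vw).+1 = w by lia.
  exact: modnn.
by rewrite modn_small // ltn_exp2l //; lia.
Qed.

(** [f] is any key whose equality is decided by two stored ranks: [key 1] at the start, where [vl]
    is 0 and the two comparisons coincide, and [key (l + l)] while doubling. A class is ranked by
    the one-based position of its first member. *)
Lemma rank_passP f r a t :
  r vn = n -> r vl <= n -> perm_eq (mkseq (a ORD) n) (iota 0 n) ->
  pairwise (fun i j => f i <= f j) (mkseq (a ORD) n) ->
  (forall i j, i < n -> j < n -> (f i == f j) =
     (a RK i == a RK j) && (a RK (i + r vl) == a RK (j + r vl))) ->
  wp w B rank_pass (fun r' a' t' =>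
    [/\ forall i, i < n -> a' RK i = (below n f i).+1,
        forall i, n <= i -> a' RK i = a RK i & t' <= t + 12 * n + 4]) r a t.
Proof.
move=> rn rl pm srt cmp; have W1 : 8 < W by lia.
have sa_lt p := mkseq_perm_lt (p := p) pm.
do 2!wp_step; apply: (@wp_forc _ _ 7 (fun p r' a' =>
  (forall q, q < p -> a' NRK (a ORD q) = (below n f (a ORD q)).+1) /\
  (0 < p -> r' vc = (below n f (a ORD p.-1)).+1))) => //; simp; try lia.
- move=> p r1 a1 t1 hp [Fv Fa] r1p [e1 e2]; simp_in Fv; simp_in Fa.
  have r1l : r1 vl = r vl by rewrite Fv.
  have a1O : a1 ORD = a ORD by rewrite Fa.
  have a1R : a1 RK = a RK by rewrite Fa.
  have pn : p < n by lia.
  have hi := sa_lt p pn.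
  have fin r2 t2 : r2 vi = a ORD p -> r2 vc = (below n f (a ORD p)).+1 -> t2 < t1 + 7 ->
    wp w B (Put NRK (V vi) (V vc)) (fun r'' a'' t'' =>
      ((forall q, q < p.+1 -> a'' NRK (a ORD q) = (below n f (a ORD q)).+1) /\
       (0 < p.+1 -> r'' vc = (below n f (a ORD p.+1.-1)).+1)) /\ t'' <= t1 + 7) r2 a1 t2.
    move=> h1 h2 h3; wp_step; split; last by lia.
    split=> // q hq; rewrite /upd h1 h2; case: eqP => [->//|ne].
    by apply: e1; case: (ltngtP q p) => // [|E]; [lia | case: ne; rewrite E].
  wp_step; wp_step; rewrite r1p a1O.
  wp_step; wp_step; rewrite r1p.
  + move=> /eqP p0; wp_step; apply: fin => //; last by lia.
    have -> : below n f (a ORD p) = p by apply: (below_sorted pm srt pn); left.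
    by rewrite p0.
  + move=> /eqP p0; do 2!wp_step; rewrite a1O r1p subn1.
    have hj : a ORD p.-1 < n by apply: sa_lt; lia.
    have new : f (a ORD p.-1) != f (a ORD p) -> below n f (a ORD p) = p.
      move=> ne; apply: (below_sorted pm srt pn); right.
      rewrite ltn_neqAle ne /=; move/pairwise_mkseq: srt; apply; lia.
    have eqf := cmp (a ORD p) (a ORD p.-1) hi hj.
    wp_step; rewrite a1R.
    * move=> E; wp_step; rewrite a1R r1l => E2; wp_step; apply: fin => //=; try lia.
        rewrite e2; last by lia.
        congr S; apply: below_congr; apply/esym/eqP.
        by rewrite eqf E E2.
    * move=> E; wp_step; apply: fin => //=; last by lia.
      by rewrite r1p new ?addn1 // eq_sym eqf negb_and E.
- move=> r1 a1 t1 [Fv Fa] _ [e1 _] ht1; simp_in Fv; simp_in Fa.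
  have r1n : r1 vn = n by rewrite Fv.
  have a1R : a1 RK = a RK by rewrite Fa.
  apply: (@wp_forc _ _ 1 (fun i r' a' => [/\ a' NRK = a1 NRK,
     forall q, q < i -> a' RK q = a1 NRK q & forall q, n <= q -> a' RK q = a1 RK q])) => //;
    simp; try lia.
    move=> i r2 a2 t2 hi [Fv2 Fa2] r2i [e2 e3 e4]; wp_step.
    split; last by lia.
    split=> // q hq; rewrite /upd r2i e2; first by case: eqP => [->//|ne]; apply: e3; lia.
    by rewrite gtn_eqF; [apply: e4 | lia].
  move=> r2 a2 t2 [Fv2 Fa2] _ [e2 e3 e4] ht2; split.
  + move=> i hi; rewrite e3; last by lia.
    by have [p pn <-] := mkseq_perm_onto pm hi; apply: e1; lia.
  + by move=> i hi; rewrite e4 // a1R.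
  + by lia.
Qed.

Definition sorted_upto (l : nat) (a : arrays) : Prop :=
  [/\ perm_eq (mkseq (a ORD) n) (iota 0 n),
      pairwise (fun i j => key l i <= key l j) (mkseq (a ORD) n) &
      forall i, a RK i = krank W n X l i].

Lemma double_stepP r a t :
  r vn = n -> 0 < r vl -> r vl < n -> sorted_upto (r vl) a ->
  wp w B double_step (fun r' a' t' =>
    [/\ r' vl = r vl + r vl, sorted_upto (r vl + r vl) a' & t' <= t + 36 * n + 20]) r a t.
Proof.
move=> rn l0 ln [pm srt rk]; set l := r vl in l0 ln srt rk *.
have W1 : 8 < W by lia.
have sa_lt p := mkseq_perm_lt (p := p) pm.
do 4!wp_step; apply: (@wp_forc _ _ 2 (fun i r' a' =>
  mkseq (a' TMP) (r' vq) = iota (n - l) (i - (n - l)))) => //; simp; rewrite -/l ?rn; try lia.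
- by split=> //; apply: ltnW.
- by rewrite subnn.
- move=> i r1 a1 t1 hi [Fv Fa] r1i e1.
  have q1 : r1 vq <= n by rewrite -(size_mkseq (a1 TMP) (r1 vq)) e1 size_iota; lia.
  do 4!wp_step; split; last by lia.
  rewrite addn1 mkseq_upd e1 r1i.
  have -> : i.+1 - (n - l) = i - (n - l) + 1 by lia.
  by rewrite iotaD -cats1; congr (_ ++ _); congr cons; lia.
move=> r1 a1 t1 [Fv1 Fa1] _ e1 ht1; simp_in Fv1; simp_in Fa1.
have r1n : r1 vn = n by rewrite Fv1.
have r1l : r1 vl = l by rewrite Fv1.
have a1O : a1 ORD = a ORD by rewrite Fa1.
have a1R : a1 RK = a RK by rewrite Fa1.
have {}e1 : mkseq (a1 TMP) (r1 vq) = iota (n - l) l by rewrite e1; congr iota; lia.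
wp_step; apply: (@wp_forc _ _ 4 (fun p r' a' => mkseq (a' TMP) (r' vq) =
  iota (n - l) l ++ [seq i - l | i <- mkseq (a ORD) p & l <= i])) => //; simp; rewrite ?r1n; try lia.
- by rewrite cats0.
- move=> p r2 a2 t2 hp [Fv2 Fa2] r2p e2; simp_in Fv2; simp_in Fa2.
  have a2O : a2 ORD = a ORD by rewrite Fa2.
  have r2l : r2 vl = l by rewrite Fv2.
  have q2 : r2 vq <= l + p.
    rewrite -(size_mkseq (a2 TMP) (r2 vq)) e2 size_cat size_iota leq_add2l size_map size_filter.
    by rewrite (leq_trans (count_size _ _)) // size_mkseq.
  wp_step; wp_step; rewrite r2p a2O.
  wp_step; rewrite r2l => h.
    wp_step; split; last by lia.
    by rewrite mkseqS filter_rcons leqNgt h.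
  do 4!wp_step; rewrite ?r2l; try lia; split; last by lia.
  rewrite addn1 mkseq_upd mkseqS filter_rcons leqNgt (negbTE h) /= map_rcons e2 rcons_cat.
  by [].
move=> r2 a2 t2 [Fv2 Fa2] _ e2 ht2; simp_in Fv2; simp_in Fa2.
have r2n : r2 vn = n by rewrite Fv2.
have r2l : r2 vl = l by rewrite Fv2.
have a2R : a2 RK = a RK by rewrite Fa2.
have [pmT srtT] := second_key_order ln pm srt.
rewrite -e2 in pmT srtT.
have q2 : r2 vq = n by have := perm_size pmT; rewrite size_mkseq size_iota.
rewrite q2 in pmT srtT.
set tmp := a2 TMP in pmT srtT.
wp_step; apply: (@wp_forc _ _ 1 (fun p r' a' =>
  forall q, q < p -> a' CNT q.+1 = q)) => //; simp; rewrite ?r2n; try lia.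
- move=> p r3 a3 t3 hp [Fv3 Fa3] r3p e3; wp_step; split; last by lia.
  move=> q hq; rewrite /upd r3p addn1 eqSS; case: eqP => // ne.
  by apply: e3; lia.
move=> r3 a3 t3 [Fv3 Fa3] _ e3 ht3; simp_in Fv3; simp_in Fa3.
have r3n : r3 vn = n by rewrite Fv3.
have r3l : r3 vl = l by rewrite Fv3.
have a3R : a3 RK = a RK by rewrite Fa3.
have a3T : a3 TMP = tmp by rewrite Fa3.
have rkE i : i < n -> a RK i = (below n (key l) i).+1 by move=> hi; rewrite rk /krank hi.
have tmp_lt q := mkseq_perm_lt (p := q) pmT.
(* In the invariant, [CNT] at the rank of i is the next free cell of the bucket of i. *)
wp_step; apply: (@wp_forc _ _ 5 (fun p r' a' =>
  (forall q, q < p -> a' ORD (place n (key l) tmp q) = tmp q) /\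
  (forall i, i < n -> a' CNT (a RK i) =
     below n (key l) i + count (fun j => key l j == key l i) (mkseq tmp p)))) => //;
  simp; rewrite ?r3n; try lia.
- split; first by move=> q; lia.
  by move=> i hi; rewrite rkE //= addn0 e3 //; apply: below_lt.
- move=> p r4 a4 t4 hp [Fv4 Fa4] r4p [e4 e5]; simp_in Fv4; simp_in Fa4.
  have a4T : a4 TMP = tmp by rewrite Fa4.
  have a4R : a4 RK = a RK by rewrite Fa4.
  have pn : p < n by lia.
  have ti := tmp_lt p pn.
  have pl := place_lt (key l) pmT pn.
  have ec : a4 CNT (a RK (tmp p)) = place n (key l) tmp p by rewrite e5.
  have rkb : a RK (tmp p) <= n by rewrite rkE //; apply: below_lt.
  do 2!wp_step; rewrite r4p a4T.
  do 2!wp_step; rewrite a4R.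
  do 2!wp_step; rewrite ec.
  do 2!wp_step.
  wp_step; split; last by lia.
  split.
    move=> q hq; rewrite /upd; case: eqP => [/(place_inj pmT)|ne].
      by move=> ->; [|lia|].
    by apply: e4; case: (ltngtP q p) => // [|E]; [lia | case: ne; rewrite E].
  move=> i hi; rewrite /upd mkseqS -cats1 count_cat /= addn0.
  have -> : (a RK i == a RK (tmp p)) = (key l (tmp p) == key l i).
    by rewrite !rk (krank_eq X_lt X_in X_out) // eq_sym.
  case: eqP => [E|ne]; last by rewrite addn0 e5.
  by rewrite /place addnA E (below_congr _ E).
move=> r4 a4 t4 [Fv4 Fa4] _ [e4 _] ht4; simp_in Fv4; simp_in Fa4.
have r4n : r4 vn = n by rewrite Fv4.
have r4l : r4 vl = l by rewrite Fv4.
have a4R : a4 RK = a RK by rewrite Fa4.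
have [pm4 srt4] := placed_sorted pmT srtT e4.
have {}srt4 : pairwise (fun i j => key (l + l) i <= key (l + l) j) (mkseq (a4 ORD) n).
  apply: sub_pairwise srt4 => i j h /=; rewrite leqNgt (ltn_keyD X_lt); move: h.
  by case: (ltngtP (key l i) (key l j)) => //= _; rewrite -leqNgt.
wp_step; apply: (wp_conseq (rank_passP t4 (f := key (l + l)) r4n _ pm4 srt4 _)).
- by rewrite r4l ltnW.
- move=> i j _ _; rewrite a4R r4l !rk !(krank_eq X_lt X_in X_out) //.
  exact: eqn_keyD.
move=> r5 a5 t5 [Fv5 Fa5] [e5 e6 ht5]; simp_in Fv5; simp_in Fa5.
have r5l : r5 vl = l by rewrite Fv5.
have a5O : a5 ORD = a4 ORD by rewrite Fa5.
wp_step; rewrite r5l; split=> //; last by lia.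
rewrite /sorted_upto a5O; split=> // i; rewrite /krank; case: ltnP => hi; first exact: e5.
by rewrite e6 // a4R rk /krank ltnNge hi.
Qed.

Lemma suffix_sortP r a t :
  0 < n -> r vn = n -> r vw = w ->
  (forall i, i < n -> a IN (i + 4) = X i) ->
  (forall i, n <= i -> a RK i = 0) -> (forall i, n <= i -> a XP i = 0) ->
  wp w B suffix_sort (fun r' a' t' =>
    [/\ (exists2 L, n <= L & sorted_upto L a'), (forall i, a' XP i = X i) &
        t' <= t + 20 * (w + 1) * (n + 1) + (trunc_log 2 n + 3) * (40 * n + 40)]) r a t.
Proof.
move=> n0 rn rw hin hrk hxp; have W1 : 8 < W by lia.
do 2!wp_step; apply: (@wp_forc _ _ 4 (fun i r' a' => a' IN = a IN /\
  (forall q, q < i -> [/\ a' KEY q = X q, a' RK q = X q & a' XP q = X q]) /\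
  (forall q, n <= q -> a' RK q = 0 /\ a' XP q = 0))) => //; simp; rewrite ?rn; try lia.
- by split=> //; split=> // q h; rewrite hrk ?hxp.
- move=> i r1 a1 t1 hi [Fv1 Fa1] r1i [e0 [e1 e2]].
  do 7!wp_step; split; last by lia.
  rewrite r1i e0 hin; last by lia.
  split=> //; split=> q hq; last by rewrite /upd gtn_eqF; [apply: e2 | lia].
  by rewrite /upd; case: eqP => [->//|ne]; apply: e1; lia.
move=> r1 a1 t1 [Fv1 Fa1] _ [_ [e1 e2]] ht1; simp_in Fv1; simp_in Fa1.
have r1n : r1 vn = n by rewrite Fv1.
have r1w : r1 vw = w by rewrite Fv1.
have a1R i : a1 RK i = X i.
  by case: (ltnP i n) => hi; [case: (e1 i hi) | rewrite X_out // (e2 i hi).1].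
have a1X i : a1 XP i = X i.
  by case: (ltnP i n) => hi; [case: (e1 i hi) | rewrite X_out // (e2 i hi).2].
have a1K i : i < n -> a1 KEY i = X i by case/e1.
wp_step; wp_step; wp_step.
apply: (wp_conseq (radix_sortP BW _ t1.+1 (m := n) _ _ wW _ _)) => //; simp; try lia.
  by move=> i hi; rewrite a1K.
move=> r2 a2 t2 [Fv2 Fa2] [pm2 srt2 ht2]; simp_in Fv2; simp_in Fa2.
have r2n : r2 vn = n by rewrite Fv2.
have a2R : a2 RK = a1 RK by rewrite Fa2.
have a2X : a2 XP = a1 XP by rewrite Fa2.
do 3!wp_step.
have {}srt2 : pairwise (fun i j => key 1 i <= key 1 j) (mkseq (a2 ORD) n).
  apply: (@sub_in_pairwise _ (fun i => i < n)) srt2; last first.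
    by rewrite (perm_all _ pm2); apply/allP => i; rewrite mem_iota.
  by move=> i j hi hj; rewrite /klt !key1 !a1K // => /orP[/ltnW//|/andP[/eqP-> _]].
apply: (wp_conseq (rank_passP (r := set r2 vl 0) t2.+1 (f := key 1) _ _ pm2 srt2 _)) => //; simp.
  by move=> i j _ _; rewrite !addn0 a2R !a1R andbb !key1.
move=> r3 a3 t3 [Fv3 Fa3] [e3 e4 ht3]; simp_in Fv3; simp_in Fa3.
have r3n : r3 vn = n by rewrite Fv3.
have a3O : a3 ORD = a2 ORD by rewrite Fa3.
have a3X : a3 XP = a1 XP by rewrite Fa3.
do 2!wp_step.
pose lgn := trunc_log 2 n.
(* After e rounds the sorted length is 2^e, and a further round requires 2^e < n; so there are at
   most [lgn] + 1 rounds. *)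
apply: (@wp_while _ _ (fun m r' a' t' => exists e, [/\ m + e = lgn.+2,
   r' vl = 2 ^ e, sorted_upto (2 ^ e) a' & t' <= t3.+1 + e * (36 * n + 21)]) lgn.+2); simp.
  exists 0; split=> //; [by rewrite addn0 | | by lia].
  rewrite /sorted_upto a3O; split=> // i; rewrite /krank; case: ltnP => hi; first exact: e3.
  by rewrite e4 // a2R a1R X_out.
move=> m r4 a4 t4 [Fv4 Fa4] [e [me r4l srt4 ht4]]; simp_in Fv4; simp_in Fa4.
have r4n : r4 vn = n by rewrite Fv4.
have a4X : a4 XP = a1 XP by rewrite Fa4.
split=> //; rewrite r4n r4l; case: ltnP => hl; last first.
  split; [by exists (2 ^ e) | by move=> i; rewrite a4X a1X |].
  have em : e <= lgn.+2 by lia.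
  have : e * (36 * n + 21) <= lgn.+2 * (36 * n + 21) by rewrite leq_mul2r em orbT.
  rewrite -/lgn; move: ht1 ht2 ht3 ht4; clear; nia.
rewrite -r4l in hl srt4; have l0 : 0 < r4 vl by rewrite r4l expn_gt0.
have eL : e <= lgn by apply: trunc_log_max; rewrite // -r4l ltnW.
apply: (wp_conseq (double_stepP t4.+1 r4n l0 hl srt4)) => r5 a5 t5 _ [r5l srt5 ht5].
exists (m.-1); first by lia.
have e2l : r4 vl + r4 vl = 2 ^ e.+1 by rewrite r4l addnn -mul2n expnS.
rewrite e2l in r5l srt5.
by exists e.+1; split=> //; [lia | rewrite mulSn; lia].
Qed.

End SuffixSort.

(** * Common prefixes and events of the sweep *)

Definition kasai :=
  vh <-- N 0 ;;
  For vi (N 0) vn (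
    vp <-- Get RK (V vi) -! N 1 ;;
    If (Eq (V vp) (N 0)) (Put KEY (N 0) (N 1)) (
      vj <-- Get ORD (V vp -! N 1) ;;
      While (Eq (Get XP (V vi +! V vh)) (Get XP (V vj +! V vh)))
        (vh <-- V vh +! N 1) ;;
      Put KEY (V vp) (V vh +! N 1) ;;
      If (Lt (N 0) (V vh)) (vh <-- V vh -! N 1) Skip)).

(* Event [b < n] removes boundary [b] and has key lcp + 1.  Events [n + i] and
   [2 n + i] lower the leaf of suffix [i] once the window is too short to reach the
   first, respectively second, element of the set to the right of [i]; their keys are
   the distances.  At equal keys the larger event comes first in the sweep, so
   leaves are up to date when a boundary is removed. *)
Definition make_events :=
  For vj (N 0) vgs
    (vc <-- Get IN (V vn +! V vj +! N 4) ;; Put GF (V vc) (N 1)) ;;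
  vc1 <-- V vn +! V vn +! N 1 ;;
  vc2 <-- V vc1 ;;
  For vt (N 0) vn (
    vi <-- V vn -! V vt -! N 1 ;;
    If (Eq (Get GF (V vi +! N 1)) (N 1))
      (vc2 <-- V vc1 ;; vc1 <-- V vi +! N 1) Skip ;;
    Put NX (V vi) (V vc1) ;;
    Put KEY (V vn +! V vi) (V vc1 -! V vi -! N 1) ;;
    Put KEY (V vn +! V vn +! V vi) (V vc2 -! V vi -! N 1)) ;;
  For vp (N 0) vn (Put SA (V vp) (Get ORD (V vp))) ;;
  vN <-- V vn +! V vn +! V vn ;;
  radix_sort.

Section Scan.
Variables (n : nat) (G : pred nat).
Hypothesis G_in : forall p, G p -> 0 < p <= n.

(** Models [vc1] and [vc2] after t steps of the right-to-left loop of [make_events]: the next two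
    elements beyond position n - t, or the sentinel. *)
Fixpoint scan (t : nat) : nat * nat :=
  if t is t'.+1 then
    let: (c1, c2) := scan t' in if G (n - t') then (n - t', c1) else (c1, c2)
  else (n.*2.+1, n.*2.+1).

Definition next1 (i : nat) : nat := (scan (n - i)).1.
Definition next2 (i : nat) : nat := (scan (n - i)).2.

Lemma scanP t : t <= n -> let: (c1, c2) := scan t in
  [/\ G c1 \/ c1 = n.*2.+1, n - t < c1, forall p, G p -> n - t < p -> c1 <= p &
  [/\ G c2 \/ c2 = n.*2.+1, c1 < c2 \/ c2 = n.*2.+1 &
      forall p, G p -> c1 < p -> c2 <= p]].
Proof.
elim: t => [|t IH] tn /=.
  split; [by right | by lia | by move=> p /G_in; lia |].
  by split; [by right | by right | by move=> p /G_in; lia].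
case: (scan t) (IH (ltnW tn)) => c1 c2 [h1 h2 h3 [h4 h5 h6]].
case: ifP => Gt; last first.
  split=> //; first by lia.
  move=> p Gp hp; apply: h3 => //; case: (eqVneq p (n - t)) => e; last by lia.
  by rewrite -e Gp in Gt.
split; [by left | by lia | by move=> p Gp; lia |].
split=> //; first by left.
Qed.

Lemma scan_le t : (scan t).1 <= n.*2.+1 /\ (scan t).2 <= n.*2.+1.
Proof.
elim: t => [|t] //=; case: (scan t) => c1 c2 /= [h1 h2]; case: ifP => _ /=; split=> //; lia.
Qed.

Lemma next_spec i : i < n ->
  [/\ G (next1 i) \/ next1 i = n.*2.+1, i < next1 i,
      forall p, G p -> i < p -> next1 i <= p &
  [/\ G (next2 i) \/ next2 i = n.*2.+1, next1 i < next2 i \/ next2 i = n.*2.+1 &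
      forall p, G p -> next1 i < p -> next2 i <= p]].
Proof.
move=> hi; have := @scanP (n - i) ltac:(lia); rewrite /next1 /next2.
by case: (scan _) => c1 c2 /=; rewrite subKn // ltnW.
Qed.

End Scan.

Section LcpEvents.
Variables (w B n : nat) (X : nat -> nat).
Local Notation W := (2 ^ w).
Hypothesis n_gt0 : 0 < n.
Hypothesis X_lt : forall i, X i < W.
Hypothesis X_in : forall i, i < n -> 0 < X i.
Hypothesis X_out : forall i, n <= i -> X i = 0.
Local Notation key := (key W X).

Section Kasai.
Variables (L : nat) (sa rk : nat -> nat).
Hypothesis leL : n <= L.
Hypothesis pm : perm_eq (mkseq sa n) (iota 0 n).
Hypothesis srt : pairwise (fun i j => key L i <= key L j) (mkseq sa n).
Hypothesis rkE : forall i, rk i = krank W n X L i.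
Let pos i := rk i - 1.

(** Strictness comes from L >= n: two suffixes with equal keys would make L letters fit from the
    later start, which is positive. *)
Lemma sorted_sa_mono p q : p < q -> q < n -> key L (sa p) < key L (sa q).
Proof.
move=> pq qn; have pn := ltn_trans pq qn.
rewrite ltn_neqAle; move/pairwise_mkseq: srt => -> //; rewrite andbT.
apply/eqP => e.
have h1 := mkseq_perm_lt pm pn; have h2 := mkseq_perm_lt pm qn.
have ne : sa p <> sa q by move=> /(mkseq_perm_inj pm pn qn); lia.
case: (ltngtP (sa p) (sa q)) ne => // lt _.
  by have := key_eq_ltn X_lt X_in X_out e lt h2; lia.
by have := key_eq_ltn X_lt X_in X_out (esym e) lt h1; lia.
Qed.

Lemma sorted_rank p : p < n -> rk (sa p) = p.+1.
Proof.
move=> pn; rewrite rkE /krank (mkseq_perm_lt pm pn); congr S.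
apply: (below_sorted pm srt pn).
by case: (posnP p) => [|p0]; [left | right; apply: sorted_sa_mono; lia].
Qed.

Lemma sorted_posK i : i < n -> sa (pos i) = i.
Proof.
by move=> /(mkseq_perm_onto pm)[p pn <-]; rewrite /pos sorted_rank // subn1.
Qed.

Lemma sorted_pos_lt i : i < n -> pos i < n.
Proof.
by move=> /(mkseq_perm_onto pm)[p pn <-]; rewrite /pos sorted_rank // subn1.
Qed.

Lemma sorted_rk_gt0 i : i < n -> 0 < rk i.
Proof. by move=> hi; rewrite rkE /krank hi. Qed.

(** The stored value is the common prefix plus one, the length at which the boundary is tested and
    therefore already its event key. Boundary 0 is given common prefix 0. *)
Definition lcp_entry (f : nat -> nat) (p : nat) : Prop :=
  if p == 0 then f p = 1 else
  [/\ 0 < f p, key (f p).-1 (sa p.-1) = key (f p).-1 (sa p) &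
      X (sa p.-1 + (f p).-1) <> X (sa p + (f p).-1)].

Hypothesis BW : 16 * B < W.
Hypothesis nB : 4 * n + 8 <= B.

(** The clock is bounded by 11 i + 2 h up to a constant: a round of the inner loop costs 2 and
    raises h by one, and h never exceeds n. By [pred_shift], h drops by at most one from a suffix to
    the next. *)
Lemma kasaiP r a t :
  r vn = n -> a ORD = sa -> a RK = rk -> (forall i, a XP i = X i) ->
  wp w B kasai (fun r' a' t' => (forall p, p < n -> lcp_entry (a' KEY) p) /\
    t' <= t + 14 * n + 4) r a t.
Proof.
move=> rn aO aR aX; have W1 : 8 < W by lia.
have sa_lt p := mkseq_perm_lt (p := p) pm.
do 3!wp_step.
apply: (@wp_for _ _ (fun i r' a' t' => [/\
  forall q, q < i -> lcp_entry (a' KEY) (pos q),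
  i < n -> r' vh = 0 \/ (0 < pos i /\ key (r' vh) (sa (pos i).-1) = key (r' vh) i),
  r' vh <= n & t' <= t + 2 + 11 * i + 2 * r' vh])) => //; simp; rewrite ?rn; try lia.
- by split=> //; [left | lia].
- move=> i r1 a1 t1 /= hi [Fv Fa] r1i [e1 e2 e3 ht1]; simp_in Fv; simp_in Fa.
  have r1n : r1 vn = n by rewrite Fv.
  have a1O : a1 ORD = sa by rewrite Fa.
  have a1R : a1 RK = rk by rewrite Fa.
  have a1X q : a1 XP q = X q by rewrite Fa.
  have pn := sorted_pos_lt hi.
  have rk0 := sorted_rk_gt0 hi.
  have pos_inj q : q < i -> pos q <> pos i.
    by move=> qi /(congr1 sa); rewrite !sorted_posK //; lia.
  have pos_cons f v : lcp_entry (upd f (pos i) v) (pos i) ->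
      (forall q, q < i -> lcp_entry f (pos q)) ->
      forall q, q < i.+1 -> lcp_entry (upd f (pos i) v) (pos q).
    move=> h1 h2 q hq; case: (ltngtP q i) => [lt|gt|->//]; last by lia.
    have := h2 q lt; rewrite /lcp_entry /upd.
    by have /eqP/negbTE-> := pos_inj q lt.
  do 2!wp_step; first by rewrite a1R r1i.
  rewrite r1i a1R -/(pos i).
  wp_step => /eqP p0.
    wp_step; split.
    + by rewrite -[X in upd _ X]p0; apply: pos_cons => //; rewrite /lcp_entry p0 /upd.
    (* The program does not reset h here: the invariant allows a positive h only if suffix i has a
       predecessor, so h is already 0. *)
    + move=> i1; left; case: (e2 hi) => //.
      by case=> h; rewrite p0 in h.
    + by [].
    + by lia.
  have p1 : 0 < pos i by lia.
  have hj : sa (pos i).-1 < n by apply: sa_lt; lia.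
  do 2!wp_step; rewrite a1O subn1; set j := sa (pos i).-1 in hj *.
  have ij : i <> j.
    move=> E; have : sa (pos i) = sa (pos i).-1 by rewrite sorted_posK.
    by move=> /(mkseq_perm_inj pm pn); lia.
  have h_lt h : key h j = key h i -> h < n.
    move=> e; case: (ltngtP i j) ij => // lt _.
      by have := key_eq_ltn X_lt X_in X_out (esym e) lt hj; lia.
    by have := key_eq_ltn X_lt X_in X_out e lt hi; lia.
  have eh : key (r1 vh) j = key (r1 vh) i by case: (e2 hi) => [->|[]].
  wp_step; apply: (@wp_while _ _ (fun m r' a' t' => [/\ m = n - r' vh,
     key (r' vh) j = key (r' vh) i & t' <= t1 + 4 + 2 * (r' vh - r1 vh) /\ r1 vh <= r' vh])
     (n - r1 vh)); simp.
    by split=> //; lia.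
  move=> m r2 a2 t2 [Fv2 Fa2] [em e4 [ht2 le2]]; simp_in Fv2; simp_in Fa2.
  have r2i : r2 vi = i by rewrite Fv2.
  have r2j : r2 vj = j by rewrite Fv2.
  have r2p : r2 vp = pos i by rewrite Fv2.
  have a2X q : a2 XP q = X q by rewrite Fa2.
  have a2K : a2 KEY = a1 KEY by rewrite Fa2.
  have hn := h_lt _ e4.
  split; first by rewrite r2i r2j; do ?split; lia.
  rewrite r2i r2j !a2X; case: eqP => Xe.
    wp_step; exists (n - (r2 vh).+1); first by lia.
    rewrite addn1; split=> //; last by lia.
    by apply/eqP; rewrite (keyS_eq X_lt) e4 Xe !eqxx.
  have entry : lcp_entry (upd (a1 KEY) (pos i) (r2 vh).+1) (pos i).
    rewrite /lcp_entry (negbTE (lt0n_neq0 p1)) /upd eqxx /= sorted_posK // -/j.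
    by split=> // E; apply: Xe.
  do 2!wp_step; rewrite r2p a2K addn1.
  wp_step => h0; wp_step; split; try lia; try exact: pos_cons.
    move=> i1; case: (leqP (r2 vh) 1) => h1; first by left; lia.
    right; rewrite subn1.
    exact: (pred_shift X_lt X_in X_out leL sa_lt sorted_sa_mono sorted_pos_lt sorted_posK).
- move=> r1 a1 t1 _ _ [e1 _ e3 ht1]; split; last by lia.
  move=> p pn; have := e1 (sa p) (sa_lt p pn).
  by rewrite /pos sorted_rank // subn1.
Qed.

End Kasai.

Hypothesis BW : 16 * B < W.
Hypothesis wW : w < W.
Hypothesis nB : 4 * n + 8 <= B.

Lemma make_eventsP (G : pred nat) (g : seq nat) r a t :
  r vn = n -> r vw = w -> r vgs = size g -> size g <= n ->
  (forall p, G p -> 0 < p <= n) -> g =i G ->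
  (forall j, j < size g -> a IN (n + j + 4) = nth 0 g j) ->
  (forall i, a GF i = 0) ->
  (forall i, i < n -> a KEY i < W) ->
  wp w B make_events (fun r' a' t' =>
    [/\ [/\ r' vN = 3 * n, forall i, i < n -> a' KEY i = a KEY i,
          forall i, i < n -> a' KEY (n + i) = next1 n G i - i.+1,
          forall i, i < n -> a' KEY (n + n + i) = next2 n G i - i.+1 &
          forall i, i < n -> a' NX i = next1 n G i],
        forall i, i < n -> a' SA i = a ORD i,
        perm_eq (mkseq (a' ORD) (3 * n)) (iota 0 (3 * n)),
        pairwise (klt (a' KEY)) (mkseq (a' ORD) (3 * n)) &
        t' <= t + 20 * (w + 1) * (3 * n + 1) + 18 * n + 20]) r a t.
Proof.
move=> rn rw rg gn G_in gG hin hGF hK; have W1 : 8 < W by lia.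
do 2!wp_step; apply: (@wp_forc _ _ 2 (fun j r' a' => a' IN = a IN /\
  forall p, a' GF p = (p \in take j g))) => //; simp; rewrite ?rn ?rg; try lia.
- by split=> // p; rewrite take0 hGF.
- move=> j r1 a1 t1 hj [Fv Fa] r1j [e0 e1]; simp_in Fv.
  have r1n : r1 vn = n by rewrite Fv.
  have jg : j < size g by lia.
  have gj : a1 IN (r1 vn + r1 vj + 4) = nth 0 g j by rewrite e0 r1n r1j hin.
  have : nth 0 g j \in g by apply: mem_nth.
  rewrite gG => /G_in hp.
  do 2!wp_step; rewrite gj.
  wp_step; split; last by lia.
  split=> // p; rewrite (take_nth 0 jg) mem_rcons inE /upd.
  by case: eqP => //= _; apply: e1.
move=> r1 a1 t1 [Fv1 Fa1] _ [_ e1] ht1; simp_in Fv1; simp_in Fa1.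
rewrite take_size in e1.
have r1n : r1 vn = n by rewrite Fv1.
have a1K : a1 KEY = a KEY by rewrite Fa1.
have a1O : a1 ORD = a ORD by rewrite Fa1.
do 5!wp_step; rewrite r1n.
apply: (@wp_forc _ _ 8 (fun u r' a' => [/\ a' GF = a1 GF,
  (r' vc1, r' vc2) = scan n G u,
  forall i, i < n -> a' KEY i = a KEY i &
  forall i, n - u <= i < n -> [/\ a' KEY (n + i) = next1 n G i - i.+1,
     a' KEY (n + n + i) = next2 n G i - i.+1 & a' NX i = next1 n G i]])) => //;
  simp; rewrite ?r1n; try lia.
- split=> //; [by congr pair; lia | by move=> i _; rewrite a1K | by move=> i; lia].
- move=> u r2 a2 t2 hu [Fv2 Fa2] r2t [e2 e3 e4 e5]; simp_in Fv2; simp_in Fa2.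
  have r2n : r2 vn = n by rewrite Fv2.
  have Gi : (a1 GF (n - u) == 1) = G (n - u).
    by rewrite e1 gG unfold_in; case: (G _).
  have ui : n - u - 1 + 1 = n - u by lia.
  have nu : n - (n - u - 1) = u.+1 by lia.
  have [c1b c2b] := scan_le n G u.
  have hs := @scanP n G G_in u ltac:(lia); rewrite -e3 /= in hs c1b c2b.
  case: hs => _ c1gt _ [_ c2gt _].
  have fin r3 t3 : r3 vn = n -> r3 vi = n - u - 1 -> t3 <= t2 + 5 ->
    (r3 vc1, r3 vc2) = scan n G u.+1 ->
    wp w B (Put NX (V vi) (V vc1) ;; Put KEY (V vn +! V vi) (V vc1 -! V vi -! N 1) ;;
      Put KEY (V vn +! V vn +! V vi) (V vc2 -! V vi -! N 1))
      (fun r'' a'' t'' => [/\ a'' GF = a1 GF, (r'' vc1, r'' vc2) = scan n G u.+1,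
       forall i, i < n -> a'' KEY i = a KEY i &
       forall i, n - u.+1 <= i < n -> [/\ a'' KEY (n + i) = next1 n G i - i.+1,
          a'' KEY (n + n + i) = next2 n G i - i.+1 & a'' NX i = next1 n G i]] /\
       t'' <= t2 + 8) r3 a2 t3.
    move=> h1 h2 h3 h4.
    have [c1b' c2b'] := scan_le n G u.+1.
    have hs := @scanP n G G_in u.+1 ltac:(lia); rewrite -h4 /= in hs c1b' c2b'.
    case: hs => _ c1gt' _ [_ c2gt' _].
    do 5!wp_step; rewrite h1 h2; split; last by lia.
    split=> //.
    + move=> i hi; rewrite /upd !ltn_eqF; [exact: e4 | lia | lia].
    + move=> i hi; rewrite /upd !eqn_add2l.
      have -> : (n + i == n + n + (n - u - 1)) = false by lia.
      have -> : (n + n + i == n + (n - u - 1)) = false by lia.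
      case: eqP => [->|ne]; last by apply: e5; lia.
      by rewrite /next1 /next2 nu -h4 /=; split; lia.
  do 2!wp_step; rewrite r2n r2t.
  wp_step; wp_step; rewrite ui e2 Gi => Gu.
    do 3!wp_step; apply: fin => //; simp; first by lia.
    by rewrite /= -e3 Gu; congr pair; lia.
  wp_step; apply: fin => //; simp; first by lia.
  by rewrite /= -e3 (negbTE Gu).
move=> r2 a2 t2 [Fv2 Fa2] _ [_ _ e4 e5] ht2; simp_in Fv2; simp_in Fa2.
rewrite subnn in e5.
have r2n : r2 vn = n by rewrite Fv2.
have r2w : r2 vw = w by rewrite Fv2 //= Fv1.
have a2O : a2 ORD = a ORD by rewrite Fa2.
wp_step; apply: (@wp_forc _ _ 1 (fun i r' a' => a' ORD = a ORD /\
  forall q, q < i -> a' SA q = a ORD q)) => //; simp; rewrite ?r2n; try lia.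
- move=> i r3 a3 t3 hi [Fv3 Fa3] r3i [e6 e7]; wp_step; split; last by lia.
  split=> // q hq; rewrite /upd r3i e6; case: eqP => [->//|ne]; apply: e7; lia.
move=> r3 a3 t3 [Fv3 Fa3] _ [_ e6] ht3; simp_in Fv3; simp_in Fa3.
have r3n : r3 vn = n by rewrite Fv3.
have r3w : r3 vw = w by rewrite Fv3.
have a3K : a3 KEY = a2 KEY by rewrite Fa3.
have a3N : a3 NX = a2 NX by rewrite Fa3.
do 2!wp_step; rewrite r3n.
have kW i : i < 3 * n -> a3 KEY i < W.
  move=> hi; rewrite a3K; case: (ltnP i n) => h1; first by rewrite e4 //; apply: hK.
  case: (ltnP i (n + n)) => h2.
    have [|h _ _] := e5 (i - n); try lia.
    have := (scan_le n G (n - (i - n))).1; rewrite -/(next1 n G (i - n)).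
    by move: h; rewrite subnKC // => ->; lia.
  have [|_ h _] := e5 (i - (n + n)); try lia.
  have := (scan_le n G (n - (i - (n + n)))).2; rewrite -/(next2 n G (i - (n + n))).
  by move: h; rewrite subnKC // => ->; lia.
apply: (wp_conseq (radix_sortP BW _ _ (m := 3 * n) _ _ wW _ _)) => //; simp; try lia.
move=> r4 a4 t4 [Fv4 Fa4] [pm4 srt4 ht4]; simp_in Fv4; simp_in Fa4.
have a4K : a4 KEY = a2 KEY by rewrite Fa4.
have a4N : a4 NX = a2 NX by rewrite Fa4.
have a4S : a4 SA = a3 SA by rewrite Fa4.
split; rewrite ?a4K ?a4S //; last 2 first.
- by rewrite -a3K.
- by move: gn ht1 ht2 ht3 ht4; clear; lia.
rewrite a4N; split=> //; first by rewrite Fv4 //=; lia.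
- by move=> i hi; have [] := e5 i hi.
- by move=> i hi; have [] := e5 i hi.
- by move=> i hi; have [] := e5 i hi.
Qed.

End LcpEvents.

(** * Segment tree *)

Definition join_cmd (u v : nat) :=
  If (Eq (V u) (N 0)) (u <-- V v)
    (If (Eq (V v) (N 0)) Skip (If (Eq (V u) (V v)) Skip (u <-- N 1))).

Definition tree_update :=
  vL <-- V vn +! V vp ;;
  Put TR (V vL) (V vv) ;;
  While (Lt (N 1) (V vL)) (
    vL <-- Op HDiv (V vL) (N 2) ;;
    vres <-- Get TR (V vL +! V vL) ;;
    vu <-- Get TR (V vL +! V vL +! N 1) ;;
    join_cmd vres vu ;;
    Put TR (V vL) (V vres)).

Definition tree_query :=
  vres <-- N 0 ;;
  vL <-- V vn +! V vql ;;
  vR <-- V vn +! V vqr ;;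
  While (Lt (V vL) (V vR)) (
    If (Eq (Op HBit (V vL) (N 0)) (N 1))
      (vu <-- Get TR (V vL) ;; join_cmd vres vu ;; vL <-- V vL +! N 1) Skip ;;
    If (Eq (Op HBit (V vR) (N 0)) (N 1))
      (vR <-- V vR -! N 1 ;; vu <-- Get TR (V vR) ;; join_cmd vres vu) Skip ;;
    vL <-- Op HDiv (V vL) (N 2) ;;
    vR <-- Op HDiv (V vR) (N 2)) ;;
  If (Eq (V vres) (N 0)) (vbad <-- N 1) (Put MK (V vres -! N 1) (N 1)).

Definition guarded_query :=
  If (Lt (V vql) (V vqr))
    (If (Lt (V vk) (V va)) Skip
      (If (Eq (V vqr) (V vql +! N 1))
        (If (Lt (V vn) (Get SA (V vql) +! V va)) Skip tree_query)
        tree_query))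
    Skip.

(** Leaves occupy cells n to 2 n - 1, and node u has children 2 u and 2 u + 1. *)
Definition tree_ok (n : nat) (T : nat -> nat) : Prop :=
  forall u, 0 < u < n -> T u = join (T u.*2) (T u.*2.+1).

(** The step of a bottom-up query: a range with even ends moves up one level. Nothing is assumed
    about the shape of the tree, so n need not be a power of two. *)
Lemma tree_half n T l r : tree_ok n T -> 0 < l -> l <= r <= n ->
  \big[join/0]_(l.*2 <= u < r.*2) T u = \big[join/0]_(l <= u < r) T u.
Proof.
move=> ok l0; elim: r => [|r IH] hr; first by rewrite !big_geq //; lia.
case: (ltngtP l r.+1) hr => [lt|gt|->] hr; [|lia|by rewrite !big_geq].
rewrite doubleS [RHS]big_nat_recr //= big_nat_recr /=; last by lia.
rewrite big_nat_recr /=; last by lia.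
by rewrite -joinA IH; [rewrite -ok //; lia | lia].
Qed.

Lemma join_bound M (f : nat -> nat) l r : 0 < M ->
  (forall p, l <= p < r -> f p <= M) -> \big[join/0]_(l <= p < r) f p <= M.
Proof.
move=> M0 h; rewrite big_nat_cond; elim/big_ind: _ => //.
  by move=> a b; rewrite /join; split_eqs; lia.
by move=> p /andP[/h].
Qed.

Section Tree.
Variables (w B n : nat).
Local Notation W := (2 ^ w).
Hypothesis BW : 16 * B < W.
Hypothesis nB : 4 * n + 8 <= B.

Lemma join_cmdP u v (Q : regfile -> arrays -> nat -> Prop) r a t :
  (forall r' t', (forall x, Nat.eqb x u = false -> r' x = r x) ->
     r' u = join (r u) (r v) -> t' <= t + 4 -> Q r' a t') ->
  wp w B (join_cmd u v) Q r a t.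
Proof.
move=> h; rewrite /join_cmd.
have W1 : 8 < W by lia.
apply: wp_if => [|/= /eqP u0|/= /negbTE u0]; first by wp_side.
  apply: wp_asg => //; apply: h => //; last by lia.
    by move=> x hx; rewrite /set hx.
  by rewrite setE eqxx /= u0 /join.
apply: wp_if => [|/= /eqP v0|/= /negbTE v0]; first by wp_side.
  apply: wp_skip; apply: h => //; last by lia.
  by rewrite /join u0 v0.
apply: wp_if => [//|/= uv|/= /negbTE uv].
  apply: wp_skip; apply: h => //; last by lia.
  by rewrite /join u0 v0 uv.
apply: wp_asg => //=; first by lia.
apply: h => //; last by lia.
  by move=> x hx; rewrite /set hx.
by rewrite setE eqxx /join u0 v0 uv.
Qed.

Lemma half_lt m x : x < 2 ^ m.+1 -> x %/ 2 < 2 ^ m.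
Proof. by rewrite expnS ltn_divLR // mulnC. Qed.

Lemma double_lt_exp : n + n < 2 ^ (trunc_log 2 n).+2.
Proof. by rewrite addnn -mul2n [X in _ < X]expnS ltn_mul2l /= trunc_log_ltn. Qed.

Lemma tree_updateP p r a t :
  r vn = n -> r vp = p -> p < n -> tree_ok n (a TR) ->
  wp w B tree_update (fun r' a' t' => [/\ tree_ok n (a' TR),
    forall q, q < n -> a' TR (n + q) = if q == p then r vv else a TR (n + q) &
    t' <= t + 9 * (trunc_log 2 n + 4)]) r a t.
Proof.
move=> rn rp pn ok; have W1 : 8 < W by lia.
do 5!wp_step; rewrite rn rp.
(* Only the parent of the node just written may be inconsistent; at the root this parent is 0, which
   is no node. *)
apply: (@wp_while _ _ (fun m r' a' t' => [/\ 0 < r' vL < n + n, r' vL < 2 ^ m,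
  (forall u, 0 < u < n -> u <> r' vL %/ 2 -> a' TR u = join (a' TR u.*2) (a' TR u.*2.+1)),
  forall q, q < n -> a' TR (n + q) = if q == p then r vv else a TR (n + q) &
  t' + 9 * m <= t + 2 + 9 * (trunc_log 2 n).+2]) (trunc_log 2 n).+2); simp.
  split; [lia | | | |lia].
  - by have := double_lt_exp; lia.
  - move=> u hu ne; rewrite /upd.
    have -> : (u == n + p) = false by lia.
    have -> : (u.*2 == n + p) = false by lia.
    have -> : (u.*2.+1 == n + p) = false by lia.
    exact: ok.
  - by move=> q qn; rewrite /upd eqn_add2l.
move=> m r1 a1 t1 [Fv Fa] [hL hm e1 e2 ht]; simp_in Fv.
split; first by lia.
case: ltnP => L1; last first.
  split=> //; last by lia.
  by move=> u hu; apply: e1 => //; lia.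
case: m hm ht => [|m] hm ht; first by move: hm; rewrite expn0; lia.
set x := r1 vL %/ 2.
have hx : 0 < x < n by rewrite /x; lia.
do 6!wp_step.
rewrite -/x; wp_step; apply: join_cmdP => r2 t2 F2 e3 ht2; simp_in F2; simp_in e3.
have r2L : r2 vL = x by rewrite F2.
wp_step; exists m => //; rewrite r2L e3; split; [lia | exact: half_lt | | | lia].
- move=> u hu ne; rewrite /upd.
  have -> : (u.*2 == x) = false by lia.
  have -> : (u.*2.+1 == x) = false by lia.
  case: eqP => [->|ux]; last by apply: e1.
  by rewrite addnn addn1.
- move=> q qn; rewrite /upd; have -> : (n + q == x) = false by lia.
  exact: e2.
Qed.

(** Throughout the loop, the partial result joined with the nodes from [vL] up to [vR] gives [J],
    and each round halves [vR]. The bound on [J] keeps the marked cell [J.-1] inside the array. *)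
Lemma tree_queryP r a t :
  let J := \big[join/0]_(r vql <= p < r vqr) a TR (n + p) in
  r vn = n -> r vql <= r vqr -> r vqr <= n -> 0 < n -> tree_ok n (a TR) -> J <= n.*2.+2 ->
  wp w B tree_query (fun r' a' t' => [/\
    r' vbad = (if J == 0 then 1 else r vbad),
    a' MK = (if J == 0 then a MK else upd (a MK) J.-1 1) &
    t' <= t + 20 * (trunc_log 2 n + 4)]) r a t.
Proof.
move=> J rn hlr hr n0 ok Jle; have W1 : 8 < W by lia.
do 8!wp_step; rewrite rn.
pose S l u := \big[join/0]_(l <= p < u) a TR p.
apply: (@wp_while _ _ (fun m r' a' t' => [/\ 0 < r' vL, r' vR <= n + n, r' vR < 2 ^ m,
  join (r' vres) (S (r' vL) (r' vR)) = J &
  t' + 17 * m <= t + 3 + 17 * (trunc_log 2 n).+2]) (trunc_log 2 n).+2); simp.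
  split; [lia|lia| | |lia].
  - by have := double_lt_exp; lia.
  - rewrite join0x /S /J [n + r vql]addnC big_addn addKn.
    by apply: eq_bigr => p _; rewrite addnC.
move=> m r1 a1 t1 [Fv Fa] [L0 hR hm eJ ht]; simp_in Fv; simp_in Fa.
have r1n : r1 vn = n by rewrite Fv.
have a1T : a1 TR = a TR by rewrite Fa.
have a1M : a1 MK = a MK by rewrite Fa.
have r1b : r1 vbad = r vbad by rewrite Fv.
split=> //; case: ltnP => hLR; last first.
  have eres : r1 vres = J.
    by rewrite -eJ /S big_geq // joinC join0x.
  wp_step; rewrite eres => h.
    by wp_step; rewrite a1M h; split=> //; lia.
  wp_step; rewrite eres (negbTE h) a1M; split=> //; [by rewrite subn1 | by lia].
case: m hm ht => [|m] hm ht; first by move: hm; rewrite expn0; lia.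
have W2 : r1 vR < W by lia.
wp_step.
(* An odd left end is absorbed and the end is rounded up to an even number; below, the right end is
   rounded down. *)
have step1 : wp w B (If (Eq (Op HBit (V vL) (N 0)) (N 1))
    (vu <-- Get TR (V vL) ;; join_cmd vres vu ;; vL <-- V vL +! N 1) Skip)
  (fun r' a' t' => [/\ a' = a1, r' vR = r1 vR, r' vL = (uphalf (r1 vL)).*2,
     join (r' vres) (S (r' vL) (r1 vR)) = J & t' <= t1.+1 + 7]) r1 a1 t1.+1.
  wp_step; rewrite divn1 => ho.
    have {}ho : odd (r1 vL) by move: ho; case: odd.
    do 2!wp_step; wp_step; apply: join_cmdP => r2 t2 F2 e2 ht2; simp_in F2; simp_in e2.
    have r2L : r2 vL = r1 vL by rewrite F2.
    wp_step; rewrite r2L; split=> //.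
    + by rewrite F2.
    + by rewrite -[in LHS](odd_double_half (r1 vL)) ho uphalf_half ho; lia.
    + rewrite e2 a1T -joinA -[RHS]eJ; congr join.
      by rewrite /S [in RHS]big_ltn // addn1.
    + by lia.
  have {}ho : ~~ odd (r1 vL) by move: ho; case: odd.
  have eL : (uphalf (r1 vL)).*2 = r1 vL.
    by rewrite uphalf_half (negbTE ho) add0n even_halfK.
  by wp_step; split=> //; rewrite ?eL //; lia.
apply: (wp_conseq step1) => r2 a2 t2 _ [-> r2R r2L eJ2 ht2].
set l := uphalf (r1 vL) in r2L.
have hl : 0 < l by rewrite /l; lia.
have hlR : l.*2 <= r1 vR by rewrite /l; lia.
wp_step.
have step2 : wp w B (If (Eq (Op HBit (V vR) (N 0)) (N 1))
    (vR <-- V vR -! N 1 ;; vu <-- Get TR (V vR) ;; join_cmd vres vu) Skip)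
  (fun r' a' t' => [/\ a' = a1, r' vR = (r1 vR)./2.*2, r' vL = l.*2,
     join (r' vres) (S l.*2 (r1 vR)./2.*2) = J & t' <= t2 + 7]) r2 a1 t2.
  wp_step; rewrite r2R divn1.
    move=> ho; have {}ho : odd (r1 vR) by move: ho; case: odd.
    have eR : r1 vR = (r1 vR)./2.*2.+1.
      by rewrite -[in LHS](odd_double_half (r1 vR)) ho.
    have eR1 : r1 vR - 1 = (r1 vR)./2.*2 by lia.
    do 4!wp_step; rewrite ?r2R; try lia.
    apply: join_cmdP => r3 t3 F3 e3 ht3; simp_in F3; simp_in e3.
    split=> //.
    + by rewrite F3 //= r2R.
    + by rewrite F3.
    + rewrite e3 -[RHS]eJ2 r2L eR1 -joinA; congr join.
      rewrite /S [in RHS]eR big_nat_recr /=; last by lia.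
      by rewrite a1T joinC.
    + by lia.
  move=> ho; have {}ho : ~~ odd (r1 vR) by move: ho; case: odd.
  have eR : (r1 vR)./2.*2 = r1 vR by rewrite even_halfK.
  by wp_step; split=> //; rewrite ?eR -?r2L //; lia.
apply: (wp_conseq step2) => r3 a3 t3 _ [-> r3R r3L eJ3 ht3].
do 3!wp_step; exists m => //; rewrite r3L r3R.
have -> : l.*2 %/ 2 = l by lia.
have -> : (r1 vR)./2.*2 %/ 2 = (r1 vR)./2 by lia.
split; [lia | lia | | | lia].
- by rewrite -divn2; apply: half_lt.
- by rewrite /S -(tree_half ok hl) //; lia.
Qed.

End Tree.

(** * Doubly linked list of block boundaries *)

Section Links.
Variable n : nat.

(** Removed boundaries are left unconstrained: their stale pointers are never read again. *)
Definition links (alive : pred nat) (lf rt : nat -> nat) : Prop :=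
  [/\ lf 0 = 0,
      forall b, 0 < b <= n -> alive b -> [/\ lf b < b, alive (lf b) &
        forall b', lf b < b' < b -> ~~ alive b'] &
      forall b, b < n -> alive b -> [/\ b < rt b <= n, alive (rt b) &
        forall b', b < b' < rt b -> ~~ alive b']].

(** The case c = 0 is included: 0 stays alive and both updates write back old values, so the event
    of boundary 0 needs no branch of its own. *)
Lemma links_delete (alive alive' : pred nat) lf rt c :
  links alive lf rt -> alive 0 -> alive n -> alive c -> c < n ->
  alive' =1 (fun b => (b == 0) || (alive b && (b != c))) ->
  links alive' (upd lf (rt c) (lf c)) (upd rt (lf c) (rt c)).
Proof.
move=> [l0 lfP rtP] a0 an ac cn aE.
have [r1 r2 r3] := rtP c cn ac.
have left_c : [/\ lf c <= c, 0 < c -> lf c < c, alive (lf c) &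
    forall b', lf c < b' < c -> ~~ alive b'].
  case: (posnP c) => c0; last by have [] := @lfP c ltac:(lia) ac; split=> //; lia.
  by rewrite c0 l0; split=> //; lia.
case: left_c => l1 l1' l2 l3.
have al : alive' (lf c) by rewrite aE l2; case: (posnP c) => c0; lia.
have ar : alive' (rt c) by rewrite aE r2; lia.
have gap b' : lf c < b' < rt c -> ~~ alive' b'.
  move=> h; rewrite aE; case: (ltngtP b' c) => hb.
  - by have := l3 b'; case: (alive b'); lia.
  - by have := r3 b'; case: (alive b'); lia.
  - by rewrite hb; lia.
split.
- by rewrite /upd; case: eqP; lia.
- move=> b hb; rewrite {1}aE => ab'.
  have ab : alive b by move: ab'; case: (eqVneq b 0); lia.
  rewrite /upd; case: eqP => [e|ne].
    by split=> //; [lia | move=> b' h; apply: gap; lia].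
  have [h1 h2 h3] := lfP b hb ab.
  have nc : lf b <> c.
    move=> e; case: (ltngtP (rt c) b) => h; [|move: (r3 b)|by case: ne].
      by have := h3 (rt c); rewrite r2; lia.
    by rewrite ab; lia.
  split=> //; first by rewrite aE h2; lia.
  by move=> b' hb'; rewrite aE (negbTE (h3 b' hb')) orbF; lia.
- move=> b hb; rewrite {1}aE => ab'.
  have ab : alive b by move: ab'; case: (eqVneq b 0) => [->|]; lia.
  rewrite /upd; case: eqP => [e|ne].
    by split=> //; [lia | move=> b' h; apply: gap; lia].
  have [h1 h2 h3] := rtP b hb ab.
  have nc : rt b <> c.
    move=> e; have c0 : 0 < c by lia.
    case: (ltngtP (lf c) b) => h; [move: (l3 b)| |by case: ne].
      by rewrite ab; lia.
    by have := h3 (lf c); rewrite l2; lia.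
  split=> //; first by rewrite aE h2; lia.
  by move=> b' hb'; rewrite aE (negbTE (h3 b' hb')) orbF; lia.
Qed.

End Links.

(** * The sweep over the events *)

Definition sweep_event :=
  ve <-- Get ORD (V vN -! V vt -! N 1) ;;
  va <-- Get KEY (V ve) ;;
  If (Lt (V ve) (V vn)) (
    vlo <-- Get LF (V ve) ;; vj <-- Get RT (V ve) ;;
    vql <-- V vlo ;; vqr <-- V ve ;; guarded_query ;;
    vql <-- V ve ;; vqr <-- V vj ;; guarded_query ;;
    Put RT (V vlo) (V vj) ;; Put LF (V vj) (V vlo)) (
    vi <-- V ve -! V vn ;; vv <-- N 0 ;;
    If (Lt (V vi) (V vn)) Skip
      (vi <-- V vi -! V vn ;; vv <-- Get NX (V vi) +! N 1) ;;
    vp <-- Get RK (V vi) -! N 1 ;;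
    tree_update).

(** All nodes start at the top. Where an element is missing, the sentinel gives a leaf event of key
    2 n - i, larger than every boundary key, so such leaves are lowered before the first test. *)
Definition sweep :=
  vq <-- V vn +! V vn ;;
  For vi (N 0) vq (Put TR (V vi) (N 1)) ;;
  For vi (N 0) vn
    (Put RT (V vi) (V vi +! N 1) ;; Put LF (V vi +! N 1) (V vi)) ;;
  Put LF (N 0) (N 0) ;;
  vbad <-- N 0 ;;
  For vt (N 0) vN sweep_event.

Section Sweep.
Variables (w B n k : nat).
Local Notation W := (2 ^ w).
Hypothesis BW : 16 * B < W.
Hypothesis nB : 4 * n + 8 <= B.
Hypothesis n_gt0 : 0 < n.
Variables (sa rk lc nx1 nx2 ek ord : nat -> nat).
Let pos i := rk i - 1.
Local Notation m3 := (3 * n).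
Hypothesis sa_lt : forall p, p < n -> sa p < n.
Hypothesis rk_gt0 : forall i, i < n -> 0 < rk i.
Hypothesis pos_lt : forall i, i < n -> pos i < n.
Hypothesis posK : forall i, i < n -> sa (pos i) = i.
Hypothesis saK : forall p, p < n -> pos (sa p) = p.
Hypothesis lc0 : lc 0 = 0.
Hypothesis lc_lt : forall p, p < n -> lc p < n.
Hypothesis nx1_gt : forall i, i < n -> i < nx1 i.
Hypothesis nx_le : forall i, i < n -> nx1 i <= nx2 i <= n.*2.+1.
Hypothesis ek_border : forall b, b < n -> ek b = (lc b).+1.
Hypothesis ek_nx1 : forall i, i < n -> ek (n + i) = nx1 i - i.+1.
Hypothesis ek_nx2 : forall i, i < n -> ek (n + n + i) = nx2 i - i.+1.
Hypothesis ord_pm : perm_eq (mkseq ord m3) (iota 0 m3).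
Hypothesis ord_srt : pairwise (klt ek) (mkseq ord m3).

Variables (BadP : Prop) (MarkP : nat -> Prop).
Hypothesis sound0 : forall l r a, qualified n sa k l r a ->
  closed_block n lc l r a -> answer sa nx1 nx2 l r a = 0 -> BadP.
Hypothesis sound1 : forall l r a p, qualified n sa k l r a ->
  closed_block n lc l r a -> 0 < p -> answer sa nx1 nx2 l r a = p.+1 -> MarkP p.

(* The events handled in the first [u] steps: the order is traversed from its
   end. *)
Definition handled (u e : nat) : bool := e \in drop (m3 - u) (mkseq ord m3).

Lemma handledS u e : u < m3 ->
  handled u.+1 e = (e == ord (m3 - u - 1)) || handled u e.
Proof.
move=> hu; rewrite /handled.
have h : m3 - u.+1 < size (mkseq ord m3) by rewrite size_mkseq; lia.
rewrite (drop_nth 0 h) inE nth_mkseq; last by lia.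
have -> : (m3 - u.+1).+1 = m3 - u by lia.
by have -> : m3 - u.+1 = m3 - u - 1 by lia.
Qed.

Lemma handled_klt u e : u < m3 -> e < m3 ->
  handled u e = klt ek (ord (m3 - u - 1)) e.
Proof.
move=> hu he; have [q hq <-] := mkseq_perm_onto ord_pm he.
have srt := pairwise_mkseq _ _ _ ord_srt.
have -> : handled u (ord q) = (m3 - u <= q).
  apply/idP/idP.
    case/(nthP 0) => j; rewrite size_drop size_mkseq => hj.
    rewrite nth_drop nth_mkseq; last by lia.
    by move/(mkseq_perm_inj ord_pm); lia.
  move=> h; apply/(nthP 0); exists (q - (m3 - u)).
    by rewrite size_drop size_mkseq; lia.
  by rewrite nth_drop subnKC // nth_mkseq.
case: (ltngtP (m3 - u - 1) q) => h.
- by have := srt _ _ h hq => /= ->; lia.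
- have := srt _ _ h ltac:(lia); rewrite /klt; lia.
- by rewrite h /klt ltnn eqxx ltnn /=; lia.
Qed.

Definition alive (u b : nat) : bool := [|| b == 0, b == n | ~~ handled u b].

Definition leaves (u : nat) (T : nat -> nat) : Prop :=
  forall i, i < n -> T (n + pos i) =
    if handled u (n + i) then 0
    else if handled u (n + n + i) then (nx1 i).+1 else 1.

(** [BadP] and [MarkP p] will be the failure of coverage by the whole set and by the set without
    p. *)
Definition sound (bad : nat) (mk : nat -> nat) : Prop :=
  (bad <> 0 -> BadP) /\ (forall p, 0 < p -> mk p <> 0 -> MarkP p).

(** Promised only while the flag is 0: an empty answer raises the flag and leaves no mark, and the
    verdict is negative from then on. *)
Definition left_recorded (bad : nat) (mk : nat -> nat) (b : nat) : Prop :=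
  bad = 0 -> forall l, l < b -> (forall b', l < b' < b -> prec lc b b') ->
    prec lc l b -> qualified n sa k l b (lc b) ->
    recorded sa nx1 nx2 (fun p => mk p != 0) l b (lc b).

Definition right_recorded (bad : nat) (mk : nat -> nat) (b : nat) : Prop :=
  bad = 0 -> forall r, b < r <= n -> (forall b', b < b' < r -> prec lc b b') ->
    r = n \/ prec lc r b -> qualified n sa k b r (lc b) ->
    recorded sa nx1 nx2 (fun p => mk p != 0) b r (lc b).

Record invariant (u bad : nat) (lf rt T mk : nat -> nat) : Prop := {
  inv_links : links n (alive u) lf rt;
  inv_tree : tree_ok n T;
  inv_leaves : leaves u T;
  inv_sound : sound bad mk;
  inv_left : forall b, b < n -> handled u b -> left_recorded bad mk b;
  inv_right : forall b, b < n -> handled u b -> right_recorded bad mk b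
}.

Definition effect (q : bool) (J bad : nat) (mk : nat -> nat) (bad' : nat)
    (mk' : nat -> nat) : Prop :=
  bad' = (if q && (J == 0) then 1 else bad) /\
  mk' = (if q && (J != 0) then upd mk J.-1 1 else mk).

Definition constants (r : regfile) (a : arrays) : Prop :=
  [/\ [/\ r vn = n, r vk = k & r vN = m3],
      [/\ a KEY = ek, a ORD = ord & a RK = rk],
      forall i, i < n -> a SA i = sa i & forall i, i < n -> a NX i = nx1 i].

Lemma guarded_queryP r a t al :
  let J := \big[join/0]_(r vql <= p < r vqr) a TR (n + p) in
  constants r a -> r va = al.+1 -> al < n -> r vql <= n -> r vqr <= n ->
  tree_ok n (a TR) -> J <= n.*2.+2 ->
  wp w B guarded_query (fun r' a' t' =>
    effect (qualified n sa k (r vql) (r vqr) al) J (r vbad) (a MK) (r' vbad) (a' MK) /\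
    t' <= t + 20 * (trunc_log 2 n + 5)) r a t.
Proof.
move=> J [[rn rk_ _] _ aS _] ra aln hl hr ok Jle; have W1 : 8 < W by lia.
rewrite /qualified.
have query t1 : r vql < r vqr -> al < k -> t1 <= t + 4 ->
  ~~ ((r vqr == (r vql).+1) && (n < sa (r vql) + al + 1)) ->
  wp w B tree_query (fun r' a' t' =>
    effect [&& r vql < r vqr, al < k & ~~ ((r vqr == (r vql).+1) && (n < sa (r vql) + al + 1))]
     J (r vbad) (a MK) (r' vbad) (a' MK) /\ t' <= t + 20 * (trunc_log 2 n + 5)) r a t1.
  move=> lt ak ht short.
  apply: (wp_conseq (tree_queryP BW nB t1 rn (ltnW lt) hr n_gt0 ok Jle)).
  move=> r' a' t' _ [h1 h2 ht']; split; last by lia.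
  by rewrite /effect lt ak short /= -/J h1 h2; split=> //; case: eqP.
wp_step; wp_step => lt; last by wp_step; rewrite (negbTE lt); split=> //; lia.
wp_step; rewrite rk_ ra => ak.
  have {}ak : (al < k) = false by lia.
  by wp_step; rewrite ak andbF; split=> //; lia.
have {}ak : al < k by lia.
wp_step; rewrite addn1 => e1; last by apply: query => //; [lia | rewrite (negbTE e1)].
have sl : a SA (r vql) = sa (r vql) by apply: aS; lia.
have sn : sa (r vql) < n by apply: sa_lt; lia.
wp_step; rewrite rn sl ra => sh.
  have {}sh : n < sa (r vql) + al + 1 by lia.
  by wp_step; rewrite e1 sh !andbF; split=> //; lia.
apply: query => //; first by lia.
by rewrite e1 /=; lia.
Qed.

(** The event keys are calibrated for this: [nx1 i] lies beyond the window of length [lc c] + 1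
    exactly if its distance [nx1 i - i.+1] is at least [lc c] + 1, and likewise for [nx2]. In case
    of a tie the leaf event comes first because its index is at least n. *)
Lemma border_leaves u T c : u < m3 -> c = ord (m3 - u - 1) -> c < n ->
  leaves u T -> forall p, p < n -> T (n + p) = window nx1 nx2 (lc c) (sa p).
Proof.
move=> hu ec cn lv p pn; have hs := sa_lt pn.
have := lv _ hs; rewrite saK // !handled_klt -?ec; try lia.
have := nx1_gt hs; have := nx_le hs.
rewrite /klt ek_border // ek_nx1 // ek_nx2 // /window => h1 h2 ->.
case: (leqP (nx2 (sa p)) (sa p + lc c + 1)) => h3.
  by rewrite !ifF //; lia.
case: (leqP (nx1 (sa p)) (sa p + lc c + 1)) => h4.
  by rewrite ifF ?ifT //; lia.
by rewrite ifT //; lia.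
Qed.

Lemma effect_mono q J bad mk bad' mk' : effect q J bad mk bad' mk' ->
  (bad' = 0 -> bad = 0) /\ (forall p, mk p <> 0 -> mk' p <> 0).
Proof.
move=> [-> ->]; split; first by case: ifP.
by move=> p; case: ifP => // _; rewrite /upd; case: ifP.
Qed.

Lemma effect_sound l r a bad mk bad' mk' : closed_block n lc l r a ->
  effect (qualified n sa k l r a) (answer sa nx1 nx2 l r a) bad mk bad' mk' ->
  sound bad mk -> sound bad' mk'.
Proof.
move=> cb [-> ->] [s1 s2]; split.
  by case: ifP => // /andP[q /eqP J0] _; apply: sound0 q cb J0.
move=> p p0; case: ifP => [/andP[q J0]|_]; last exact: s2.
rewrite /upd; case: eqP => [e _|_]; last exact: s2.
by apply: sound1 q cb p0 _; move: J0; rewrite e; case: (answer _ _ _ _ _ _).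
Qed.

Lemma effect_recorded l r a bad mk bad' mk' bad2 mk2 :
  effect (qualified n sa k l r a) (answer sa nx1 nx2 l r a) bad mk bad' mk' ->
  (bad2 = 0 -> bad' = 0) -> (forall p, mk' p <> 0 -> mk2 p <> 0) ->
  bad2 = 0 -> qualified n sa k l r a ->
  recorded sa nx1 nx2 (fun p => mk2 p != 0) l r a.
Proof.
move=> [e1 e2] h1 h2 /h1 b0 q; rewrite q /= in e1 e2; rewrite /recorded.
case: eqP e1 e2 => J0 e1 e2; first by rewrite b0 in e1.
by split=> //; apply/eqP/h2; rewrite e2 /upd /= eqxx.
Qed.

(** When c comes up, the boundaries already removed are those that [prec] puts before c. Hence the
    list neighbours of c delimit closed blocks, and they are the only ends that [left_recorded] and
    [right_recorded] can speak of. *)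
Lemma border_blocks u lf rt c : u < m3 -> c = ord (m3 - u - 1) -> c < n ->
  links n (alive u) lf rt ->
  [/\ lf c <= c, c < rt c <= n, closed_block n lc (lf c) c (lc c) &
      closed_block n lc c (rt c) (lc c)] /\
  (forall lo, lo < c -> (forall b, lo < b < c -> prec lc c b) -> prec lc lo c ->
     lo = lf c) /\
  (forall hi, c < hi <= n -> (forall b, c < b < hi -> prec lc c b) ->
     hi = n \/ prec lc hi c -> hi = rt c).
Proof.
move=> hu ec cn [lk0 lkl lkr].
have hdl b : b < n -> handled u b = prec lc c b.
  move=> bn; rewrite handled_klt //; last by lia.
  by rewrite -ec /klt !ek_border // /prec ltnS eqSS.
have alE b : 0 < b < n -> alive u b = ~~ prec lc c b.
  by move=> hb; rewrite /alive hdl; lia.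
have alc : alive u c by rewrite /alive hdl // /prec ltnn eqxx ltnn !orbT.
have dead b : 0 < b < n -> ~~ alive u b -> lc c <= lc b.
  by move=> hb; rewrite alE // /prec; clear -hb; lia.
have alv b : 0 < b < n -> alive u b -> b <> c -> lc b <= lc c.
  by move=> hb; rewrite alE // /prec; clear -hb; lia.
have [hr1 hr2 hr3] := lkr c cn alc.
have left_c : 0 < c -> [/\ lf c < c, alive u (lf c) &
    forall b', lf c < b' < c -> ~~ alive u b'].
  by move=> c0; apply: lkl => //; clear -c0 cn; lia.
clear lkl lkr hdl; split; last split.
- split=> //.
  + by case: (posnP c) => [->|/left_c[/ltnW]]; rewrite ?lk0.
  + case: (posnP c) => [->|c0].
      by rewrite lk0 lc0; split; [by [] | by move=> b; clear; lia | by left | by right; rewrite lc0].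
    have [h1 h2 h3] := left_c c0; split; [exact: ltnW | | | by right].
      by move=> b hb; apply: dead; [clear -hb cn; lia | apply: h3].
    case: (posnP (lf c)) => l0; [by left | right; apply: alv => //; clear -h1 l0 cn; lia].
  + split; [by case/andP: hr1 | | by right |].
      by move=> b hb; apply: dead; [clear -hb hr1; lia | apply: hr3].
    by case: (eqVneq (rt c) n) => [|ne]; [left | right; apply: alv => //; clear -ne hr1; lia].
- move=> lo lolt inner pl; have [h1 h2 h3] := left_c ltac:(clear -lolt; lia).
  case: (ltngtP lo (lf c)) => // h5.
    have := inner (lf c) ltac:(clear -h1 h5; lia).
    by move: h2; rewrite alE; [move=> /negbTE-> | clear -h1 h5 cn; lia].
  have := h3 lo ltac:(clear -h5 lolt; lia); rewrite alE; last by clear -h5 lolt cn; lia.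
  by move: pl; rewrite /prec; clear; lia.
- move=> hi hic inner pl.
  case: (ltngtP hi (rt c)) => // h5.
    have := hr3 hi ltac:(clear -h5 hic; lia); rewrite alE; last by clear -h5 hic hr1; lia.
    by case: pl => [|pl]; [clear -h5 hr1; lia | move: pl; rewrite /prec; clear; lia].
  have := inner (rt c) ltac:(clear -h5 hr1; lia).
  by move: hr2; rewrite alE; [move=> /negbTE-> | clear -h5 hic hr1; lia].
Qed.

Lemma answer_le l r a : r <= n -> answer sa nx1 nx2 l r a <= n.*2.+2.
Proof.
move=> rn; apply: join_bound => // p hp; rewrite /window.
have hs : sa p < n by apply: sa_lt; lia.
by have := nx_le hs; clear; case: ifP => _; [|case: ifP => _]; lia.
Qed.

(** The flag and the marks only grow, so earlier records survive; the two queries at c supply the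
    new ones. *)
Lemma invariant_border u c bad lf rt T mk bad1 mk1 bad2 mk2 :
  u < m3 -> c = ord (m3 - u - 1) -> c < n -> invariant u bad lf rt T mk ->
  effect (qualified n sa k (lf c) c (lc c)) (answer sa nx1 nx2 (lf c) c (lc c))
    bad mk bad1 mk1 ->
  effect (qualified n sa k c (rt c) (lc c)) (answer sa nx1 nx2 c (rt c) (lc c))
    bad1 mk1 bad2 mk2 ->
  invariant u.+1 bad2 (upd lf (rt c) (lf c)) (upd rt (lf c) (rt c)) T mk2.
Proof.
move=> hu ec cn [lk ok lv snd hl hr] ef1 ef2.
have hdlS e : handled u.+1 e = (e == c) || handled u e by rewrite ec; apply: handledS.
have [[_ hr1 cbl cbr] [lo_eq hi_eq]] := border_blocks hu ec cn lk.
have [b12 m12] := effect_mono ef1; have [b23 m23] := effect_mono ef2.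
split=> //.
- apply: (links_delete lk) => //; try by rewrite /alive eqxx ?orbT.
  + rewrite /alive handled_klt; [|exact: hu|clear -cn; lia].
    by rewrite -ec /klt ltnn eqxx ltnn !orbT.
  + move=> b; rewrite /alive hdlS.
    case: (b == 0) => //=; case: eqP => [->|_] /=; first by rewrite gtn_eqF.
    by rewrite negb_or andbC.
- move=> i hi; rewrite !hdlS lv // !(gtn_eqF (m := c)) //; clear -cn; lia.
- exact: effect_sound cbr ef2 (effect_sound cbl ef1 snd).
- move=> b bn; rewrite hdlS; case: eqP => [-> _|_ /= hb].
    move=> b0 lo lolt inner pl q.
    rewrite (lo_eq lo lolt inner pl) in q *.
    exact: (effect_recorded ef1 b23 m23 b0 q).
  move=> b0 lo h1 h2 h3 h4; have [j1 j2] := hl b bn hb (b12 (b23 b0)) lo h1 h2 h3 h4.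
  by split=> //; apply/eqP/m23/m12/eqP.
- move=> b bn; rewrite hdlS; case: eqP => [-> _|_ /= hb].
    move=> b0 hi hic inner pl q.
    rewrite (hi_eq hi hic inner pl) in q *.
    exact: (effect_recorded ef2 id (fun p h => h) b0 q).
  move=> b0 hi h1 h2 h3 h4; have [j1 j2] := hr b bn hb (b12 (b23 b0)) hi h1 h2 h3 h4.
  by split=> //; apply/eqP/m23/m12/eqP.
Qed.

Lemma invariant_leaf u c i v bad lf rt T T' mk :
  u < m3 -> c = ord (m3 - u - 1) -> i < n ->
  c = n + i /\ v = 0 \/ c = n + n + i /\ v = (nx1 i).+1 ->
  invariant u bad lf rt T mk -> tree_ok n T' ->
  (forall q, q < n -> T' (n + q) = if q == pos i then v else T (n + q)) ->
  invariant u.+1 bad lf rt T' mk.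
Proof.
move=> hu ec hi hc [lk ok lv snd hl hr] ok' lv'.
have hdlS e : handled u.+1 e = (e == c) || handled u e by rewrite ec; apply: handledS.
have nc : n <= c by clear -hc; case: hc => [[]|[]]; lia.
have same b : b < n -> handled u.+1 b = handled u b.
  by move=> bn; rewrite hdlS ltn_eqF //; apply: leq_trans nc.
have aE b : b <= n -> alive u.+1 b = alive u b.
  rewrite leq_eqVlt => /orP[/eqP->|bn]; first by rewrite /alive eqxx !orbT.
  by rewrite /alive same.
split=> //.
- have [h1 h2 h3] := lk.
  split=> // b hb; rewrite aE; try by clear -hb; lia.
    move=> /(h2 b hb)[j1 j2 j3]; split=> //; first by rewrite aE //; clear -j1 hb; lia.
    by move=> b' hb'; rewrite aE; [apply: j3 | clear -hb' hb; lia].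
  move=> /(h3 b hb)[j1 j2 j3]; split=> //; first by rewrite aE //; clear -j1 hb; lia.
  by move=> b' hb'; rewrite aE; [apply: j3 | clear -hb' j1; lia].
- move=> j hj; rewrite lv' ?pos_lt // lv // !hdlS.
  have -> : (pos j == pos i) = (j == i).
    by apply/eqP/eqP => [/(congr1 sa)|->//]; rewrite !posK.
  case: eqP => [->|ne]; last first.
    have -> : (n + j == c) = false by clear -hc hj hi ne; case: hc => [[]|[]]; lia.
    by have -> : (n + n + j == c) = false by clear -hc hj hi ne; case: hc => [[]|[]]; lia.
  case: hc => [[ec' ->]|[ec' ->]]; first by rewrite ec' eqxx.
  rewrite ec' eqxx /=; have -> : (n + i == n + n + i) = false by clear -n_gt0; lia.
  (* Since [nx1 i <= nx2 i], and by index in case of a tie, the event n + i comes after 2 n + i; a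
     leaf already at 0 is never raised to an atom. *)
  rewrite handled_klt //; last by clear -hi; lia.
  rewrite -ec; have := nx_le hi; rewrite /klt ec' ek_nx1 // ek_nx2 // => hle.
  by rewrite ifF //; clear -hle n_gt0; lia.
- by move=> b bn; rewrite same //; apply: hl.
- by move=> b bn; rewrite same //; apply: hr.
Qed.

Lemma sweep_eventP u r a t :
  constants r a -> r vt = u -> u < m3 ->
  invariant u (r vbad) (a LF) (a RT) (a TR) (a MK) ->
  wp w B sweep_event (fun r' a' t' =>
    invariant u.+1 (r' vbad) (a' LF) (a' RT) (a' TR) (a' MK) /\
    t' <= t + 50 * (trunc_log 2 n + 5)) r a t.
Proof.
move=> cst rt_ hu inv; have W1 : 8 < W by lia.
have [[rn rk_ rN] [aK aO aR] aS aN] := cst.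
have [c ec] : exists c, c = ord (m3 - u - 1) by eexists.
have cm : c < m3 by rewrite ec; apply: (mkseq_perm_lt ord_pm); lia.
have ok := inv_tree inv; have lv := inv_leaves inv; have lk := inv_links inv.
do 3!wp_step; rewrite rN rt_ aO -ec.
do 2!wp_step; rewrite aK; wp_step; rewrite rn => cn.
- have ekc : ek c = (lc c).+1 by rewrite ek_border.
  have aln := lc_lt cn.
  have leafE := border_leaves hu ec cn lv.
  have [[hl1 hr1 _ _] _] := border_blocks hu ec cn lk.
  have ansE lo hi : hi <= n ->
      \big[join/0]_(lo <= p < hi) a TR (n + p) = answer sa nx1 nx2 lo hi (lc c).
    by move=> hin; apply: eq_big_nat => p hp; apply: leafE; clear -hp hin; lia.
  have hln : a LF c <= n by clear -hl1 cn; lia.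
  have hrn : a RT c <= n by case/andP: hr1.
  do 8!wp_step.
  wp_step.
  set r1 := set (set _ vql _) vqr c.
  have c1 : constants r1 a by [].
  have ra1 : r1 va = (lc c).+1 by [].
  have J1 : \big[join/0]_(r1 vql <= p < r1 vqr) a TR (n + p) <= n.*2.+2.
    by rewrite ansE ?answer_le // ltnW.
  apply: (wp_conseq (guarded_queryP _ c1 ra1 aln hln (ltnW cn) ok J1)).
  rewrite /r1; simp; rewrite (ansE _ _ (ltnW cn)).
  move=> r2 a2 t2 [Fv2 Fa2] [ef1 ht2]; simp_in Fv2; simp_in Fa2.
  have r2e : r2 ve = c by rewrite Fv2.
  have r2j : r2 vj = a RT c by rewrite Fv2.
  have r2lo : r2 vlo = a LF c by rewrite Fv2.
  have a2T : a2 TR = a TR by rewrite Fa2.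
  do 4!wp_step; rewrite r2e r2j.
  wp_step.
  set r3 := set (set _ vql c) vqr _.
  have c3 : constants r3 a2.
    by split; [split|split| |]; rewrite /r3; simp; rewrite ?Fv2 ?Fa2.
  have ra3 : r3 va = (lc c).+1 by rewrite /r3; simp; rewrite Fv2.
  have J3 : \big[join/0]_(r3 vql <= p < r3 vqr) a2 TR (n + p) <= n.*2.+2.
    by rewrite a2T ansE ?answer_le.
  have ok2 : tree_ok n (a2 TR) by rewrite a2T.
  apply: (wp_conseq (guarded_queryP _ c3 ra3 aln (ltnW cn) hrn ok2 J3)).
  rewrite /r3; simp; rewrite a2T (ansE _ _ hrn).
  move=> r4 a4 t4 [Fv4 Fa4] [ef2 ht4]; simp_in Fv4; simp_in Fa4.
  have r4lo : r4 vlo = a LF c by rewrite Fv4.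
  have r4j : r4 vj = a RT c by rewrite Fv4.
  have a4L : a4 LF = a LF by rewrite Fa4 // Fa2.
  have a4R : a4 RT = a RT by rewrite Fa4 // Fa2.
  have a4T : a4 TR = a TR by rewrite Fa4 // Fa2.
  have inv' := invariant_border hu ec cn inv ef1 ef2.
  clear -inv' r4lo r4j a4L a4R a4T ht2 ht4 hln hrn nB BW W1.
  by do 3!wp_step; rewrite r4lo r4j a4L a4R a4T; split=> //; lia.
- have del i v r1 t1 : i < n -> r1 vn = n -> r1 vi = i -> r1 vv = v -> r1 vbad = r vbad ->
      t1 <= t + 8 ->
      c = n + i /\ v = 0 \/ c = n + n + i /\ v = (nx1 i).+1 ->
      wp w B (vp <-- Get RK (V vi) -! N 1 ;; tree_update) (fun r' a' t' =>
        invariant u.+1 (r' vbad) (a' LF) (a' RT) (a' TR) (a' MK) /\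
        t' <= t + 50 * (trunc_log 2 n + 5)) r1 a t1.
    move=> hi r1n r1i r1v r1b ht1 hc.
    have h0 := rk_gt0 hi; have pn := pos_lt hi.
    do 2!wp_step; first by rewrite aR r1i.
    rewrite aR r1i -/(pos i).
    apply: (wp_conseq (@tree_updateP _ _ _ BW nB (pos i) _ _ _ _ _ _ ok)) => //.
    move=> r2 a2 t2 [Fv2 Fa2]; simp_in Fv2; simp_in Fa2; simp; rewrite r1v.
    move=> [ok2 lv2 ht2]; split; last by clear -ht1 ht2; lia.
    rewrite (Fv2 vbad) // (Fa2 LF) // (Fa2 RT) // (Fa2 MK) //; simp; rewrite r1b.
    exact: (invariant_leaf hu ec hi hc inv ok2 lv2).
  have nc : n <= c by rewrite leqNgt.
  clear lv lk inv.
  do 6!wp_step; rewrite rn => ci.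
    wp_step; apply: (del (c - n) 0) => //; simp; [clear; lia|].
    by left; split=> //; rewrite subnKC.
  have hi : c - n - n < n by clear -cm ci nc; lia.
  have nc2 : n <= c - n by rewrite leqNgt.
  do 3!wp_step; rewrite ?rn //; try lia.
  + by have := nx_le hi; have := nx1_gt hi; rewrite aN //; lia.
  apply: (del (c - n - n) (nx1 (c - n - n)).+1) => //; simp; rewrite ?rn.
  + by rewrite aN // addn1.
  + by clear; lia.
  + by right; split=> //; clear -nc nc2; lia.
Qed.

Lemma sweepP r a t :
  constants r a ->
  (forall p, 0 < p -> a MK p = 0) ->
  wp w B sweep (fun r' a' t' => [/\ sound (r' vbad) (a' MK),
    forall b, b < n -> left_recorded (r' vbad) (a' MK) b,
    forall b, b < n -> right_recorded (r' vbad) (a' MK) b &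
    t' <= t + 200 * n * (trunc_log 2 n + 5)]) r a t.
Proof.
move=> cst mk0; have W1 : 8 < W by lia.
have [[rn rk_ rN] [aK aO aR] aS aN] := cst.
do 4!wp_step; rewrite rn.
apply: (@wp_forc _ _ 1 (fun i r' a' => forall q, q < i -> a' TR q = 1)) => //; simp; try lia.
  move=> i r1 a1 t1 hi _ r1i e1; wp_step; split; last by lia.
  by move=> q hq; rewrite /upd r1i; case: eqP => // ne; apply: e1; lia.
move=> r1 a1 t1 [Fv1 Fa1] _ e1 ht1; simp_in Fv1; simp_in Fa1.
have r1n : r1 vn = n by rewrite Fv1.
wp_step; apply: (@wp_forc _ _ 2 (fun i r' a' => forall q, q < i ->
   a' RT q = q.+1 /\ a' LF q.+1 = q)) => //; simp; rewrite ?r1n; try lia.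
  move=> i r2 a2 t2 hi _ r2i e2; do 3!wp_step; split; last by lia.
  move=> q hq; rewrite /upd r2i addn1 eqSS; case: eqP => [->//|ne].
  by apply: e2; lia.
move=> r2 a2 t2 [Fv2 Fa2] _ e2 ht2; simp_in Fv2; simp_in Fa2.
have r2n : r2 vn = n by rewrite Fv2.
have r2N : r2 vN = m3 by rewrite Fv2 //= Fv1.
do 4!wp_step.
apply: (@wp_forc _ _ (50 * (trunc_log 2 n + 5)) (fun u r' a' =>
  invariant u (r' vbad) (a' LF) (a' RT) (a' TR) (a' MK))) => //; simp; rewrite ?r2N; try lia.
- have h0 e : handled 0 e = false.
    by rewrite /handled subn0 drop_oversize // size_mkseq.
  have aT q : q < n + n -> a2 TR q = 1 by move=> hq; rewrite Fa2 //; apply: e1.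
  split.
  + split.
    * by [].
    * move=> b hb _; rewrite /upd ifF; last by lia.
      have [_] := e2 b.-1 ltac:(lia); rewrite prednK; last by lia.
      move=> ->; split; [lia | by rewrite /alive h0 !orbT | by move=> b'; lia].
    * move=> b hb _; have [-> _] := e2 b hb.
      by split; [lia | by rewrite /alive h0 !orbT | by move=> b'; lia].
  + by move=> x hx; rewrite !aT //; lia.
  + by move=> i hi; rewrite !h0 aT //; have := pos_lt hi; lia.
  + by split=> // p p0; rewrite Fa2 //= Fa1 //= mk0.
  + by move=> b bn; rewrite h0.
  + by move=> b bn; rewrite h0.
- move=> u r3 a3 t3 hu [Fv3 Fa3] r3t inv; simp_in Fv3; simp_in Fa3.
  have c3 : constants r3 a3.
    split; [split|split| |]; rewrite ?(Fv3, Fa3) //= ?(Fv2, Fa2) //= ?(Fv1, Fa1) //=.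
  apply: (wp_conseq (sweep_eventP t3 c3 r3t ltac:(lia) inv)) => r4 a4 t4 _ [inv4 ht4].
  by split=> //; simp.
- move=> r3 a3 t3 _ _ [_ _ _ snd hl hr] ht3.
  have all_h e : e < m3 -> handled m3 e.
    by move=> he; rewrite /handled subnn drop0 (perm_mem ord_pm) mem_iota.
  split=> //.
  + by move=> b bn; apply: hl => //; apply: all_h; lia.
  + by move=> b bn; apply: hr => //; apply: all_h; lia.
  + move: ht1 ht2 ht3 n_gt0; clear; nia.
Qed.

End Sweep.

(** * The complete program and its cost *)

Definition final_check :=
  For vj (N 0) vgs (
    vc <-- Get IN (V vn +! V vj +! N 4) ;;
    If (Eq (Get MK (V vc)) (N 0)) (vbad <-- N 1) Skip).

Definition main_cmd :=
  vn <-- Get IN (N 0) ;; vk <-- Get IN (N 2) ;; vgs <-- Get IN (N 3) ;;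
  word_bits ;; suffix_sort ;; kasai ;; make_events ;; sweep ;; final_check.

(** Loads the array length 4 n + 8 into register [nvar]. Array 0 starts at address 0 and so is the
    input in place; the input has at most 2 n + 4 words, hence all other arrays start blank. *)
Definition prologue : seq instr :=
  [:: Const 60 0; Read 60 60; Const 61 4; Bin OpMul 60 60 61;
      Const 61 8; Bin OpAdd nvar 60 61].

Definition epilogue (q : nat) : seq instr :=
  [:: Const 60 0; Jeq vbad 60 (q + 3); Halt false; Halt true].

Definition checker : program :=
  prologue ++ cmd_code main_cmd 6 ++
  epilogue (6 + cmd_size main_cmd).

Section Main.
Variables (w n k : nat) (x g : seq nat) (G : pred nat).
Local Notation W := (2 ^ w).
Local Notation B := (4 * n + 8).
Local Notation X := (nth 0 x).
Hypothesis BW : 16 * B < W.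
Hypothesis n_gt0 : 0 < n.
Hypothesis size_x : size x = n.
Hypothesis x_in : forall c, c \in x -> 0 < c < W.
Hypothesis gG : g =i G.
Hypothesis uniq_g : uniq g.
Hypothesis G_in : forall p, G p -> 0 < p <= n.

Let wW : w < W. Proof. exact: ltn_expl. Qed.

Let X_lt i : X i < W.
Proof.
case: (ltnP i n) => hi; last by rewrite nth_default ?size_x // expn_gt0.
by have /x_in/andP[] : X i \in x by rewrite mem_nth // size_x.
Qed.

Let X_in i : i < n -> 0 < X i.
Proof. by move=> hi; have /x_in/andP[] : X i \in x by rewrite mem_nth // size_x. Qed.

Let X_out i : n <= i -> X i = 0.
Proof. by move=> hi; rewrite nth_default // size_x. Qed.

Let size_g : size g <= n.
Proof.
have sub : {subset g <= iota 1 n} by move=> p; rewrite gG mem_iota => /G_in; lia.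
by have := uniq_leq_size uniq_g sub; rewrite size_iota.
Qed.

Lemma final_checkP r a t : r vn = n -> r vgs = size g ->
  (forall j, j < size g -> a IN (n + j + 4) = nth 0 g j) ->
  wp w B final_check (fun r' a' t' =>
    (r' vbad == 0) = (r vbad == 0) && all (fun p => a MK p != 0) g /\
    t' <= t + 5 * n + 2) r a t.
Proof.
move=> rn rg hin; have W1 : 8 < W by lia.
wp_step; apply: (@wp_forc _ _ 3 (fun j r' a' =>
  (r' vbad == 0) = (r vbad == 0) && all (fun p => a MK p != 0) (take j g))) => //;
  simp; rewrite ?rg; try lia.
- by rewrite take0 andbT.
- move=> j r1 a1 t1 hj [Fv Fa] r1j e1; simp_in Fv; simp_in Fa.
  have r1n : r1 vn = n by rewrite Fv.
  have jg : j < size g by lia.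
  have gj : a1 IN (r1 vn + r1 vj + 4) = nth 0 g j by rewrite Fa // r1n r1j hin.
  have : nth 0 g j \in g by apply: mem_nth.
  rewrite gG => /G_in hp.
  have aM : a1 MK = a MK by rewrite Fa.
  do 2!wp_step; rewrite gj.
  wp_step; rewrite aM => h; wp_step; (split; last by lia);
    rewrite (take_nth 0 jg) all_rcons.
    by rewrite h andbF.
  by rewrite h e1.
- move=> r1 a1 t1 _ _; rewrite take_size => e1 ht; split=> //.
  by move: size_g ht; clear; lia.
Qed.

Local Notation lgn := (trunc_log 2 n).
Local Notation covers := (covers W n X).

Lemma main_cmdP r a :
  a IN 0 = n -> a IN 2 = k -> a IN 3 = size g ->
  (forall i, i < n -> a IN (i + 4) = X i) ->
  (forall j, j < size g -> a IN (n + j + 4) = nth 0 g j) ->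
  (forall j i, 0 < j -> a j i = 0) ->
  wp w B main_cmd (fun r' a' t' =>
    ((r' vbad == 0) <-> (covers G k /\
       forall p, G p -> ~ covers (fun q => G q && (q != p)) k)) /\
    t' <= 3 * w + 20 * (w + 1) * (n + 1) + 20 * (w + 1) * (3 * n + 1) +
          (lgn + 3) * (40 * n + 40) + 200 * n * (lgn + 5) + 50 * n + 50) r a 0.
Proof.
move=> hn hk hg hX hgs h0; have W1 : 8 < W by lia.
have nB : 4 * n + 8 <= B by [].
do 7!wp_step; rewrite hn hk hg.
set r1 := set (set _ _ _) _ _.
wp_step; apply: (wp_conseq (word_bitsP BW wW nB r1 a 3)) => r2 a2 t2 [Fv2 Fa2] [r2w ht2].
simp_in Fv2; simp_in Fa2.
wp_step; apply: (wp_conseq (suffix_sortP (r := r2) (a := a2) X_lt X_in X_out BW wW nB t2 n_gt0 _ r2w _ _ _)).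
- by rewrite Fv2.
- by move=> i hi; rewrite Fa2 // hX.
- by move=> i hi; rewrite Fa2 // h0.
- by move=> i hi; rewrite Fa2 // h0.
move=> r3 a3 t3 [Fv3 Fa3] [[L leL [pm srt rkE]] aX ht3]; simp_in Fv3; simp_in Fa3.
have r3n : r3 vn = n by rewrite Fv3 // Fv2.
have r3w : r3 vw = w by rewrite Fv3.
wp_step; apply: (wp_conseq (kasaiP n_gt0 X_lt X_in X_out leL pm srt rkE BW nB t3 r3n erefl erefl aX)).
move=> r4 a4 t4 [Fv4 Fa4] [lcE ht4]; simp_in Fv4; simp_in Fa4.
set sa := a3 ORD in pm srt lcE; set rk := a3 RK in rkE.
have sa_lt p := mkseq_perm_lt (p := p) pm.
have sa_mono := sorted_sa_mono n_gt0 X_lt X_in X_out leL pm srt.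
have pos_lt := sorted_pos_lt n_gt0 X_lt X_in X_out leL pm srt rkE.
have posK := sorted_posK n_gt0 X_lt X_in X_out leL pm srt rkE.
have rank := sorted_rank n_gt0 X_lt X_in X_out leL pm srt rkE.
pose lc p := (a4 KEY p).-1.
have keyE p : p < n -> a4 KEY p = (lc p).+1.
  by move=> /lcE; rewrite /lcp_entry /lc; case: eqP => [_ ->//|_ [h _ _]]; rewrite prednK.
have lc0 : lc 0 = 0 by have := lcE 0 n_gt0; rewrite /lcp_entry /lc eqxx => ->.
have lcP p : 0 < p < n -> key W X (lc p) (sa p.-1) = key W X (lc p) (sa p) /\
    X (sa p.-1 + lc p) <> X (sa p + lc p).
  by case/andP=> p0 /lcE; rewrite /lcp_entry gtn_eqF // => -[_ h1 h2].
have lc_n p : p < n -> lc p < n by apply: (lc_lt X_lt X_in X_out leL sa_lt sa_mono lc0 lcP).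
wp_step; apply: (wp_conseq (make_eventsP (G := G) (g := g) (r := r4) (a := a4) n_gt0 BW wW nB t4 _ _ _ size_g G_in gG _ _ _)).
- by rewrite Fv4.
- by rewrite Fv4.
- by rewrite Fv4 // Fv3 // Fv2.
- by move=> j hj; rewrite Fa4 // Fa3 // Fa2 // hgs.
- by move=> i; rewrite Fa4 // Fa3 // Fa2 // h0.
- by move=> i hi; rewrite keyE //; have := lc_n i hi; lia.
move=> r5 a5 t5 [Fv5 Fa5] [[r5N ekb ek1 ek2 nxE] saE pmE srtE ht5]; simp_in Fv5; simp_in Fa5.
have nspec := next_spec G_in.
have nx1_gt i : i < n -> i < next1 n G i by case/nspec.
have nx_le i : i < n -> next1 n G i <= next2 n G i <= n.*2.+1.
  move=> /nspec[_ _ _ [_ h _]].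
  have := (scan_le n G (n - i)).1; have := (scan_le n G (n - i)).2.
  rewrite -/(next1 n G i) -/(next2 n G i); lia.
have nx1_min i p : i < n -> G p -> i < p -> next1 n G i <= p.
  by move=> /nspec[_ _ h _]; apply: h.
have nx2_min i p : i < n -> G p -> next1 n G i < p -> next2 n G i <= p.
  by move=> /nspec[_ _ _ [_ _ h]]; apply: h.
have cst : constants n k sa rk (next1 n G) (a5 KEY) (a5 ORD) r5 a5.
  split; [split|split| |] => //.
  - by rewrite Fv5 // Fv4.
  - by rewrite Fv5 // Fv4 // Fv3 // Fv2.
  - by rewrite Fa5 // Fa4.
  - by move=> i hi; rewrite saE // Fa4.
have saK p : p < n -> rk (sa p) - 1 = p by move=> hp; rewrite rank // subn1.
have rk_gt0 i : i < n -> 0 < rk i by move=> hi; rewrite rkE /krank hi.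
have ekb' b : b < n -> a5 KEY b = (lc b).+1 by move=> hb; rewrite ekb // keyE.
have S0 := answer0_sound X_lt X_in X_out leL sa_lt sa_mono pos_lt posK lc0 lcP n_gt0
  nx1_gt nx1_min nx2_min (k := k).
have S1 := answer1_sound X_lt X_in X_out leL sa_lt sa_mono pos_lt posK lc0 lcP n_gt0
  nx1_gt nx1_min nx2_min (k := k).
wp_step; apply: (wp_conseq (sweepP BW nB n_gt0 sa_lt rk_gt0 pos_lt posK saK lc0 lc_n nx1_gt nx_le
  ekb' ek1 ek2 pmE srtE S0 S1 t5 cst _)).
  by move=> p _; rewrite Fa5 // Fa4 // Fa3 // Fa2 // h0.
move=> r6 a6 t6 [Fv6 Fa6] [[snd0 snd1] recl recr ht6]; simp_in Fv6; simp_in Fa6.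
have r6n : r6 vn = n by rewrite Fv6 // Fv5 // Fv4.
have r6g : r6 vgs = size g by rewrite Fv6 // Fv5 // Fv4 // Fv3 // Fv2.
have a6I j : j < size g -> a6 IN (n + j + 4) = nth 0 g j.
  by move=> hj; rewrite Fa6 // Fa5 // Fa4 // Fa3 // Fa2 // hgs.
apply: (wp_conseq (final_checkP t6 r6n r6g a6I)) => r7 a7 t7 _ [badE ht7].
split; last by move: ht2 ht3 ht4 ht5 ht6 ht7; clear; lia.
have nx1_in i : i < n -> G (next1 n G i) \/ next1 n G i = n.*2.+1 by case/nspec.
have nx2_in i : i < n -> G (next2 n G i) \/ next2 n G i = n.*2.+1.
  by case/nspec=> _ _ _ [].
have nx2_gt i : i < n -> next1 n G i < next2 n G i \/ next2 n G i = n.*2.+1.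
  by case/nspec=> _ _ _ [].
have complete : r6 vbad = 0 -> covers G k /\
    forall p, a6 MK p = 0 -> covers (fun q => G q && (q != p)) k.
  move=> b0.
  have rl l b : l < b < n -> (forall b', l < b' < b -> prec lc b b') -> prec lc l b ->
      qualified n sa k l b (lc b) ->
      recorded sa (next1 n G) (next2 n G) (fun p => a6 MK p != 0) l b (lc b).
    by case/andP=> lb bn; apply: (recl b bn b0).
  have rr b r' : b < r' <= n -> (forall b', b < b' < r' -> prec lc b b') ->
      r' = n \/ prec lc r' b -> qualified n sa k b r' (lc b) ->
      recorded sa (next1 n G) (next2 n G) (fun p => a6 MK p != 0) b r' (lc b).
    move=> hb; apply: (recr b _ b0) => //; clear -hb; lia.
  split.
    exact: (recorded_covers X_lt leL sa_lt sa_mono pos_lt posK lc0 lcP n_gt0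
      nx1_in nx1_gt nx2_in nx2_gt rl rr).
  move=> p p0; apply: (recorded_minimal X_lt leL sa_lt sa_mono pos_lt posK lc0 lcP n_gt0
    nx1_in nx1_gt nx2_in nx2_gt rl rr).
  by rewrite p0.
rewrite badE; split.
  case/andP=> /eqP b0 /allP mk; split; first by case: (complete b0).
  move=> p Gp; apply: snd1; first by case/andP: (G_in Gp).
  by apply/eqP/mk; rewrite gG.
move=> [cov mini]; have b0 : r6 vbad = 0.
  by case: (eqVneq (r6 vbad) 0) => // /eqP/snd0.
rewrite b0 eqxx /=; apply/allP => p; rewrite gG => Gp.
apply/eqP => mk0; case: (mini p Gp); exact: (complete b0).2.
Qed.

End Main.

Lemma covers_ext W n X (G G' : pred nat) k : G =1 G' ->
  covers W n X G k -> covers W n X G' k.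
Proof.
move=> e h i l l0 lk il; have [i' [p [h1 h2 h3]]] := h i l l0 lk il.
by exists i', p; rewrite -e.
Qed.

(** Passes from one-based inclusive ranges to zero-based starts and lengths. Letters are positive,
    so the end marker cannot be mistaken for a letter, and an occurrence found through keys lies
    within the string. *)
Lemma k_attractorP W x (Gamma : {fset nat}) k :
  (forall i, nth 0 x i < W) -> (forall c, c \in x -> 0 < c) ->
  (forall p, p \in Gamma -> 1 <= p <= size x) ->
  k_attractor k x Gamma <-> covers W (size x) (nth 0 x) (fun p => p \in Gamma) k.
Proof.
move=> X_lt x_in G_in; set n := size x.
have X_in i : i < n -> 0 < nth 0 x i by move=> hi; apply/x_in/mem_nth.
have X_out i : n <= i -> nth 0 x i = 0 by move=> hi; rewrite nth_default.
have size_sub i l : i + l <= n -> size (take l (drop i x)) = l.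
  by move=> h; rewrite size_take size_drop -/n; case: ltnP; lia.
have keyE i i' l : i + l <= n -> i' + l <= n ->
    key W (nth 0 x) l i = key W (nth 0 x) l i' <-> take l (drop i x) = take l (drop i' x).
  move=> h h'; split=> e.
    apply: (@eq_from_nth _ 0); first by rewrite !size_sub.
    move=> t; rewrite size_sub // => tl; rewrite !nth_take // !nth_drop.
    exact: (key_eq_letter X_lt e).
  apply: (key_eqP X_lt) => t tl.
  by have := congr1 (fun s => nth 0 s t) e; rewrite !nth_take // !nth_drop.
split.
- move=> [_ h] i l l0 lk il.
  have [||||i' [j' [p [[h1 h2 h3] [e Gp hp]]]]] := h i.+1 (i + l); try lia.
  have el : (i + l).+1 - i.+1 = l by lia.
  move: e; rewrite /substr el /= => e.
  have el' : j'.+1 - i' = l.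
    by have := congr1 size e; rewrite !size_sub //; lia.
  exists i'.-1, p; split=> //; last by lia.
  rewrite el' in e.
  by apply/keyE => //; lia.
- move=> h; split=> // i j i0 ij jn jk.
  have [|||i' [p [e Gp hp]]] := h i.-1 (j.+1 - i); try lia.
  have fit := key_eq_fits X_lt X_in X_out _ (esym e).
  have {}fit : i' + (j.+1 - i) <= n by apply: fit; lia.
  exists i'.+1, (i' + (j.+1 - i)), p; split; first by split; lia.
  split=> //.
  rewrite /substr; have -> : (i' + (j.+1 - i)).+1 - i'.+1 = j.+1 - i by lia.
  by apply/keyE => //; lia.
Qed.

Lemma code_at_mid l1 l l2 : code_at (l1 ++ l ++ l2) (size l1) l.
Proof.
move=> i I h; rewrite onth_cat ltnNge leq_addr /= addKn onth_cat.
by case: ltnP => // le; rewrite onth_default in h.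
Qed.

Lemma prologueP w n P (m : nat -> nat) :
  16 * (4 * n + 8) < 2 ^ w -> m 0 = n -> (forall i, m i < 2 ^ w) ->
  code_at P 0 prologue ->
  exists2 rl, related w (4 * n + 8) (fun=> 0) (fun j i => m (j * (4 * n + 8) + i)) rl m &
    reach w (4 * n + 8) P (Config 0 (fun=> 0) m) (Config 6 rl m) 6.
Proof.
move=> BW m0 mW; set B := 4 * n + 8.
move=> /code_at_cons[h1 /code_at_cons[h2 /code_at_cons[h3 /code_at_cons[h4 /code_at_cons[h5 /code_at_cons[h6 _]]]]]].
have eB : (n * 4 + 8) = B by lia.
eexists; last first.
  do 5!(apply: (@reach_trans _ _ _ _ _ _ 1); first by apply: reach_step; [eassumption | by [] | by rewrite /= /upd /= ?mod0n /narr /B; lia | reflexivity]).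
  by apply: reach_step; [eassumption | by [] | by [] | reflexivity].
have sm c : c <= 16 * B -> c %% 2 ^ w = c by move=> h; rewrite modn_small //; lia.
rewrite /= /eval_binop /upd /= mod0n m0 !sm; try lia.
split=> //.
- by move=> v hv; rewrite !ifF //; apply/negbTE; move: hv; rewrite /nvar; lia.
- by move=> v; repeat (case: ifP => _; first by lia); lia.
Qed.

Lemma run_epilogue w P q (r m : nat -> nat) :
  code_at P q (epilogue q) -> run w P (Config q r m) 3 0 (r vbad == 0).
Proof.
move=> /code_at_cons[f1 /code_at_cons[f2 /code_at_cons[f3 /code_at_cons[f4 _]]]].
have zero c I t v : onth P (pc c) = Some I -> (forall b, I <> Halt b) ->
    extent I c = 0 -> run w P (step w I c) t 0 v -> run w P c t.+1 0 v.
  by move=> h1 h2 h3 h4; rewrite -[0]/(maxn 0 0) -{1}h3; apply: run_step h4.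
apply: (zero (Config q r m) _ _ _ f1) => //=.
apply: (zero (Config q.+1 _ m) _ _ _ f2) => //=.
rewrite /upd /= mod0n addn3; case: eqP => _; exact: run_halt.
Qed.

(** The 9 counts the 6 instructions of [prologue] and the 3 executed in [epilogue]; every elementary
    step in between takes at most 40. *)
Lemma checker_computes w n k sigma (x g : seq nat) (G : pred nat) :
  0 < n -> size x = n -> 16 * (4 * n + 8) < 2 ^ w -> sigma < 2 ^ w -> k < 2 ^ w ->
  (forall c, c \in x -> 0 < c < 2 ^ w) -> g =i G -> uniq g ->
  (forall p, G p -> 0 < p <= n) ->
  let lgn := trunc_log 2 n in
  let X := nth 0 x in
  exists v time space,
    [/\ computes w checker (encode sigma k x g) v time space,
        v <-> (covers (2 ^ w) n X G k /\
               forall p, G p -> ~ covers (2 ^ w) n X (fun q => G q && (q != p)) k),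
        time <= 9 + 40 * (3 * w + 20 * (w + 1) * (n + 1) + 20 * (w + 1) * (3 * n + 1) +
          (lgn + 3) * (40 * n + 40) + 200 * n * (lgn + 5) + 50 * n + 50) &
        space <= 16 * (4 * n + 8)].
Proof.
move=> n0 sx BW sW kW xin gG ug Gin lgn X.
set B := 4 * n + 8 in BW *.
have w0 : 0 < w by case: (posnP w) BW => // ->; rewrite expn0; lia.
pose m := memory (init w (encode sigma k x g)).
have mE i : m i = nth 0 (encode sigma k x g) i %% 2 ^ w by [].
have gn : size g <= n.
  have sub : {subset g <= iota 1 n} by move=> p; rewrite gG mem_iota => /Gin; lia.
  by have := uniq_leq_size ug sub; rewrite size_iota.
have szE : size (encode sigma k x g) = 4 + (n + size g).
  by rewrite /encode !size_cat sx.
have mW i : m i < 2 ^ w by rewrite mE ltn_mod expn_gt0.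
have sm c : c <= 16 * B -> c %% 2 ^ w = c by move=> h; rewrite modn_small //; lia.
have m0 : m 0 = n by rewrite mE /encode /= sx sm //; lia.
have mx i : i < n -> m (i + 4) = X i.
  move=> hi; rewrite mE /encode addn4 /= nth_cat sx hi modn_small //.
  by have /xin/andP[] : nth 0 x i \in x by rewrite mem_nth // sx.
have mg j : j < size g -> m (n + j + 4) = nth 0 g j.
  move=> hj; rewrite mE /encode addn4 /= nth_cat sx.
  rewrite ltnNge leq_addr /= addKn sm //.
  by have : nth 0 g j \in g by [apply: mem_nth]; rewrite gG => /Gin; lia.
have cp : code_at checker 0 prologue by apply: (@code_at_mid [::]).
have [rl R G0] := prologueP BW m0 mW cp.
pose a j i := m (j * B + i).
have [||||||r' [a' [t [ex [spec ht]]]]] :=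
  @main_cmdP w n k x g G BW n0 sx xin gG ug Gin (fun=> 0) a.
- by rewrite /a mul0n.
- by rewrite /a mul0n mE /= modn_small.
- by rewrite /a mul0n mE /= sm //; lia.
- by move=> i hi; rewrite /a mul0n mx.
- by move=> j hj; rewrite /a mul0n mg.
- move=> j i j0; rewrite /a mE nth_default ?mod0n // szE.
  by have : B <= j * B by [rewrite leq_pmull]; lia.
have cw : cmd_wf 40 main_cmd by vm_compute.
have cat_ : code_at checker 6 (cmd_code main_cmd 6) by apply: (@code_at_mid prologue).
have [rl' [ml' [s [R' hs G1]]]] := cmd_codeP w0 BW ex R cw cat_.
have ce : code_at checker (6 + cmd_size main_cmd) (epilogue (6 + cmd_size main_cmd)).
  have := @code_at_mid (prologue ++ cmd_code main_cmd 6)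
    (epilogue (6 + cmd_size main_cmd)) [::].
  by rewrite size_cat size_cmd_code cats0 -catA.
have fin := run_epilogue w rl' ml' ce.
rewrite (rel_var R') // in fin.
have [m2 l2 run2] := G1 _ _ _ fin; have [m1 l1 run1] := G0 _ _ _ run2.
exists (r' vbad == 0), (6 + (s + 3)), (maxn (size (encode sigma k x g)) m1); split.
- by exists m1; split.
- exact: spec.
- rewrite add0n in ht; have : 40 * t <= 40 * (3 * w + 20 * (w + 1) * (n + 1) + 20 * (w + 1) * (3 * n + 1) +
          (lgn + 3) * (40 * n + 40) + 200 * n * (lgn + 5) + 50 * n + 50) by rewrite leq_mul2l ht orbT.
  by move: hs; clear; lia.
- rewrite geq_max szE; apply/andP; split; first by rewrite /B; lia.
  by move: l1 l2; rewrite /narr; clear; lia.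
Qed.

Theorem theorem27 :
  exists (P : program) (c0 : nat), forall c1 : nat, exists C : nat,
  forall (n w sigma k : nat) (x : seq nat) (Gamma : {fset nat}) (g : seq nat),
    0 < n -> size x = n ->
    c0 * lg n <= w <= c1 * lg n ->
    sigma < 2 ^ w -> (forall a, a \in x -> 1 <= a <= sigma) ->
    (forall p, p \in Gamma -> 1 <= p <= n) ->
    uniq g -> g =i Gamma ->
    1 <= k < 2 ^ w ->
    exists (v : bool) (time space : nat),
      [/\ computes w P (encode sigma k x g) v time space,
          v <-> minimal_k_attractor k x Gamma,
          time <= C * (n * lg n)
        & space <= C * (n * lg #|` Gamma|)].
Proof.
(* With w at least 20 [lg n] there are at least 2^(9 + [lg n]) addresses, more than the 16 arrays of
   4 n + 8 cells occupy. The dependence on [c1] pays for the radix sorts, whose cost is proportional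
   to n w. *)
exists checker, 20 => c1; exists (100 * (1000 * (c1 + 1))) => n w sigma k x Gamma g n0 sx.
move=> /andP[w_lo w_hi] sW xin Gin ug gG /andP[k0 kW].
have lg_gt0 m : 0 < lg m by rewrite /lg leq_max.
have tl_le : trunc_log 2 n <= lg n by rewrite /lg leq_maxr.
have n_lt : n < 2 ^ (lg n).+1.
  apply: leq_trans (trunc_log_ltn n (isT : 1 < 2)) _.
  by rewrite leq_exp2l // ltnS.
have BW : 16 * (4 * n + 8) < 2 ^ w.
  have : 2 ^ (8 + (lg n).+1) <= 2 ^ w by rewrite leq_exp2l //; have := lg_gt0 n; lia.
  by rewrite expnD -[2 ^ 8]/256; lia.
have x_in c : c \in x -> 0 < c < 2 ^ w by move/xin; lia.
have X_lt i : nth 0 x i < 2 ^ w.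
  case: (ltnP i (size x)) => hi; last by rewrite nth_default // expn_gt0.
  by have /x_in/andP[] := mem_nth 0 hi.
have x_pos c : c \in x -> 0 < c by move/x_in/andP=> [].
have [v [time [space [cmp spec ht hs]]]] :=
  @checker_computes w n k sigma x g (fun p => p \in Gamma) n0 sx BW sW kW x_in gG ug Gin.
exists v, time, space; split=> //.
- have attr D : {subset D <= Gamma} ->
      k_attractor k x D <-> covers (2 ^ w) n (nth 0 x) (fun p => p \in D) k.
    move=> sub; rewrite -sx; apply: k_attractorP => // p /sub; rewrite sx; exact: Gin.
  have attrD p : k_attractor k x (Gamma `\ p)%fset <->
      covers (2 ^ w) n (nth 0 x) (fun q => (q \in Gamma) && (q != p)) k.
    have e q : (q \in (Gamma `\ p)%fset) = (q \in Gamma) && (q != p).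
      by rewrite in_fsetD1 andbC.
    have h := attr (Gamma `\ p)%fset _; split=> hh.
      by apply: (covers_ext e); apply/h => // q; rewrite e => /andP[].
    apply/h; first by move=> q; rewrite e => /andP[].
    exact: (covers_ext (fun q => esym (e q))).
  rewrite spec /minimal_k_attractor; split=> -[h1 h2]; split; try exact/attr.
    by move=> p Gp /attrD; apply: h2.
  by move=> p Gp /attrD; apply: h2.
- apply: leq_trans ht _.
  have l0 := lg_gt0 n; set l := lg n in tl_le l0 w_hi *; set u := trunc_log 2 n in tl_le *.
  have hw : w * n <= c1 * (n * l) by rewrite [n * l]mulnC mulnA leq_mul2r w_hi orbT.
  have hw' : w <= c1 * (n * l) by apply: leq_trans hw; rewrite leq_pmulr.
  have hu : u * n <= n * l by rewrite mulnC leq_mul2l tl_le orbT.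
  have hn : n <= n * l by rewrite leq_pmulr.
  have hl : l <= n * l by rewrite leq_pmull.
  have -> : 20 * (w + 1) * (n + 1) = 20 * (w * n) + 20 * w + 20 * n + 20 by lia.
  have -> : 20 * (w + 1) * (3 * n + 1) = 60 * (w * n) + 20 * w + 60 * n + 20 by lia.
  have -> : (u + 3) * (40 * n + 40) = 40 * (u * n) + 40 * u + 120 * n + 120 by lia.
  have -> : 200 * n * (u + 5) = 200 * (u * n) + 1000 * n by lia.
  have -> : 100 * (1000 * (c1 + 1)) * (n * l) =
    100 * (1000 * (c1 * (n * l))) + 100 * (1000 * (n * l)) by lia.
  move: hw hw' hu hn hl tl_le n0; clear; move: (n * l) => q.
  by move: (w * n) (u * n) (c1 * q) => wn un cq; lia.
- apply: leq_trans hs _.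
  (* The space 64 n + 128 is at most 192 n because n is positive. *)
  apply: (@leq_trans (192 * n)); first by lia.
  apply: leq_mul; first by lia.
  by rewrite leq_pmulr.
Qed.
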